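(* Let $K_1,\dots,K_n\in\mathcal F_0$ and $\phi\in GL(n)$. Then for all $\alpha\in\{1,2,3\}$ and all real $p\ne-n$, $$G_p^{(\alpha)}(\phi K_1,\dots,\phi K_n)=|\det(\phi)|^{\frac{n-p}{n+p}}\,G_p^{(\alpha)}(K_1,\dots,K_n).$$ In particular, $G_p^{(\alpha)}(K_1,\dots,K_n)$ for $\alpha=1,2,3$ are affine invariant: if $\phi\in SL(n)$, then $G_p^{(\alpha)}(\phi K_1,\dots,\phi K_n)=G_p^{(\alpha)}(K_1,\dots,K_n)$.
   Context: Notation in $\mathbb R^n$: $S^{n-1}$ is the unit sphere with spherical measure $\sigma$ and $|\cdot|$ is volume. $GL(n)$ is the group of nonsingular linear transformations of $\mathbb R^n$ and $SL(n)$ the special linear group. $\mathcal K_0$ is the set of convex bodies (compact convex sets) containing the origin in their interior. For $K\in\mathcal K_0$: $h_K(u)=\max_{x\in K}\langle x,u\rangle$ and $K^\circ=\{x:\langle x,y\rangle\le1\ \forall y\in K\}$, with radial function $\rho_{K^\circ}=1/h_K$ on $S^{n-1}$. $\mathcal F_0$ is the set of $K\in\mathcal K_0$ whose surface area measure $S(K,\cdot)$ on $S^{n-1}$ is absolutely continuous with respect to $\sigma$, with density $f_K$ (curvature function); $f_p(K,u)=h_K(u)^{1-p}f_K(u)$ for $p\in\mathbb R$. For $\mathbf K=(K_1,\dots,K_n)\in\mathcal F_0^n$ and $\mathbf L=(L_1,\dots,L_n)\in\mathcal K_0^n$, $$V_p(\mathbf K;\mathbf L)=\frac1n\int_{S^{n-1}}\prod_{i=1}^n\big[h_{L_i}(u)^pf_p(K_i,u)\big]^{\frac1n}d\sigma(u),\qquad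 \widetilde V(\mathbf L^\circ)=\frac1n\int_{S^{n-1}}\prod_{i=1}^n\rho_{L_i^\circ}(u)\,d\sigma(u).$$ Mixed $L_p$ geominimal surface areas. For $p=0$ and $\alpha=1,2,3$: $G_0^{(\alpha)}(K_1,\dots,K_n)=\int_{S^{n-1}}\prod_{i=1}^n[f_{K_i}(u)h_{K_i}(u)]^{\frac1n}d\sigma(u)$. For $p>0$: $$G_p^{(1)}(K_1,\dots,K_n)=\inf_{L\in\mathcal K_0}\Big\{nV_p(\mathbf K;L,\dots,L)^{\frac n{n+p}}|L^\circ|^{\frac p{n+p}}\Big\},$$ $$G_p^{(2)}(K_1,\dots,K_n)=\inf_{\mathbf L\in\mathcal K_0^n}\Big\{nV_p(\mathbf K;\mathbf L)^{\frac n{n+p}}\prod_{i=1}^n|L_i^\circ|^{\frac p{(n+p)n}}\Big\},$$ $$G_p^{(3)}(K_1,\dots,K_n)=\inf_{\mathbf L\in\mathcal K_0^n}\Big\{nV_p(\mathbf K;\mathbf L)^{\frac n{n+p}}\widetilde V(\mathbf L^\circ)^{\frac p{n+p}}\Big\}.$$ For $p<0$, $p\ne-n$, the same formulas with each $\inf$ replaced by $\sup$. Infima and suprema are taken in $[0,+\infty]$, with $0^a=+\infty$ for $a<0$. *)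

(* Defs.v *)
From HB Require Import structures.
From mathcomp Require Import all_boot all_order all_algebra.
From mathcomp Require Import all_classical all_reals all_analysis.
From mathcomp Require Import measurable_realfun.

Set Implicit Arguments.
Unset Strict Implicit.
Unset Printing Implicit Defensive.

Import Order.TTheory GRing.Theory Num.Theory.
Import numFieldNormedType.Exports.

Local Open Scope classical_set_scope.
Local Open Scope ring_scope.

(* Points of R^n are row vectors 'rV[R]_n, and a matrix phi acts on them by
   x |-> x *m phi.  The library norm `|x| on 'rV[R]_n is the sup norm; it is
   only used through the topology it induces. *)

HB.instance Definition _ (R : realType) (m n : nat) :=
  @isMeasurable.Build default_measure_display 'M[R]_(m, n)
    <<s @open 'M[R]_(m, n) >>
    (@sigma_algebra0 _ setT (@open 'M[R]_(m, n)))
    (@sigma_algebraC _ (@open 'M[R]_(m, n)))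
    (@sigma_algebra_bigcup _ setT (@open 'M[R]_(m, n))).

Section borel_row_vectors.
Context (R : realType).

Lemma measurable_open_rV n (U : set 'rV[R]_n) : open U -> measurable U.
Proof. by move=> oU; apply: sub_sigma_algebra. Qed.

Lemma measurable_coord_rV n (i : 'I_n) :
  measurable_fun [set: 'rV[R]_n] (fun x : 'rV[R]_n => x ord0 i).
Proof.
apply: (@measurability _ _ _ _ _ _ _ (RGenOpens.measurableE R)).
move=> _ [_ [a [b ->]] <-]; rewrite setTI; apply: measurable_open_rV.
by apply: open_comp => [x _|]; [exact: coord_continuous | exact: interval_open].
Qed.

Lemma open_bigcup_rV n (U : set 'rV[R]_n) : open U ->
  U = \bigcup_(q : {ffun 'I_n -> rat * rat})
    (if `[< [set x : 'rV[R]_n | forall i,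
              x ord0 i \in `](ratr (q i).1), (ratr (q i).2)[ ] `<=` U >]
     then [set x : 'rV[R]_n | forall i,
              x ord0 i \in `](ratr (q i).1), (ratr (q i).2)[ ]
     else set0).
Proof.
move=> oU; apply/seteqP; split=> [x Ux|x [q _]]; last first.
  by case: asboolP => // + qx; exact.
have /nbhs_ballP[e /= e0 xeU] : nbhs x U by exact: open_nbhs_nbhs.
have H i : exists q : rat * rat, x ord0 i - e < ratr q.1 < x ord0 i /\
    x ord0 i < ratr q.2 < x ord0 i + e.
  have [q1 q1P] : exists q : rat, ratr q \in `]x ord0 i - e, x ord0 i[.
    by apply: rat_in_itvoo; rewrite ltrBlDr ltrDl.
  have [q2 q2P] : exists q : rat, ratr q \in `]x ord0 i, x ord0 i + e[.
    by apply: rat_in_itvoo; rewrite ltrDl.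
  by exists (q1, q2); move: q1P q2P; rewrite !in_itv.
have [f fP] := choice H.
exists [ffun i => f i] => //; rewrite asboolT.
  by move=> i /=; rewrite ffunE in_itv/=; have [/andP[_ ->] /andP[-> _]] := fP i.
move=> y yP; apply: xeU; split=> // i j; rewrite (ord1 i).
have := yP j; rewrite ffunE in_itv/= => /andP[y1 y2].
have [/andP[a1 _] /andP[_ a2]] := fP j.
rewrite /ball/= ltr_distlC.
by rewrite (lt_trans a1 y1) (lt_trans y2 a2).
Qed.

Lemma measurable_fun_rVP d (T : measurableType d) n (f : T -> 'rV[R]_n) :
  (forall i, measurable_fun [set: T] (fun t => f t ord0 i)) ->
  measurable_fun [set: T] f.
Proof.
move=> mf.
apply: (@measurability _ _ _ _ [set: T] f (@open 'rV[R]_n)) => //.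
move=> _ [U oU <-]; rewrite setTI (open_bigcup_rV oU) preimage_bigcup.
apply: countable_bigcupT_measurable => [|q].
  exact: countableP.
case: ifPn => _; last by rewrite preimage_set0.
rewrite (_ : _ @^-1` _ = \bigcap_(i in [set: 'I_n])
   ((fun t => f t ord0 i) @^-1` `](ratr (q i).1), (ratr (q i).2)[)); last first.
  by apply/seteqP; split=> t /= => [H i _|H i]; exact: H.
apply: fin_bigcap_measurable => //.
by move=> i _; rewrite -[X in measurable X]setTI; exact: mf.
Qed.

End borel_row_vectors.

Section lebesgue_rV.
Context (R : realType).

Definition cons_rV n (p : R * 'rV[R]_n) : 'rV[R]_n.+1 := row_mx p.1%:M p.2.

Lemma measurable_cons_rV n : measurable_fun [set: R * 'rV[R]_n] (@cons_rV n).
Proof.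
apply: measurable_fun_rVP => i; rewrite /cons_rV.
case: (@split_ordP 1 n i) => j ->.
  rewrite (_ : (fun t => _) = fst) //.
  by apply/funext => t; rewrite (@row_mxEl _ 1 1 n) !mxE (ord1 j) eqxx mulr1n.
rewrite (_ : (fun t => _) = (fun x : 'rV[R]_n => x ord0 j) \o snd).
  by apply: measurableT_comp; [exact: measurable_coord_rV | exact: measurable_snd].
by apply/funext => t; rewrite (@row_mxEr _ 1 1 n).
Qed.

Lemma cons_rV_surj n (x : 'rV[R]_n.+1) : exists p, cons_rV p = x.
Proof.
exists (x ord0 ord0, \row_j x ord0 (lift ord0 j)); apply/rowP => i.
rewrite /cons_rV; case: (@split_ordP 1 n i) => j ->.
  rewrite (@row_mxEl _ 1 1 n) !mxE (ord1 j) eqxx mulr1n; congr (x _ _); exact/val_inj.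
by rewrite (@row_mxEr _ 1 1 n) mxE; congr (x _ _); exact/val_inj.
Qed.

Section cons_measure.
Variables (n : nat) (mu : {sigma_finite_measure set 'rV[R]_n -> \bar R}).

Definition cons_measure : set 'rV[R]_n.+1 -> \bar R :=
  pushforward (@lebesgue_measure R \x mu)%E (@cons_rV n).

Let cons_measure0 : cons_measure set0 = 0%E.
Proof. by rewrite /cons_measure /pushforward preimage_set0 measure0. Qed.

Let mpre (A : set 'rV[R]_n.+1) : measurable A ->
  measurable (@cons_rV n @^-1` A).
Proof. by rewrite -[X in _ -> measurable X]setTI; exact: measurable_cons_rV. Qed.

Let cons_measure_ge0 A : (0 <= cons_measure A)%E.
Proof. rewrite /cons_measure /pushforward; exact: measure_ge0. Qed.

Let cons_measure_additive : semi_sigma_additive cons_measure.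
Proof.
move=> F mF tF mUF; rewrite /cons_measure /pushforward preimage_bigcup.
apply: measure_semi_sigma_additive.
- by move=> k; exact: mpre.
- apply/trivIsetP => /= i j _ _ ij; rewrite -preimage_setI.
  by move/trivIsetP : tF => /(_ _ _ _ _ ij) ->//; rewrite preimage_set0.
- by rewrite -preimage_bigcup; exact: mpre.
Qed.

HB.instance Definition _ := isMeasure.Build _ _ _ cons_measure
  cons_measure0 cons_measure_ge0 cons_measure_additive.

Let cons_measure_sigma_finite : sigma_finite setT cons_measure.
Proof.
have /sigma_finiteP[F [TF ndF Foo]] := sigma_finiteT mu.
pose tl (x : 'rV[R]_n.+1) : 'rV[R]_n := \row_j x ord0 (lift ord0 j).
have mtl : measurable_fun setT tl.
  apply: measurable_fun_rVP => i; rewrite (_ : (fun t => _) = fun x : 'rV[R]_n.+1 => x ord0 (lift ord0 i)).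
    exact: measurable_coord_rV.
  by apply/funext => x; rewrite mxE.
pose I k : set R := `[- k%:R, k%:R]%classic.
pose G k := ((fun x : 'rV[R]_n.+1 => x ord0 ord0) @^-1` I k) `&` (tl @^-1` F k).
have preG k : @cons_rV n @^-1` G k = I k `*` F k.
  have h0 p : @cons_rV n p ord0 ord0 = p.1.
    rewrite /cons_rV (_ : ord0 = lshift n (ord0 : 'I_1)) ?(@row_mxEl _ 1 1 n); last exact/val_inj.
    by rewrite mxE eqxx mulr1n.
  have t0 p : tl (@cons_rV n p) = p.2.
    apply/rowP => j; rewrite mxE /cons_rV.
    rewrite (_ : lift ord0 j = rshift 1 j); last exact/val_inj.
    by rewrite (@row_mxEr _ 1 1 n).
  by apply/seteqP; split=> p; rewrite /G /= h0 t0.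
exists G.
  apply/esym/seteqP; split=> // x _.
  have [a _ xa] : (\bigcup_k F k) (tl x) by rewrite -TF.
  pose b := Num.truncn `|x ord0 ord0|.
  exists (maxn a b.+1) => //; split => /=.
    rewrite /I /= in_itv/= -ler_norml.
    rewrite (@le_trans _ _ b.+1%:R) ?ler_nat ?leq_maxr//.
    by rewrite ltW// truncnS_gt.
  have /subsetPset := ndF _ _ (leq_maxl a b.+1); exact.
move=> k; split.
  apply: measurableI.
    rewrite -[X in measurable X]setTI; apply: (measurable_coord_rV ord0 measurableT).
    exact: measurable_itv.
  by rewrite -[X in measurable X]setTI; apply: mtl => //; have [] := Foo k.
rewrite /cons_measure /pushforward preG product_measure1E; last 2 first.
- exact: measurable_itv.
- by have [] := Foo k.
have Ifin : @lebesgue_measure R (I k) \is a fin_num.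
  by rewrite /I lebesgue_measure_itv; case: ifPn.
by apply: lte_mul_pinfty; [exact: measure_ge0 | exact: Ifin | have [] := Foo k].
Qed.

HB.instance Definition _ := @Measure_isSigmaFinite.Build _ _ _ cons_measure
  cons_measure_sigma_finite.

End cons_measure.

Fixpoint lebesgue_rV n : {sigma_finite_measure set 'rV[R]_n -> \bar R} :=
  if n is n'.+1
  then [the {sigma_finite_measure set _ -> \bar R} of cons_measure (lebesgue_rV n')]
  else [the {sigma_finite_measure set _ -> \bar R} of @dirac _ 'rV[R]_0 0 R].

End lebesgue_rV.

Section euclidean.
Context (R : realType) (n : nat).
Implicit Types x y u : 'rV[R]_n.

Definition dot x y : R := \sum_(i < n) x ord0 i * y ord0 i.

Definition enorm x : R := Num.sqrt (dot x x).

Definition sphere : set 'rV[R]_n := [set u | enorm u = 1].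

Definition direction x : 'rV[R]_n := (enorm x)^-1 *: x.

(* sigma(A) = n |{t u : 0 < t <= 1, u in A}|, for A a subset of the sphere *)
Definition spherical_measure (A : set 'rV[R]_n) : \bar R :=
  (n%:R%:E * lebesgue_rV R n
     ([set x | (0 < enorm x <= 1)%R] `&` direction @^-1` A))%E.

Lemma measurable_enorm : measurable_fun [set: 'rV[R]_n] enorm.
Proof.
apply: (measurableT_comp (continuous_measurable_fun (@sqrt_continuous R))).
by apply: measurable_sum => i; apply: measurable_funM; exact: measurable_coord_rV.
Qed.

Lemma measurable_direction : measurable_fun [set: 'rV[R]_n] direction.
Proof.
apply: measurable_fun_rVP => i.
rewrite (_ : (fun t => _) = fun x => (enorm x `^ (-1) * x ord0 i)%R).
  apply: measurable_funM; last exact: measurable_coord_rV.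
  exact: (measurableT_comp (measurable_powR (-1)) measurable_enorm).
by apply/funext => x; rewrite /direction mxE powR_inv1// sqrtr_ge0.
Qed.

Let mshell (A : set 'rV[R]_n) : measurable A ->
  measurable ([set x : 'rV[R]_n | (0 < enorm x <= 1)%R] `&` direction @^-1` A).
Proof.
move=> mA; apply: measurableI.
  rewrite (_ : [set _ | _] = enorm @^-1` `]0, 1]%classic).
    by rewrite -[X in measurable X]setTI; apply: measurable_enorm.
  by apply/seteqP; split=> x /=; rewrite in_itv.
by rewrite -[X in measurable X]setTI; apply: measurable_direction.
Qed.

Let spherical_measure0 : spherical_measure set0 = 0%E.
Proof. by rewrite /spherical_measure preimage_set0 setI0 measure0 mule0. Qed.

Let spherical_measure_ge0 A : (0 <= spherical_measure A)%E.
Proof. by rewrite /spherical_measure mule_ge0// lee_fin. Qed.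

Let spherical_measure_additive : semi_sigma_additive spherical_measure.
Proof.
move=> F mF tF mUF; rewrite /spherical_measure preimage_bigcup setI_bigcupr.
under eq_cvg do rewrite -ge0_sume_distrr//.
apply: cvgeZl => //; apply: measure_semi_sigma_additive.
- by move=> k; exact: mshell.
- apply/trivIsetP => /= i j _ _ ij; rewrite setIACA setIid -preimage_setI.
  by move/trivIsetP : tF => /(_ _ _ _ _ ij) ->//; rewrite preimage_set0 setI0.
- by rewrite -setI_bigcupr -preimage_bigcup; exact: mshell.
Qed.

HB.instance Definition _ := isMeasure.Build _ _ _ spherical_measure
  spherical_measure0 spherical_measure_ge0 spherical_measure_additive.

End euclidean.
Arguments sphere {R} n.
Arguments spherical_measure {R} n A.

Section hausdorff.
Context (R : realType) (n : nat).
Local Open Scope ereal_scope.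

Definition diam (A : set 'rV[R]_n) : \bar R :=
  ereal_sup [set (enorm (x - y)%R)%:E | x in A & y in A].

Definition unit_ball_volume (m : nat) : \bar R :=
  lebesgue_rV R m [set x | (enorm x <= 1)%R].

(* The case distinction makes set0 weigh 0 also for m = 0, where every nonempty
   set weighs 1. *)
Definition hausdorff_gauge (m : nat) (A : set 'rV[R]_n) : \bar R :=
  if A == set0 then 0
  else unit_ball_volume m * ((2^-1)%:E * diam A) ^+ m.

Definition hausdorff_premeasure (m : nat) (delta : R) (A : set 'rV[R]_n) :=
  ereal_inf [set \sum_(i <oo) hausdorff_gauge m (U i) |
    U in [set U : (set 'rV[R]_n)^nat |
      A `<=` \bigcup_i U i /\ forall i, diam (U i) <= delta%:E]].

(* Normalized so that it agrees with Lebesgue measure when m = n. *)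
Definition hausdorff_measure (m : nat) (A : set 'rV[R]_n) : \bar R :=
  ereal_sup [set hausdorff_premeasure m delta A | delta in [set d : R | (0 < d)%R]].

End hausdorff.

Section convex_bodies.
Context (R : realType) (n : nat).
Implicit Types (K L : set 'rV[R]_n) (u : 'rV[R]_n) (A : set 'rV[R]_n).

Definition K0 : set (set 'rV[R]_n) :=
  [set K | [/\ compact K, @convex_set R 'rV[R]_n K & interior K 0]].

Definition support_fun K u : R := sup [set dot x u | x in K].

Definition polar K : set 'rV[R]_n := [set x | forall y, K y -> dot x y <= 1].

Definition radial_fun K u : R := sup [set t : R | 0 <= t /\ K (t *: u)].

(* the points of K having an outer unit normal vector in A *)
Definition reverse_spherical_image K A : set 'rV[R]_n :=
  [set x | K x /\ exists u, [/\ sphere n u, A u & dot x u = support_fun K u]].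

Definition surface_area_measure K A : \bar R :=
  hausdorff_measure n.-1 (reverse_spherical_image K A).

Definition is_curvature_function K (f : 'rV[R]_n -> R) :=
  [/\ measurable_fun (sphere n) f,
      forall u, sphere n u -> 0 <= f u &
      forall A, measurable A -> A `<=` sphere n ->
        surface_area_measure K A =
        (\int[spherical_measure n]_(u in A) (f u)%:E)%E].

(* By Radon-Nikodym the last two conditions express the same property; f_K is
   determined up to a sigma-null set. *)
Definition F0 : set (set 'rV[R]_n) :=
  [set K | [/\ K0 K,
               surface_area_measure K `<< @spherical_measure R n &
               exists f, is_curvature_function K f]].

Definition curvature_function K : 'rV[R]_n -> R :=
  xget (fun=> 0) (is_curvature_function K).

Definition Lp_curvature_function (p : R) K u : R :=
  support_fun K u `^ (1 - p) * curvature_function K u.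

End convex_bodies.
Arguments K0 {R} n.
Arguments F0 {R} n.

Section geominimal.
Context (R : realType) (n : nat).
Implicit Types (p : R) (K L : 'I_n -> set 'rV[R]_n).
Local Open Scope ereal_scope.

Definition mixed_Lp_volume p K L : \bar R :=
  (n%:R^-1)%:E * \int[spherical_measure n]_(u in sphere n)
    (\prod_(i < n) (support_fun (L i) u `^ p *
                    Lp_curvature_function p (K i) u) `^ (n%:R^-1))%R%:E.

Definition dual_mixed_volume L : \bar R :=
  (n%:R^-1)%:E * \int[spherical_measure n]_(u in sphere n)
    (\prod_(i < n) radial_fun (L i) u)%R%:E.

(* x ^ a on [0, +oo] with 0 ^ a = +oo for a < 0; the library's `^ has
   0 `^ a = 0 and +oo `^ a = +oo for a < 0. *)
Definition epower (x : \bar R) (a : R) : \bar R :=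
  if (a < 0)%R then (x `^ (- a))^-1 else x `^ a.

Variant geominimal_index := alpha1 | alpha2 | alpha3.

Definition geominimal_values (alpha : geominimal_index) p K : set \bar R :=
  let Vpow L := n%:R%:E * epower (mixed_Lp_volume p K L) (n%:R / (n%:R + p)) in
  match alpha with
  | alpha1 =>
      [set Vpow (fun=> L) *
           epower (lebesgue_rV R n (polar L)) (p / (n%:R + p)) | L in K0 n]
  | alpha2 =>
      [set Vpow L * \prod_(i < n)
           epower (lebesgue_rV R n (polar (L i))) (p / ((n%:R + p) * n%:R))
         | L in [set L | forall i, K0 n (L i)]]
  | alpha3 =>
      [set Vpow L *
           epower (dual_mixed_volume (fun i => polar (L i))) (p / (n%:R + p))
         | L in [set L | forall i, K0 n (L i)]]
  end.

(* meaningful for p != - n *)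
Definition geominimal (alpha : geominimal_index) p K : \bar R :=
  if p == 0%R then
    \int[spherical_measure n]_(u in sphere n)
      (\prod_(i < n) (curvature_function (K i) u *
                      support_fun (K i) u) `^ (n%:R^-1))%R%:E
  else if (0 < p)%R then ereal_inf (geominimal_values alpha p K)
  else ereal_sup (geominimal_values alpha p K).

End geominimal.

Definition linear_image (R : realType) (n : nat) (phi : 'M[R]_n)
  (K : set 'rV[R]_n) : set 'rV[R]_n := [set x *m phi | x in K].

(* Main.v *)
(* Write [w u = |u phi^T|] and [T u = u phi^T / w u] for [u] on the sphere.  The
   support and radial functions satisfy [h_{phi L}(u) = w(u) h_L(T u)] and
   [rho_{(phi L)^o}(u) = rho_{L^o}(T u) / w(u)], the spherical measure satisfies
   [int g dsigma = |det phi| int g(T u) w(u)^-n dsigma(u)], and the curvature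
   function satisfies, almost everywhere,
     [f_{phi K}(u) = |det phi|^2 w(u)^-(n+1) f_K(T u)].
   Hence [V_p(phi K; phi L) = |det phi| V_p(K; L)], while the volume of [(phi L)^o]
   and the dual mixed volume pick up the factor [|det phi|^-1]; since [L |-> phi L]
   permutes the convex bodies, the infima and suprema are all multiplied by
   [|det phi|^(n/(n+p) - p/(n+p))].

   The formula for [f_{phi K}] is the substantial point, because the surface area
   measure is the Hausdorff measure [H] of the set [tau(K, A)] of boundary points
   with normals in [A].  If [A] lies close to [v], then [tau(K, A)] is almost
   contained in a hyperplane orthogonal to [v], so that [phi] multiplies its
   Hausdorff measure by about [J(v) = |det phi| |v phi^-T|], the Jacobian of [phi]
   on that hyperplane; translation invariance identifies [H] there with a multiple
   of Lebesgue measure, and no isodiametric inequality is needed.  As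
   [A |-> H(phi tau(K, A))] is countably additive, these local estimates add up to
   [H(phi tau(K, A)) = int_A J dS(K, .)].  The change of variables on the sphere
   follows from the same localization. *)
From HB Require Import structures.
Require Import Defs.
From mathcomp Require Import all_boot all_order all_algebra.
From mathcomp Require Import all_classical all_reals all_analysis.
From mathcomp Require Import perm measurable_realfun ring lra zify.

Set Implicit Arguments.
Unset Strict Implicit.
Unset Printing Implicit Defensive.

Import Order.TTheory GRing.Theory Num.Theory.
Import numFieldNormedType.Exports.
Local Open Scope classical_set_scope.
Local Open Scope ring_scope.

(** * Lebesgue measure under linear maps *)

(** The obstacle that shapes the proof is measurability. For a Borel set [A], tau(K, A) is a
    projection of a set of pairs (point, normal) and is not known to be Borel; and for disjoint [A]
    and [B] the sets tau(K, A) and tau(K, B) may share points with several normals. The existence of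
    a density helps: it makes S(K, .) additive, and comparing this with the outer measure [H] shows
    that the shared points form a null set. A sigma-algebra argument starting from closed [A] then
    makes tau(K, A) and all its linear images Caratheodory measurable, so that their measures add up
    and the localization applies.

    The formula for f_{phi K} has two sources: the density J, taken at T u, equals |det phi|
    w(u)^-1, and the substitution on the sphere contributes |det phi| w(u)^-n. As f_K is merely a
    chosen density, all identities for it hold almost everywhere; the uniqueness behind them uses
    that the total surface area is finite, which again follows from flatness and the compactness of
    the sphere. *)

Lemma section_fubini d1 d2 (T1 : measurableType d1) (T2 : measurableType d2)
    (R : realType) (m1 : {sigma_finite_measure set T1 -> \bar R})
    (m2 : {sigma_finite_measure set T2 -> \bar R}) (S : set (T1 * T2)) :
  measurable S ->
  (\int[m1]_x m2 [set y | S (x, y)] = \int[m2]_y m1 [set x | S (x, y)])%E.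
Proof.
move=> mS; have := indic_fubini_tonelli m1 m2 mS.
rewrite indic_fubini_tonelli_FE// indic_fubini_tonelli_GE// => H.
transitivity (\int[m1]_x (m2 \o xsection S) x)%E.
  by apply: eq_integral => x _ /=; rewrite xsectionE.
rewrite H; apply: eq_integral => y _ /=; congr (m1 _).
by apply/seteqP; split=> x /=; rewrite /ysection/= inE.
Qed.

Section lebesgue_shift.
Context (R : realType).
Local Notation lam := (@lebesgue_measure R).

Lemma lebesgue_measure_shift (a : R) (A : set R) : measurable A ->
  lam ((fun x => x + a) @^-1` A) = lam A.
Proof.
move=> mA.
have ms : measurable_fun [set: R] (fun x : R => x + a).
  exact: measurable_funD.
pose m := pushforward lam (fun x : R => x + a : measurableTypeR R).
transitivity (m A); first by [].
apply/esym/lebesgue_measure_unique => //= _ [[b c]] _ <-.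
rewrite /m /pushforward.
rewrite (_ : _ @^-1` _ = `]b - a, c - a]%classic); last first.
  apply/seteqP; split=> x /=; rewrite !in_itv/= ltrBlDr lerBrDr//.
rewrite !lebesgue_measure_itv/= !lte_fin ltrD2r.
by case: ifP => // _; rewrite -!EFinB; congr EFin; ring.
Qed.

Lemma lebesgue_rVS1 n (A : set 'rV[R]_n.+1) : measurable A ->
  lebesgue_rV R n.+1 A =
  (\int[lam]_t lebesgue_rV R n [set y | A (cons_rV (t, y))])%E.
Proof.
move=> mA; rewrite [LHS]/= /cons_measure /pushforward /product_measure1.
by apply: eq_integral => x _ /=; rewrite xsectionE.
Qed.

Lemma lebesgue_rVS2 n (A : set 'rV[R]_n.+1) : measurable A ->
  lebesgue_rV R n.+1 A =
  (\int[lebesgue_rV R n]_y lam [set t | A (cons_rV (t, y))])%E.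
Proof.
move=> mA; rewrite lebesgue_rVS1//.
have := section_fubini (@lebesgue_measure R) (lebesgue_rV R n) (S := @cons_rV R n @^-1` A).
apply.
by rewrite -[X in measurable X]setTI; exact: measurable_cons_rV.
Qed.

Lemma cons_rVD n (t s : R) (x y : 'rV[R]_n) :
  cons_rV (t, x) + cons_rV (s, y) = cons_rV (t + s, x + y).
Proof. by rewrite /cons_rV/= (@add_row_mx R 1 1 n) raddfD. Qed.

Lemma measurable_funD_rV d (T : measurableType d) n (f g : T -> 'rV[R]_n) :
  measurable_fun setT f -> measurable_fun setT g ->
  measurable_fun setT (fun x => f x + g x).
Proof.
move=> mf mg; apply: measurable_fun_rVP => i.
rewrite (_ : (fun t => _) = (fun t => f t ord0 i) \+ (fun t => g t ord0 i)).
  apply: measurable_funD.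
    exact: (measurableT_comp (measurable_coord_rV i) mf).
  exact: (measurableT_comp (measurable_coord_rV i) mg).
by apply/funext => t; rewrite !mxE.
Qed.

Lemma measurable_fun_mulmx d (T : measurableType d) n p (M : 'M[R]_(n, p))
    (f : T -> 'rV[R]_n) :
  measurable_fun setT f -> measurable_fun setT (fun x => f x *m M).
Proof.
move=> mf; apply: measurable_fun_rVP => i.
rewrite (_ : (fun t => _) = (fun t => \sum_j (f t ord0 j * M j i))); last first.
  by apply/funext => t; rewrite mxE.
apply: measurable_sum => j; apply: measurable_funM => //.
exact: (measurableT_comp (measurable_coord_rV j) mf).
Qed.

Lemma measurable_oppr_rV n : measurable_fun setT (fun x : 'rV[R]_n => - x).
Proof.
rewrite (_ : (fun x => _) = fun x : 'rV[R]_n => x *m (- 1%:M)).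
  exact: measurable_fun_mulmx.
by apply/funext => x; rewrite mulmxN mulmx1.
Qed.

Lemma measurable_preimage d d' (T : measurableType d) (T' : measurableType d')
  (f : T -> T') (A : set T') : measurable_fun setT f -> measurable A ->
  measurable (f @^-1` A).
Proof. by move=> mf mA; rewrite -[X in measurable X]setTI; exact: mf. Qed.

(** Induction on the dimension: after slicing along the first coordinate, the induction hypothesis
    removes the translation of the slices and [lebesgue_measure_shift] that of the first
    coordinate. *)
Lemma lebesgue_rV_shift n (a : 'rV[R]_n) (A : set 'rV[R]_n) : measurable A ->
  lebesgue_rV R n ((fun x => x + a) @^-1` A) = lebesgue_rV R n A.
Proof.
elim: n a A => [|n IH] a A mA.
  by congr (lebesgue_rV R 0 _); apply/seteqP; split=> x /=;
    rewrite (_ : x + a = x)//; apply/rowP; case.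
have msh : measurable_fun setT (fun x : 'rV[R]_n.+1 => x + a).
  exact: measurable_funD_rV.
rewrite [RHS]lebesgue_rVS1// lebesgue_rVS1; last exact: measurable_preimage.
have [[s b] <-] := cons_rV_surj a.
pose F t := lebesgue_rV R n [set y | A (cons_rV (t, y))].
have mc t : measurable_fun setT (fun y : 'rV[R]_n => cons_rV (t, y)).
  by apply: (measurableT_comp (@measurable_cons_rV R n)); exact: measurable_pair1.
have mF : measurable_fun setT F.
  have := @measurable_fun_xsection _ _ _ _ R (lebesgue_rV R n)
    _ (measurable_preimage (@measurable_cons_rV R n) mA).
  by apply: eq_measurable_fun => t _; rewrite /F/= xsectionE.
have ms : measurable_fun [set: R] (fun x : R => x + s) by exact: measurable_funD.
transitivity (\int[lam]_t F (t + s)%R)%E.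
  apply: eq_integral => t _; rewrite /F -[RHS](IH b).
    by congr (lebesgue_rV R n _); apply/seteqP; split=> y /=; rewrite cons_rVD.
  exact: measurable_preimage (mc _) mA.
transitivity (\int[pushforward lam (fun x : R => (x + s)%R : measurableTypeR R)]_t F t)%E.
  by rewrite ge0_integral_pushforward//= => y _; exact: measure_ge0.
apply: eq_measure_integral => B mB _.
exact: lebesgue_measure_shift.
Qed.

(* Evaluating [int int 1_A(x) 1_B(x + y) dnu(x) dlam(y)] in both orders. *)
Lemma shift_invariant_proportional n
    (nu : {sigma_finite_measure set 'rV[R]_n -> \bar R}) :
  (forall a (A : set 'rV[R]_n), measurable A ->
    nu ((fun x => x + a) @^-1` A) = nu A) ->
  forall A B : set 'rV[R]_n, measurable A -> measurable B ->
  (lebesgue_rV R n B * nu A = nu B * lebesgue_rV R n (-%R @^-1` A))%E.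
Proof.
move=> nush A B mA mB; set mu := lebesgue_rV R n.
have mN := @measurable_oppr_rV n.
have mf := @measurable_fst _ _ 'rV[R]_n 'rV[R]_n.
have ms := @measurable_snd _ _ 'rV[R]_n 'rV[R]_n.
pose S := [set xy : 'rV[R]_n * 'rV[R]_n | A xy.1 /\ B (xy.1 + xy.2)].
pose S' := [set xy : 'rV[R]_n * 'rV[R]_n | B xy.1 /\ A (xy.1 - xy.2)].
have mS : measurable S.
  apply: measurableI; first exact: measurable_preimage mf mA.
  exact: (measurable_preimage (measurable_funD_rV mf ms) mB).
have mS' : measurable S'.
  apply: measurableI; first exact: measurable_preimage mf mB.
  exact: (measurable_preimage (measurable_funD_rV mf (measurableT_comp mN ms)) mA).
transitivity (\int[nu]_x mu [set y | S (x, y)])%E.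
  transitivity (\int[nu]_x (mu B * (\1_A x)%:E))%E.
    rewrite ge0_integralZl//; last exact/measurable_EFinP.
    by rewrite integral_indic// setIT.
  apply: eq_integral => x _; rewrite indicE.
  have [/set_mem Ax|/negP nAx] := boolP (x \in A).
    rewrite mule1 -(lebesgue_rV_shift x mB); congr (mu _).
    by apply/seteqP; split=> y /=; rewrite /S/= addrC => // -[].
  rewrite mule0 (_ : [set y | _] = set0) ?measure0//.
  by apply/seteqP; split => // y [/= /mem_set].
transitivity (\int[nu]_x mu [set y | S' (x, y)])%E.
  rewrite section_fubini// [RHS]section_fubini//; apply: eq_integral => y _.
  rewrite -[RHS](nush y); last first.
    exact: (measurable_preimage (measurable_pair2 y) mS').
  by congr (nu _); apply/seteqP; split=> x /=; rewrite /S /S'/= addrK => -[].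
transitivity (\int[nu]_x (mu (-%R @^-1` A) * (\1_B x)%:E))%E.
  apply: eq_integral => x _; rewrite indicE.
  have [/set_mem Ax|/negP nAx] := boolP (x \in B).
    have mA' : measurable (-%R @^-1` A) by exact: measurable_preimage.
    rewrite mule1 -[in RHS](lebesgue_rV_shift (- x) mA').
    congr (mu _); apply/seteqP; split=> y /=; rewrite /S'/= opprD opprK [- y + x]addrC //.
    by move=> -[].
  rewrite mule0 (_ : [set y | _] = set0) ?measure0//.
  by apply/seteqP; split => // y [/= /mem_set].
rewrite ge0_integralZl//; last exact/measurable_EFinP.
by rewrite integral_indic// setIT muleC.
Qed.

End lebesgue_shift.

(** * The volume factor of an invertible matrix *)

Section lebesgue_linear.
Context (R : realType).
Local Notation lam := (@lebesgue_measure R).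

Definition cube n (r : R) : set 'rV[R]_n := [set x | forall i, `|x ord0 i| <= r].

Lemma measurable_cube n r : measurable (@cube n r).
Proof.
rewrite (_ : cube r = \bigcap_(i in [set: 'I_n])
    ((fun x : 'rV[R]_n => x ord0 i) @^-1` `[- r, r]%classic)); last first.
  apply/seteqP; split => x /= H i; last by have := H i I; rewrite /= in_itv/= -ler_norml.
  by move=> _; rewrite /= in_itv/= -ler_norml.
apply: fin_bigcap_measurable => // i _.
exact: (measurable_preimage (measurable_coord_rV i) (measurable_itv _)).
Qed.

Lemma cons_rV0 n (t : R) (y : 'rV[R]_n) : cons_rV (t, y) ord0 ord0 = t.
Proof.
rewrite /cons_rV (_ : ord0 = lshift n (ord0 : 'I_1)); last exact/val_inj.
by rewrite (@row_mxEl _ 1 1 n) mxE eqxx mulr1n.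
Qed.

Lemma cons_rVS n (t : R) (y : 'rV[R]_n) j :
  cons_rV (t, y) ord0 (lift ord0 j) = y ord0 j.
Proof.
rewrite /cons_rV (_ : lift ord0 j = rshift 1 j); last exact/val_inj.
by rewrite (@row_mxEr _ 1 1 n).
Qed.

Lemma cube_cons_rV n r (t : R) (y : 'rV[R]_n) :
  cube r (cons_rV (t, y)) <-> `|t| <= r /\ cube r y.
Proof.
split=> [H|[H1 H2] i].
  split=> [|j]; first by have := H ord0; rewrite cons_rV0.
  by have := H (lift ord0 j); rewrite cons_rVS.
by case: (unliftP ord0 i) => [j ->|->]; rewrite ?cons_rV0 ?cons_rVS.
Qed.

Lemma lebesgue_itv_sym (r s : R) : 0 <= r ->
  lam [set t | `|t + s| <= r] = (2 * r)%:E.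
Proof.
move=> r0; rewrite (_ : [set t | _] = `[- r - s, r - s]%classic); last first.
  by apply/seteqP; split=> t /=; rewrite in_itv/= ler_norml lerBlDr lerBrDr.
rewrite lebesgue_measure_itv/= lte_fin ltrD2r.
case: ifPn => [_|]; first by rewrite -EFinB; congr EFin; ring.
by rewrite -leNgt => h; have -> : r = 0; [lra|rewrite mulr0].
Qed.

Lemma lebesgue_cube n (r : R) : 0 <= r ->
  lebesgue_rV R n (@cube n r) = ((2 * r) ^+ n)%:E.
Proof.
move=> r0; elim: n => [|n IH].
  by rewrite expr0 /= /dirac/= indicE mem_set// => -[].
rewrite lebesgue_rVS1; last exact: measurable_cube.
have mI : measurable [set t : R | `|t + 0| <= r].
  rewrite (_ : [set t | _] = `[- r, r]%classic); first exact: measurable_itv.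
  by apply/seteqP; split=> t /=; rewrite addr0 in_itv/= ler_norml.
transitivity (\int[lam]_t (((2 * r) ^+ n)%:E * (\1_[set t : R | `|t + 0| <= r] t)%:E))%E.
  apply: eq_integral => t _; rewrite indicE.
  have [/set_mem/=|/negP h] := boolP (t \in [set t : R | `|t + 0| <= r]).
    rewrite addr0 mule1 -IH => tr; congr (lebesgue_rV R n _).
    by apply/seteqP; split => y /=; rewrite cube_cons_rV//; case.
  rewrite mule0 (_ : [set y | _] = set0) ?measure0//.
  apply/seteqP; split => // y /=; rewrite cube_cons_rV => -[ht _].
  by apply: h; apply: mem_set; rewrite /= addr0.
rewrite ge0_integralZl//; last 2 first.
- exact/measurable_EFinP.
- by rewrite lee_fin exprn_ge0// mulr_ge0.
rewrite integral_indic// setIT (_ : (_ : set _ -> \bar R) _ = (2 * r)%:E).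
  by rewrite -EFinM exprSr.
exact: lebesgue_itv_sym.
Qed.

Lemma cube_bigcup n : \bigcup_k @cube n k%:R = setT.
Proof.
apply/seteqP; split=> // x _.
have [k Hk] : exists k : nat, forall i, `|x ord0 i| <= k%:R.
  exists (\max_(i < n) (Num.truncn `|x ord0 i|).+1)%N => i.
  apply: (@le_trans _ _ (Num.truncn `|x ord0 i|).+1%:R).
    by rewrite ltW// truncnS_gt.
  by rewrite ler_nat; exact: (@leq_bigmax _ (fun i => (Num.truncn `|x ord0 i|).+1) i).
by exists k.
Qed.

(** The set [cube 1] is symmetric of Lebesgue measure [2 ^+ n], so taking it for [A] in
    [shift_invariant_proportional] determines the constant. Finiteness on cubes makes [nu]
    sigma-finite, as Fubini requires. It serves for images of Lebesgue measure under linear maps and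
    for Hausdorff measure in top dimension. *)
Lemma shift_invariant_lebesgue n (nu : {measure set 'rV[R]_n -> \bar R}) :
  (forall a (A : set 'rV[R]_n), measurable A ->
    nu ((fun x => x + a) @^-1` A) = nu A) ->
  (forall k : nat, (nu (cube k%:R) < +oo)%E) ->
  forall B : set 'rV[R]_n, measurable B ->
  nu B = ((fine (nu (cube 1)) / 2 ^+ n)%:E * lebesgue_rV R n B)%E.
Proof.
move=> nush nufin B mB.
have sf : sigma_finite setT nu.
  by exists (fun k => cube k%:R); [rewrite cube_bigcup|split => //; exact: measurable_cube].
pose H1 := isSFinite.Build _ _ _ _ (sfinite_measure_sigma_finite sf).
pose H2 := isSigmaFinite.Build _ _ _ _ sf.
pose nu' := HB.pack_for (sigma_finite_measure 'rV[R]_n R) (Measure.sort nu) H1 H2.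
have : (lebesgue_rV R n B * nu (cube 1) = nu B * lebesgue_rV R n (-%R @^-1` cube 1))%E.
  exact: (shift_invariant_proportional (nu := nu') nush (measurable_cube 1) mB).
rewrite (_ : -%R @^-1` cube 1 = @cube n 1); last first.
  by apply/seteqP; split=> x /= h i; have := h i; rewrite mxE normrN.
rewrite lebesgue_cube// mulr1.
have fin1 : nu (cube 1) \is a fin_num.
  by rewrite ge0_fin_numE ?(nufin 1%N).
rewrite -[nu (cube 1)](fineK fin1) => /(congr1 (fun x => (2 ^+ n)^-1%:E * x)%E).
have p2 : (2 ^+ n : R) != 0 by rewrite expf_neq0.
rewrite [(nu B * _)%E]muleC [RHS]muleA -EFinM mulVf// mul1e => <-.
by rewrite muleC -muleA -EFinM muleC.
Qed.

Lemma cube_mulmx n p (M : 'M[R]_(n, p)) (r : R) : exists s : nat,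
  forall x : 'rV[R]_n, cube r x -> cube s%:R (x *m M).
Proof.
pose S := \sum_i \sum_j `|r * M i j|.
exists (Num.truncn S).+1 => x xr j.
apply: (@le_trans _ _ S); last by rewrite ltW// truncnS_gt.
rewrite mxE (le_trans (ler_norm_sum _ _ _))//; apply: ler_sum => i _.
rewrite normrM (@le_trans _ _ (`|r * M i j|))//.
  rewrite normrM ler_wpM2r// (le_trans (xr i))// ler_norm//.
by rewrite (bigD1 j)//= lerDl sumr_ge0.
Qed.

(** A preimage of [cube 1] is measured, so the value turns out to be the inverse of the absolute
    determinant. *)
Definition vol_factor n (psi : 'M[R]_n) : R :=
  fine (lebesgue_rV R n [set x | cube 1 (x *m psi)]) / 2 ^+ n.

Lemma measurable_mulmx n p (M : 'M[R]_(n, p)) :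
  measurable_fun setT (fun x : 'rV[R]_n => x *m M).
Proof. exact: measurable_fun_mulmx. Qed.

Lemma vol_factorP n (psi : 'M[R]_n) B : psi \in unitmx -> measurable B ->
  lebesgue_rV R n [set x | B (x *m psi)] = ((vol_factor psi)%:E * lebesgue_rV R n B)%E.
Proof.
move=> psiU mB; have mpsi := measurable_mulmx psi.
apply: (@shift_invariant_lebesgue n (pushforward (lebesgue_rV R n) (mulmxr psi))) => //.
  move=> a A mA; rewrite /pushforward/=.
  rewrite -[RHS](lebesgue_rV_shift (a *m invmx psi)).
    by congr (lebesgue_rV R n _); apply/seteqP; split => x /=;
      rewrite mulmxDl mulmxKV.
  exact: measurable_preimage mpsi mA.
move=> k; rewrite /pushforward/=.
have [s Hs] := cube_mulmx (invmx psi) k%:R.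
apply: (@le_lt_trans _ _ (lebesgue_rV R n (cube s%:R))); last first.
  by rewrite lebesgue_cube ?ltry.
apply: (le_measure (lebesgue_rV R n)); rewrite ?inE.
- exact: measurable_preimage mpsi (measurable_cube _).
- exact: measurable_cube.
- by move=> x /= /Hs; rewrite mulmxK.
Qed.

Lemma vol_factor_eq n (psi : 'M[R]_n) (c : R) :
  lebesgue_rV R n [set x | cube 1 (x *m psi)] = (c * 2 ^+ n)%:E -> vol_factor psi = c.
Proof. by rewrite /vol_factor => ->; rewrite /= mulfK// expf_neq0. Qed.

Lemma vol_factorM n (psi psi' : 'M[R]_n) : psi \in unitmx -> psi' \in unitmx ->
  vol_factor (psi *m psi') = vol_factor psi * vol_factor psi'.
Proof.
move=> U U'; apply: vol_factor_eq.
under eq_set do rewrite mulmxA.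
rewrite (vol_factorP (B := [set y | cube 1 (y *m psi')]))//; last first.
  exact: measurable_preimage (measurable_mulmx psi') (measurable_cube _).
rewrite vol_factorP//; last exact: measurable_cube.
by rewrite lebesgue_cube// mulr1 -!EFinM mulrA.
Qed.

Lemma vol_factor_perm n (s : 'S_n) : vol_factor (perm_mx s) = 1.
Proof.
apply: vol_factor_eq; rewrite mul1r -[in RHS](mulr1 2) -lebesgue_cube//.
have E (x : 'rV[R]_n) i : (x *m perm_mx s) ord0 (s i) = x ord0 i.
  rewrite mxE (bigD1 i)//= !mxE eqxx mulr1 big1 ?addr0// => j ji.
  by rewrite !mxE (inj_eq perm_inj) (negPf ji) mulr0.
have [g _ gK] := injF_bij (@perm_inj _ s).
congr (lebesgue_rV R n _); apply/seteqP; split => x /= h i.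
  by rewrite -E.
by rewrite -(gK i) E.
Qed.

Lemma cons_rV_block n (t : R) (y : 'rV[R]_n) (psi : 'M[R]_(1 + n)) :
  (cons_rV (t, y) : 'rV_(1 + n)) *m psi =
  cons_rV (t * psi ord0 ord0 + (y *m dlsubmx psi) ord0 ord0,
           t *: ursubmx psi + y *m drsubmx psi).
Proof.
rewrite -[in LHS](submxK psi) /cons_rV mul_row_block/= !mul_scalar_mx; congr row_mx.
apply/matrixP => i j; rewrite (ord1 i) (ord1 j) !mxE eqxx mulr1n.
by congr (_ * psi _ _ + _); apply/val_inj.
Qed.

(** The first coordinate of [x *m U] depends only on that of [x]. Slicing along it, each nonempty
    slice is a translate of the preimage of a cube under the lower right block, and the admissible
    first coordinates form an interval of length [2 / |U_00|]. *)
Lemma vol_factor_upper n (U : 'M[R]_n) : U \in unitmx ->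
  (forall i j : 'I_n, (j < i)%N -> U i j = 0) -> vol_factor U = `|\det U|^-1.
Proof.
elim: n U => [|n IH] U UU Up; apply: vol_factor_eq.
  rewrite det_mx00 normr1 invr1 mul1r -[in RHS](mulr1 2) -lebesgue_cube//.
  by congr (lebesgue_rV R 0 _); apply/seteqP; split => x /= h [].
have Udl : @dlsubmx R 1 n 1 n U = 0.
  by apply/matrixP => i j; rewrite !mxE Up//= (ord1 j).
have detU : \det U = U ord0 ord0 * \det (@drsubmx R 1 n 1 n U).
  rewrite -[in LHS](@submxK R 1 n 1 n U) Udl (@det_ublock R 1 n).
  rewrite det_mx11 !mxE; congr (U _ _ * _); exact/val_inj.
have : U \in unitmx by [].
rewrite unitmxE detU unitrM !unitfE => /andP[U00 UdU].
have UdrU : drsubmx (U : 'M[R]_(1 + n)) \in unitmx by rewrite unitmxE unitfE.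
rewrite lebesgue_rVS1; last exact: measurable_preimage (measurable_mulmx U) (measurable_cube _).
pose I := [set t : R | `|t + 0| <= `|U ord0 ord0|^-1].
have mI : measurable I.
  rewrite (_ : I = `[- `|U ord0 ord0|^-1, `|U ord0 ord0|^-1]%classic).
    exact: measurable_itv.
  by apply/seteqP; split=> t /=; rewrite /I/= addr0 in_itv/= ler_norml.
pose c := `|\det (drsubmx (U : 'M[R]_(1 + n)))|^-1.
transitivity (\int[lam]_t ((c * 2 ^+ n)%:E * (\1_I t)%:E))%E.
  apply: eq_integral => t _; rewrite indicE.
  have H y : cube 1 (cons_rV (t, y) *m U) <->
      I t /\ cube 1 (t *: ursubmx (U : 'M[R]_(1 + n)) + y *m drsubmx (U : 'M[R]_(1 + n))).
    rewrite (cons_rV_block t y U) cube_cons_rV Udl mulmx0 mxE addr0 normrM.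
    by rewrite /I/= addr0 -ler_pdivlMr ?normr_gt0// mul1r.
  have [/set_mem tI|/negP tI] := boolP (t \in I); last first.
    rewrite mule0 (_ : [set y | _] = set0) ?measure0//.
    by apply/seteqP; split => // y /= /H[/mem_set].
  rewrite mule1 EFinM /c -IH//; last first.
    by move=> i j ji; rewrite !mxE Up//= /bump/= ltnS.
  rewrite -{1}(mulr1 2) -lebesgue_cube//.
  set w : 'rV[R]_n := t *: _ in H.
  have mw : measurable_fun setT (fun y : 'rV[R]_n => y + w) by exact: measurable_funD_rV.
  rewrite -(lebesgue_rV_shift w (measurable_cube 1)) -vol_factorP//; last first.
    exact: measurable_preimage mw (measurable_cube 1).
  congr (lebesgue_rV R n _); apply/seteqP; split => y /=.
    by move=> /H[_]; rewrite addrC.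
  by move=> h; apply/H; split => //; rewrite addrC.
rewrite ge0_integralZl//; last 2 first.
- exact/measurable_EFinP.
- by rewrite lee_fin mulr_ge0// /c invr_ge0.
rewrite integral_indic// setIT (_ : (_ : set _ -> \bar R) I = (2 * `|U ord0 ord0|^-1)%:E).
  by rewrite -EFinM /c normrM invfM exprS; congr EFin; ring.
exact: lebesgue_itv_sym.
Qed.

(** Here the last coordinates of [x *m L] depend only on those of [x], so the slicing is along them,
    and each nonempty slice is a translated interval of length 2. *)
Lemma vol_factor_lower n (L : 'M[R]_n) :
  (forall i j : 'I_n, (i <= j)%N -> L i j = (i == j)%:R) -> vol_factor L = 1.
Proof.
elim: n L => [|n IH] L Lo; apply: vol_factor_eq; rewrite mul1r.
  rewrite -[in RHS](mulr1 2) -lebesgue_cube//.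
  by congr (lebesgue_rV R 0 _); apply/seteqP; split => x /= h [].
rewrite lebesgue_rVS2; last exact: measurable_preimage (measurable_mulmx L) (measurable_cube _).
have Lur : @ursubmx R 1 n 1 n L = 0.
  apply/matrixP => i j; rewrite !mxE Lo//= (ord1 i)//.
have LoI (i j : 'I_n) : (i <= j)%N -> drsubmx (L : 'M[R]_(1 + n)) i j = (i == j)%:R.
  by move=> ij; rewrite !mxE Lo//= -!val_eqE/= eqn_add2l.
have LU : drsubmx (L : 'M[R]_(1 + n)) \in unitmx.
  rewrite unitmxE unitfE det_trig; last first.
    apply/is_trig_mxP => i j ij; rewrite LoI; last exact: ltnW.
    by rewrite -val_eqE/= ltn_eqF.
  by rewrite prodf_seq_neq0; apply/allP => i _; rewrite LoI// eqxx oner_neq0.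
pose Q := [set y | cube 1 (y *m drsubmx (L : 'M[R]_(1 + n)))].
have mQ : measurable Q.
  exact: measurable_preimage (measurable_mulmx _) (measurable_cube _).
transitivity (\int[lebesgue_rV R n]_y (2%:E * (\1_Q y)%:E))%E.
  apply: eq_integral => y _; rewrite indicE.
  have H t : cube 1 (cons_rV (t, y) *m L) <->
     `|t + (y *m dlsubmx (L : 'M[R]_(1 + n))) ord0 ord0| <= 1 /\ Q y.
    by rewrite (cons_rV_block t y L) cube_cons_rV Lur scaler0 add0r Lo// mulr1.
  have [/set_mem yQ|/negP yQ] := boolP (y \in Q); last first.
    rewrite mule0 (_ : [set t | _] = set0) ?measure0//.
    by apply/seteqP; split => // t /= /H[_ /mem_set].
  rewrite mule1 -[2]mulr1 -(lebesgue_itv_sym ((y *m dlsubmx (L : 'M[R]_(1 + n))) ord0 ord0))//.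
  congr (lam _); apply/seteqP; split => t /=; first by move=> /H[].
  by move=> h; apply/H.
rewrite ge0_integralZl//; last exact/measurable_EFinP.
have volQ : lebesgue_rV R n Q = (2 ^+ n)%:E.
  rewrite /Q vol_factorP//; last exact: measurable_cube.
  by rewrite IH// mul1e lebesgue_cube// mulr1.
rewrite integral_indic// setIT (_ : (_ : set _ -> \bar R) Q = (2 ^+ n)%:E).
  by rewrite -EFinM exprS.
exact: volQ.
Qed.

(** The LUP decomposition and multiplicativity reduce the claim to permutations, which preserve the
    cube, and to triangular matrices. Size zero is apart because [cormen_lup] takes matrices of
    positive size. *)
Lemma vol_factorE n (psi : 'M[R]_n) : psi \in unitmx ->
  vol_factor psi = `|\det psi|^-1.
Proof.
case: n psi => [|n] psi psiU; first by apply: vol_factor_upper => // -[].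
have := cormen_lup_correct psi; have := cormen_lup_perm psi.
have := cormen_lup_lower psi; have := cormen_lup_upper psi.
case: (cormen_lup psi) => [[P L] U] /= Uup Llo /is_perm_mxP[s ->] {P} E0.
have E : perm_mx s *m psi = L *m U := E0.
have detL : \det L = 1.
  rewrite det_trig; last first.
    by apply/is_trig_mxP => i j ij; rewrite Llo 1?ltnW// -val_eqE/= ltn_eqF.
  by rewrite big1// => i _; rewrite Llo// eqxx.
have sU : (perm_mx s : 'M[R]_n.+1) \in unitmx by exact: unitmx_perm.
have LU : L \in unitmx by rewrite unitmxE detL unitr1.
have UU : U \in unitmx.
  have : perm_mx s *m psi \in unitmx by rewrite unitmx_mul sU.
  by rewrite E unitmx_mul => /andP[].
rewrite -[LHS]mul1r -(vol_factor_perm s) -vol_factorM// E vol_factorM//.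
rewrite vol_factor_lower// mul1r vol_factor_upper//.
have /(congr1 (fun x => `|x|^-1)) := congr1 determinant E.
by rewrite !det_mulmx detL mul1r normrM det_perm normrX normrN normr1 expr1n mul1r.
Qed.

Lemma lebesgue_mulmx n (psi : 'M[R]_n) B : psi \in unitmx -> measurable B ->
  lebesgue_rV R n [set x | B (x *m psi)] =
  (`|\det psi|^-1%:E * lebesgue_rV R n B)%E.
Proof. by move=> psiU mB; rewrite vol_factorP// vol_factorE. Qed.

End lebesgue_linear.

(** * The Euclidean norm and its comparison with the sup norm *)

Section euclidean_norm.
Context (R : realType).
Implicit Types n : nat.

Lemma dotE n (x y : 'rV[R]_n) : dot x y = (x *m y^T) ord0 ord0.
Proof. by rewrite /dot mxE; apply: eq_bigr => i _; rewrite mxE. Qed.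

Lemma dotC n (x y : 'rV[R]_n) : dot x y = dot y x.
Proof. by rewrite /dot; apply: eq_bigr => i _; rewrite mulrC. Qed.

Lemma dotDl n (x y z : 'rV[R]_n) : dot (x + y) z = dot x z + dot y z.
Proof. by rewrite !dotE mulmxDl mxE. Qed.

Lemma dotZl n a (x y : 'rV[R]_n) : dot (a *: x) y = a * dot x y.
Proof. by rewrite !dotE -scalemxAl mxE. Qed.

Lemma dotDr n (x y z : 'rV[R]_n) : dot z (x + y) = dot z x + dot z y.
Proof. by rewrite dotC dotDl !(dotC z). Qed.

Lemma dotZr n a (x y : 'rV[R]_n) : dot x (a *: y) = a * dot x y.
Proof. by rewrite dotC dotZl dotC. Qed.

Lemma dotNl n (x y : 'rV[R]_n) : dot (- x) y = - dot x y.
Proof. by rewrite -scaleN1r dotZl mulN1r. Qed.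

Lemma dotBl n (x y z : 'rV[R]_n) : dot (x - y) z = dot x z - dot y z.
Proof. by rewrite dotDl dotNl. Qed.

Lemma dotBr n (x y z : 'rV[R]_n) : dot z (x - y) = dot z x - dot z y.
Proof. by rewrite dotC dotBl !(dotC z). Qed.

Lemma dot0l n (x : 'rV[R]_n) : dot 0 x = 0.
Proof. by rewrite -(scale0r 0) dotZl mul0r. Qed.

Lemma dot_mulmx n p (x : 'rV[R]_n) (M : 'M[R]_(n, p)) (y : 'rV[R]_p) :
  dot (x *m M) y = dot x (y *m M^T).
Proof. by rewrite !dotE trmx_mul trmxK mulmxA. Qed.

Lemma dot_ge0 n (x : 'rV[R]_n) : 0 <= dot x x.
Proof. by apply: sumr_ge0 => i _; exact: sqr_ge0. Qed.

Lemma enorm_ge0 n (x : 'rV[R]_n) : 0 <= enorm x.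
Proof. exact: sqrtr_ge0. Qed.

Lemma enorm_sqr n (x : 'rV[R]_n) : enorm x ^+ 2 = dot x x.
Proof. by rewrite sqr_sqrtr// dot_ge0. Qed.

Lemma enormZ n a (x : 'rV[R]_n) : enorm (a *: x) = `|a| * enorm x.
Proof.
by rewrite /enorm dotZl dotZr mulrA -expr2 sqrtrM ?sqr_ge0// sqrtr_sqr.
Qed.

Lemma enormN n (x : 'rV[R]_n) : enorm (- x) = enorm x.
Proof. by rewrite -scaleN1r enormZ normrN1 mul1r. Qed.

Lemma enorm0 n : enorm (0 : 'rV[R]_n) = 0.
Proof. by rewrite /enorm dot0l sqrtr0. Qed.

Lemma enormBC n (x y : 'rV[R]_n) : enorm (x - y) = enorm (y - x).
Proof. by rewrite -enormN opprB. Qed.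

Lemma coord_le_enorm n (x : 'rV[R]_n) i : `|x ord0 i| <= enorm x.
Proof.
rewrite -sqrtr_sqr ler_wsqrtr// /dot (bigD1 i)//= expr2 lerDl.
by apply: sumr_ge0 => j _; exact: sqr_ge0.
Qed.

Lemma enorm_eq0 n (x : 'rV[R]_n) : (enorm x == 0) = (x == 0).
Proof.
apply/idP/idP => [/eqP x0|/eqP ->]; last by rewrite enorm0.
apply/eqP/rowP => i; rewrite mxE; apply/eqP.
by rewrite -normr_le0 -x0 coord_le_enorm.
Qed.

Lemma enorm_gt0 n (x : 'rV[R]_n) : (0 < enorm x) = (x != 0).
Proof. by rewrite lt0r enorm_eq0 enorm_ge0 andbT. Qed.

Lemma dot_le_enorm n (x y : 'rV[R]_n) : `|dot x y| <= enorm x * enorm y.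
Proof.
have [->|y0] := eqVneq y 0; first by rewrite dotC dot0l enorm0 normr0 mulr0.
rewrite -(@ler_pXn2r _ 2)// ?nnegrE ?mulr_ge0 ?enorm_ge0//.
rewrite exprMn !enorm_sqr -normrX ger0_norm ?sqr_ge0//.
have yy : 0 < dot y y by rewrite -enorm_sqr exprn_gt0// enorm_gt0.
(* This square equals [dot y y] times the defect in the Cauchy-Schwarz inequality. *)
have := dot_ge0 (dot y y *: x - dot x y *: y).
rewrite !(dotBl, dotBr, dotZl, dotZr) (dotC y x) => h.
rewrite -(ler_pM2l yy); nra.
Qed.

Lemma enormD n (x y : 'rV[R]_n) : enorm (x + y) <= enorm x + enorm y.
Proof.
rewrite -(@ler_pXn2r _ 2)// ?nnegrE ?addr_ge0 ?enorm_ge0//.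
rewrite sqrrD !enorm_sqr !(dotDl, dotDr) (dotC y x).
have := le_trans (ler_norm _) (dot_le_enorm x y); nra.
Qed.

Lemma enormB n (x y : 'rV[R]_n) : enorm (x - y) <= enorm x + enorm y.
Proof. by rewrite -(enormN y) enormD. Qed.

Lemma enorm_le_sum n (x : 'rV[R]_n) : enorm x <= \sum_i `|x ord0 i|.
Proof.
rewrite -(@ler_pXn2r _ 2)// ?nnegrE ?enorm_ge0 ?sumr_ge0//.
rewrite enorm_sqr expr2 mulr_suml; apply: ler_sum => i _.
rewrite -[leLHS]ger0_norm ?sqr_ge0// normrM ler_wpM2l//.
by rewrite (bigD1 i)//= lerDl sumr_ge0.
Qed.

Lemma enorm_mulmx n p (M : 'M[R]_(n, p)) :
  exists2 C, 0 < C & forall x : 'rV[R]_n, enorm (x *m M) <= C * enorm x.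
Proof.
pose S := \sum_j \sum_i `|M i j|.
have S0 : 0 <= S by rewrite sumr_ge0// => i _; rewrite sumr_ge0.
(* The summand 1 keeps the constant positive for a zero matrix; later proofs divide by it. *)
exists (S + 1) => [|x]; first by rewrite ltr_wpDl.
rewrite (le_trans (enorm_le_sum _))// mulrDl mul1r ler_wpDr ?enorm_ge0//.
rewrite mulr_suml; apply: ler_sum => j _; rewrite mxE mulr_suml.
rewrite (le_trans (ler_norm_sum _ _ _))//; apply: ler_sum => i _.
by rewrite normrM mulrC ler_wpM2l// coord_le_enorm.
Qed.

Lemma continuous_sum_fun (T : topologicalType) (I : finType) (F : I -> T -> R) :
  (forall i, continuous (F i)) -> continuous (fun x => \sum_i F i x).
Proof.
move=> cF x; elim: (index_enum I) => [|i s IH].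
  rewrite (_ : (fun y => _) = cst 0); last by apply/funext => y; rewrite big_nil.
  exact: cst_continuous.
rewrite (_ : (fun y => _) = F i \+ (fun y => \sum_(j <- s) F j y)).
  exact: cvgD (cF i x) IH.
by apply/funext => y; rewrite big_cons.
Qed.

Lemma continuous_dotr n (y : 'rV[R]_n) : continuous (dot y).
Proof.
apply: continuous_sum_fun => i x.
apply: (@continuousM R 'rV[R]_n (fun=> y ord0 i) (fun x => x ord0 i) x).
  exact: cst_continuous.
exact: coord_continuous.
Qed.

Lemma continuous_enorm n : continuous (@enorm R n).
Proof.
move=> x; rewrite /enorm.
apply: (@continuous_comp _ _ _ (fun x : 'rV[R]_n => dot x x) Num.sqrt x);
  last exact: sqrt_continuous.
by apply: continuous_sum_fun => i {}x;
  apply: (@continuousM R 'rV[R]_n (fun x => x ord0 i) (fun x => x ord0 i) x);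
  exact: coord_continuous.
Qed.

Lemma norm_le_enorm n (x : 'rV[R]_n) : `|x| <= enorm x.
Proof.
rewrite [leLHS]/Num.norm /= mx_normrE; apply/bigmax_leP; split=> [|[i j] _ /=].
  exact: enorm_ge0.
by rewrite (ord1 i) coord_le_enorm.
Qed.

Lemma enorm_le_norm n (x : 'rV[R]_n) : enorm x <= n%:R * `|x|.
Proof.
rewrite (le_trans (enorm_le_sum _))// mulrC.
rewrite mulr_natr -[X in _ *+ X]card_ord -sumr_const.
apply: ler_sum => i _.
rewrite [leRHS]/Num.norm /= mx_normrE.
exact: (le_bigmax _ (fun k : 'I_1 * 'I_n => `|x k.1 k.2|) (ord0, i)).
Qed.

End euclidean_norm.

(** * Hausdorff measure *)
Section hausdorff_theory.
Context (R : realType).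
Local Open Scope ereal_scope.

Lemma diam_ge n (A : set 'rV[R]_n) x y : A x -> A y -> (enorm (x - y)%R)%:E <= diam A.
Proof. by move=> Ax Ay; apply: ereal_sup_ubound; exists x => //; exists y. Qed.

Lemma diam_ge0 n (A : set 'rV[R]_n) : A !=set0 -> 0 <= diam A.
Proof. by move=> [x Ax]; rewrite (le_trans _ (diam_ge Ax Ax))// lee_fin enorm_ge0. Qed.

Lemma diam_le n (A : set 'rV[R]_n) d :
  (forall x y, A x -> A y -> (enorm (x - y)%R)%:E <= d) -> diam A <= d.
Proof. by move=> H; apply: ge_ereal_sup => _ [x Ax [y Ay <-]]; exact: H. Qed.

Lemma le_diam n (A B : set 'rV[R]_n) : A `<=` B -> diam A <= diam B.
Proof. by move=> AB; apply: diam_le => x y /AB Bx /AB By; exact: diam_ge. Qed.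

Lemma le_expe (x y : \bar R) k : 0 <= x -> x <= y -> x ^+ k <= y ^+ k.
Proof.
move=> x0 xy; elim: k => [|k IH]; first by rewrite !expe0.
by rewrite !expeS lee_pmul// expe_ge0.
Qed.

Lemma expeZ (c : R) (x : \bar R) k : (c%:E * x) ^+ k = (c ^+ k)%:E * x ^+ k.
Proof.
elim: k => [|k IH]; first by rewrite !expe0 mule1.
by rewrite !expeS IH exprS EFinM muleACA.
Qed.

Lemma unit_ball_volume_ge0 m : 0 <= unit_ball_volume R m.
Proof. exact: measure_ge0. Qed.

Lemma unit_ball_volume_fin m : unit_ball_volume R m \is a fin_num.
Proof.
rewrite ge0_fin_numE ?unit_ball_volume_ge0//.
apply: (@le_lt_trans _ _ (lebesgue_rV R m (cube 1%R))); last first.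
  by rewrite lebesgue_cube// ltry.
apply: (le_measure (lebesgue_rV R m)); rewrite ?inE.
- rewrite (_ : [set x | _] = @enorm R m @^-1` `]-oo, 1%R]%classic).
    exact: (measurable_preimage (@measurable_enorm R m) (measurable_itv _)).
  by apply/seteqP; split => x /=; rewrite in_itv.
- exact: measurable_cube.
- by move=> x /= x1 i; rewrite (le_trans (coord_le_enorm _ _)).
Qed.

Lemma hausdorff_gauge0 n m : hausdorff_gauge m (set0 : set 'rV[R]_n) = 0.
Proof. by rewrite /hausdorff_gauge eqxx. Qed.

Lemma hausdorff_gauge_ge0 n m (A : set 'rV[R]_n) : 0 <= hausdorff_gauge m A.
Proof.
rewrite /hausdorff_gauge; case: eqP => // /eqP/set0P/diam_ge0 dA.
by rewrite mule_ge0 ?unit_ball_volume_ge0// expe_ge0// mule_ge0.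
Qed.

(** Two images of one parameter set are compared, rather than a set and its Lipschitz image, so that
    a projection can be bounded from both sides without naming its inverse on the set. *)
Lemma hausdorff_gauge_lip T n p m (f : T -> 'rV[R]_n) (g : T -> 'rV[R]_p)
    (E : set T) (C : R) : (0 < C)%R ->
  (forall x y, E x -> E y -> (enorm (f x - f y) <= C * enorm (g x - g y))%R) ->
  hausdorff_gauge m (f @` E) <= (C ^+ m)%:E * hausdorff_gauge m (g @` E).
Proof.
move=> C0 H; rewrite /hausdorff_gauge.
have [->|/set0P E0] := eqVneq E set0; first by rewrite !image_set0 !eqxx mule0.
have nz k (h : T -> 'rV[R]_k) : (h @` E == set0) = false.
  by apply/negP => /eqP hE; case: E0 => x Ex; have : set0 (h x) by rewrite -hE; exists x.
rewrite !nz.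
rewrite muleCA lee_wpmul2l ?unit_ball_volume_ge0// -expeZ.
have fE0 : f @` E !=set0 by case: E0 => x Ex; exists (f x), x.
apply: le_expe; first by rewrite mule_ge0 ?diam_ge0.
rewrite muleCA lee_wpmul2l//; apply: diam_le => _ _ [x Ex <-] [y Ey <-].
apply: (@le_trans _ _ (C%:E * (enorm (g x - g y)%R)%:E)).
  by rewrite -EFinM lee_fin H.
by rewrite lee_pmul2l// diam_ge.
Qed.

Lemma le_hausdorff_gauge n m (A B : set 'rV[R]_n) : A `<=` B ->
  hausdorff_gauge m A <= hausdorff_gauge m B.
Proof.
move=> AB; rewrite {1}/hausdorff_gauge; case: eqP => [_|/eqP/set0P A0].
  exact: hausdorff_gauge_ge0.
rewrite /hausdorff_gauge ifF; last first.
  by apply/negP => /eqP B0; case: A0 => x /AB; rewrite B0.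
rewrite lee_wpmul2l ?unit_ball_volume_ge0// le_expe// ?mule_ge0 ?diam_ge0//.
by rewrite lee_wpmul2l// le_diam.
Qed.

Section premeasure.
Variables (n m : nat) (delta : R).
Let T := g_sigma_algebraType [set: set 'rV[R]_n].
(* The size restriction on covers becomes an infinite weight, which puts the
   premeasure in the scope of the library's outer measure construction. *)
Let w (A : set T) : \bar R :=
  if diam (A : set 'rV[R]_n) <= delta%:E then hausdorff_gauge m (A : set 'rV[R]_n)
  else +oo.

Let w_ge0 A : 0 <= w A.
Proof. by rewrite /w; case: ifP => // _; exact: hausdorff_gauge_ge0. Qed.

Let w0 : w set0 = 0.
Proof.
rewrite /w hausdorff_gauge0 ifT//.
by apply: diam_le.
Qed.

Let mT (A : set T) : measurable A.
Proof. by apply: sub_sigma_algebra. Qed.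

Lemma hausdorff_premeasure_mu_ext :
  @hausdorff_premeasure R n m delta = mu_ext w :> (set 'rV[R]_n -> _).
Proof.
apply/funext => A; apply/eqP; rewrite eq_le; apply/andP; split.
  apply: le_ereal_inf_tmp => _ [U [_ AU] <-].
  have [[k Uk]|/forallNP Udelta] :=
      pselect (exists k, ~~ (diam (U k : set 'rV[R]_n) <= delta%:E)).
    rewrite (nneseries_pinfty (k := k)) ?leey// /w.
    by rewrite (negPf Uk).
  apply: ereal_inf_lbound; exists U.
    by split=> // i; have /negP := Udelta i; rewrite negbK.
  apply: eq_eseriesr => i _; rewrite /w ifT//.
  by have /negP := Udelta i; rewrite negbK.
apply: le_ereal_inf_tmp => _ [U [AU Ud] <-].
apply: ereal_inf_lbound; exists U; first by split.
by apply: eq_eseriesr => i _; rewrite /w ifT.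
Qed.

Let pre0 : @hausdorff_premeasure R n m delta set0 = 0.
Proof. by rewrite hausdorff_premeasure_mu_ext mu_ext0. Qed.

Let pre_ge0 A : 0 <= @hausdorff_premeasure R n m delta A.
Proof. by rewrite hausdorff_premeasure_mu_ext mu_ext_ge0. Qed.

Let pre_le : {homo @hausdorff_premeasure R n m delta : A B / A `<=` B >-> A <= B}.
Proof. by rewrite hausdorff_premeasure_mu_ext; exact: (le_mu_ext w). Qed.

Let pre_sub : sigma_subadditive (@hausdorff_premeasure R n m delta).
Proof. by rewrite hausdorff_premeasure_mu_ext; exact: (mu_ext_sigma_subadditive w_ge0). Qed.

HB.instance Definition _ := isOuterMeasure.Build R 'rV[R]_n
  (@hausdorff_premeasure R n m delta) pre0 pre_ge0 pre_le pre_sub.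

Lemma hausdorff_premeasure_le_gauge (A : set 'rV[R]_n) :
  diam A <= delta%:E -> hausdorff_premeasure m delta A <= hausdorff_gauge m A.
Proof.
move=> dA; apply: ereal_inf_lbound.
exists (fun k : nat => if k == 0%N then A else set0 : set 'rV[R]_n).
  split; first by move=> x Ax; exists 0%N.
  by move=> [|k] //=; apply: diam_le.
rewrite nneseries_recl//; last by move=> k *; exact: hausdorff_gauge_ge0.
rewrite eseries_cond/= eseries0 ?adde0// => -[|]//= k _ _.
by rewrite hausdorff_gauge0.
Qed.

End premeasure.

Lemma le_hausdorff_premeasure n m (d e : R) (A : set 'rV[R]_n) : (d <= e)%R ->
  hausdorff_premeasure m e A <= hausdorff_premeasure m d A.
Proof.
move=> de; apply: ereal_inf_le_tmp => _ [U [AU Ud] <-].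
by exists U => //; split=> // i; rewrite (le_trans (Ud i))// lee_fin.
Qed.

Section measure.
Variables (n m : nat).
Local Notation H := (@hausdorff_measure R n m).

Lemma hausdorff_premeasure_le (d : R) A : (0 < d)%R ->
  hausdorff_premeasure m d A <= H A.
Proof. by move=> d0; apply: ereal_sup_ubound; exists d. Qed.

Lemma hausdorff_measure_le A x :
  (forall d : R, (0 < d)%R -> hausdorff_premeasure m d A <= x) -> H A <= x.
Proof. by move=> h; apply: ge_ereal_sup => _ [d d0 <-]; exact: h. Qed.

Let H0 : H set0 = 0.
Proof.
apply/eqP; rewrite eq_le; apply/andP; split.
  by apply: hausdorff_measure_le => d d0; rewrite outer_measure0.
by rewrite (le_trans _ (hausdorff_premeasure_le _ ltr01))// outer_measure_ge0.
Qed.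

Let H_ge0 A : 0 <= H A.
Proof.
by rewrite (le_trans _ (hausdorff_premeasure_le _ ltr01))// outer_measure_ge0.
Qed.

Let H_le : {homo H : A B / A `<=` B >-> A <= B}.
Proof.
move=> A B AB; apply: hausdorff_measure_le => d d0.
by rewrite (le_trans _ (hausdorff_premeasure_le _ d0))// le_outer_measure.
Qed.

Let H_sub : sigma_subadditive H.
Proof.
move=> F; apply: hausdorff_measure_le => d d0.
rewrite (le_trans (outer_measure_sigma_subadditive _ _))//.
apply: lee_nneseries => k *; first exact: outer_measure_ge0.
exact: hausdorff_premeasure_le.
Qed.

HB.instance Definition _ := isOuterMeasure.Build R 'rV[R]_n H H0 H_ge0 H_le H_sub.

End measure.

(** A cover of the [g]-image is pulled back to [E] and pushed forward by [f]. Diameters grow at most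
    by the factor [C], hence the scale [C^-1 * d] for the original cover. *)
Lemma hausdorff_measure_lip T n p m (f : T -> 'rV[R]_n) (g : T -> 'rV[R]_p)
    (E : set T) (C : R) : (0 < C)%R ->
  (forall x y, E x -> E y -> (enorm (f x - f y) <= C * enorm (g x - g y))%R) ->
  hausdorff_measure m (f @` E) <= (C ^+ m)%:E * hausdorff_measure m (g @` E).
Proof.
move=> C0 lip; apply: hausdorff_measure_le => d d0.
have Cm : (0 < C ^+ m)%R by rewrite exprn_gt0.
apply: (@le_trans _ _ ((C ^+ m)%:E * hausdorff_premeasure m (C^-1 * d)%R (g @` E))); last first.
  by rewrite lee_pmul2l// hausdorff_premeasure_le// mulr_gt0// invr_gt0.
rewrite -lee_pdivrMl//; apply: le_ereal_inf_tmp => _ [U [gU Ud] <-].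
pose V k := f @` (E `&` g @^-1` U k).
have VU k : hausdorff_gauge m (V k) <= (C ^+ m)%:E * hausdorff_gauge m (U k).
  apply: (@le_trans _ _ ((C ^+ m)%:E * hausdorff_gauge m (g @` (E `&` g @^-1` U k)))).
    by apply: hausdorff_gauge_lip => // x y [Ex _] [Ey _]; exact: lip.
  by rewrite lee_pmul2l// le_hausdorff_gauge// => _ [x [_ ?] <-].
rewrite lee_pdivrMl// -nneseriesZl; last by move=> k _; exact: hausdorff_gauge_ge0.
apply: (@le_trans _ _ (\sum_(i <oo) hausdorff_gauge m (V i))); last first.
  by apply: lee_nneseries => k *; [exact: hausdorff_gauge_ge0|exact: VU].
apply: ereal_inf_lbound; exists V => //; split.
  move=> _ [x Ex <-]; have [k _ Uk] : (\bigcup_i U i) (g x) by apply: gU; exists x.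
  by exists k => //; exists x.
move=> k; apply: diam_le => _ _ [x [Ex Ux] <-] [y [Ey Uy] <-].
apply: (@le_trans _ _ (C%:E * (enorm (g x - g y)%R)%:E)).
  by rewrite -EFinM lee_fin lip.
rewrite -lee_pdivlMl// -EFinM (le_trans _ (Ud k))//.
exact: diam_ge.
Qed.

End hausdorff_theory.

(** * Borel sets and Borel hulls for Hausdorff measure *)

Section hausdorff_borel.
Context (R : realType).
Local Open Scope ereal_scope.

(** At scales below [eta] no set of a cover meets both [A] and [B], so a cover of the union splits
    into one of [A] and one of [B]. *)
Lemma hausdorff_separated n m (A B : set 'rV[R]_n) (eta : R) : (0 < eta)%R ->
  (forall x y, A x -> B y -> (eta <= enorm (x - y))%R) ->
  hausdorff_measure m A + hausdorff_measure m B <= hausdorff_measure m (A `|` B).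
Proof.
move=> eta0 sep.
have pre d : (0 < d < eta)%R -> hausdorff_premeasure m d A + hausdorff_premeasure m d B <=
    hausdorff_premeasure m d (A `|` B).
  move=> /andP[d0 deta]; apply: le_ereal_inf_tmp => _ [U [ABU Ud] <-].
  pose V (C : set 'rV[R]_n) k := if `[< U k `&` C !=set0 >] then U k else set0.
  have HV C : C `<=` A `|` B ->
      hausdorff_premeasure m d C <= \sum_(i <oo) hausdorff_gauge m (V C i).
    move=> CAB; apply: ereal_inf_lbound; exists (V C) => //; split.
      move=> x Cx; have [k _ Ukx] := ABU _ (CAB _ Cx); exists k => //.
      by rewrite /V asboolT//; exists x.
    by move=> k; rewrite /V; case: ifP => // _; apply: diam_le.
  rewrite (le_trans (leeD (HV A _) (HV B _)))//.
  rewrite -nneseriesD; try by move=> *; exact: hausdorff_gauge_ge0.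
  apply: lee_nneseries => k *; first by rewrite adde_ge0 ?hausdorff_gauge_ge0.
  rewrite /V; case: asboolP => [[x [Ux Ax]]|_]; last first.
    by rewrite hausdorff_gauge0 add0e; case: ifP => // _;
      rewrite ?hausdorff_gauge0 ?hausdorff_gauge_ge0.
  case: asboolP => [[y [Uy By]]|_]; last by rewrite hausdorff_gauge0 adde0.
  have := le_trans (diam_ge Ux Uy) (Ud k); rewrite lee_fin => xyd.
  by have := lt_le_trans (le_lt_trans xyd deta) (sep _ _ Ax By); rewrite ltxx.
have [->|Hfin] := eqVneq (hausdorff_measure m (A `|` B)) +oo; first by rewrite leey.
(* Both measures are suprema over scales, so the two scales have to vary independently before the
   suprema are taken. *)
have pre2 d1 d2 : (0 < d1)%R -> (0 < d2)%R ->
    hausdorff_premeasure m d1 A + hausdorff_premeasure m d2 B <=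
    hausdorff_measure m (A `|` B).
  move=> d10 d20; pose d := Num.min (Num.min d1 d2) (eta / 2)%R.
  have d0 : (0 < d)%R by rewrite /d !lt_min d10 d20/= divr_gt0.
  have deta : (d < eta)%R.
    rewrite /d gt_min; apply/orP; right; lra.
  rewrite (le_trans _ (hausdorff_premeasure_le _ _ d0))//.
  rewrite (le_trans _ (pre _ _)) ?d0//.
  by rewrite leeD// le_hausdorff_premeasure// /d !ge_min lexx ?orbT.
have fin d C : (0 < d)%R -> C `<=` A `|` B -> hausdorff_premeasure m d C \is a fin_num.
  move=> d0 CAB; rewrite ge0_fin_numE ?outer_measure_ge0//.
  rewrite (le_lt_trans (hausdorff_premeasure_le _ _ d0))//.
  by rewrite (le_lt_trans (le_outer_measure _ _ _ CAB))// ltey.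
have finB : hausdorff_measure m B \is a fin_num.
  rewrite ge0_fin_numE ?outer_measure_ge0//.
  rewrite (@le_lt_trans _ _ (hausdorff_measure m (A `|` B)))//; last by rewrite ltey.
  by apply: le_outer_measure => x; right.
rewrite -leeBrDr//; apply: hausdorff_measure_le => d1 d10.
rewrite leeBrDr// addeC -leeBrDr ?fin//; apply: hausdorff_measure_le => d2 d20.
by rewrite leeBrDr ?fin// addeC pre2.
Qed.

(** Caratheodory's criterion for metric outer measures, with shells of the Lipschitz function [g] in
    place of distance shells: [C] is separated from the points where [g] exceeds [a] by a fixed
    amount, and the points in between lie in shells whose measures have a convergent sum. *)
Lemma caratheodory_sublevel n m (g : 'rV[R]_n -> R) (a : R) :
  (forall x y, (`|g x - g y| <= enorm (x - y))%R) ->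
  (@hausdorff_measure R n m).-caratheodory [set x | (g x <= a)%R].
Proof.
move=> glip; apply: le_caratheodory_measurable => X.
set H := @hausdorff_measure R n m; set C := [set x | _].
have [HX|HX] := eqVneq (H X) +oo; first by rewrite (le_trans (leey _))// -HX.
have HXfin : H X < +oo by rewrite ltey.
pose s k : R := (2 ^- k)%R.
have s0 k : (0 < s k)%R by rewrite invr_gt0 exprn_gt0.
have sS k : (s k.+1 = s k / 2)%R by rewrite /s exprS invfM mulrC.
have s_le i j : (i <= j)%N -> (s j <= s i)%R.
  by move=> ij; rewrite lef_pV2 ?posrE ?exprn_gt0// ler_weXn2l// ler1n.
(* The thickness of the shells halves towards the level [a]. Neighbouring shells may touch, but
   distinct shells with indices of equal parity are separated, hence the sums over [j.*2 + b]. *)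
pose r j := X `&` [set x | (a + s j.+1 < g x <= a + s j)%R].
pose XX k := X `&` [set x | (a + s k < g x)%R].
have sep A B t e : (0 < e)%R -> (A `<=` [set x | g x <= t]%R) ->
    (B `<=` [set x | t + e <= g x]%R) -> H A + H B <= H (A `|` B).
  move=> e0 At Be; apply: (hausdorff_separated m e0) => x y /At /= xt /Be /= yt.
  rewrite (le_trans _ (glip _ _))// ler_normr; apply/orP; right; lra.
have summ b : \sum_(j <oo) H (r (j.*2 + b)%N) <= H X.
  apply: lime_le; first by apply: is_cvg_nneseries => *; exact: outer_measure_ge0.
  apply: nearW => N; rewrite big_mkord.
  pose Y M := X `&` [set x | exists2 j, (j < M)%N & r (j.*2 + b)%N x].
  have: \sum_(j < N) H (r (j.*2 + b)%N) <= H (Y N).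
    elim: N => [|N IH]; first by rewrite big_ord0 outer_measure_ge0.
    rewrite big_ord_recr/= (le_trans (leeD2r _ IH))// addeC.
    (* With [t = s (N.*2 + b)], the new shell lies at or below the level [a + t] and the earlier
       ones of this parity above [a + 2 t]. *)
    rewrite (le_trans (sep _ _ (a + s (N.*2 + b)%N)%R (s (N.*2 + b)%N) _ _ _))//.
    - by move=> x [_ /= /andP[]].
    - move=> x [_ /= [j jN [_ /= /andP[/ltW + _]]]]; apply: le_trans.
      rewrite -addrA lerD2l.
      rewrite (@le_trans _ _ (s (N.*2 + b)%N.-1))//.
        suff -> : s (N.*2 + b)%N.-1 = (s (N.*2 + b)%N + s (N.*2 + b)%N)%R by [].
        have -> : (N.*2 + b = (N.*2 + b).-1.+1)%N by lia.
        by rewrite sS/=; field.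
      by apply: s_le; lia.
    apply: le_outer_measure => x [|]; first by move=> /[dup] [[]]; split=> //; exists N.
    by move=> [Xx [j jN rj]]; split=> //; exists j => //; exact: ltnW.
  move=> /le_trans; apply; apply: le_outer_measure; exact: subIsetl.
pose t b k := \sum_(k <= j <oo) H (r (j.*2 + b)%N).
have t0 b : t b k @[k --> \oo] --> 0.
  apply: nneseries_tail_cvg; first exact: le_lt_trans (summ b) _.
  by move=> *; exact: outer_measure_ge0.
have t_ge0 b k : 0 <= t b k by apply: nneseries_ge0 => *; exact: outer_measure_ge0.
(* The error consists of the tails of the two shell series, which vanish as [k] grows because [H X]
   is finite. *)
have key k : H (X `&` C) + H (X `&` ~` C) <= H X + (t 0%N k + t 1%N k).
  have sub : X `&` ~` C `<=` XX k.*2 `|`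
     ((\bigcup_(j in ~` `I_k) r (j.*2 + 0)%N) `|` (\bigcup_(j in ~` `I_k) r (j.*2 + 1)%N)).
    move=> x [Xx /= /negP]; rewrite -ltNge => agx.
    have [lt|ge] := ltP (a + s k.*2)%R (g x); first by left.
    right.
    have [p Hp] : exists p, (a + s p < g x)%R.
      have [p Hp] : exists p : nat, ((g x - a)^-1 < 2 ^+ p)%R.
        exists (Num.truncn (g x - a)^-1).+1.
        rewrite (lt_le_trans (truncnS_gt _))// -natrX ler_nat ltnW//.
        exact: ltn_expl.
      exists p; rewrite addrC -ltrBrDr.
      by rewrite invf_plt ?posrE ?exprn_gt0 ?subr_gt0.
    have kp : (k.*2 < p)%N.
      rewrite ltnNge; apply/negP => /s_le pk.
      by have := le_lt_trans (lerD (lexx a) pk) (lt_le_trans Hp ge); rewrite ltxx.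
    have [j kj rj] : exists2 j, (k.*2 <= j)%N & r j x.
      move: Hp kp; elim: p => // p IH Hp kp.
      have [lt|ge'] := ltP (a + s p)%R (g x); last first.
        by exists p; [|split => //=; apply/andP].
      move: kp; rewrite ltnS leq_eqVlt => /orP[/eqP kp|]; last exact: IH.
      by move: lt; rewrite -kp ltNge ge.
    have := odd_double_half j; case: (odd j) => /= jj.
      by right; exists j./2 => /=; [lia|rewrite addnC jj].
    by left; exists j./2 => /=; [lia|rewrite addn0 -[X in X.*2]/(j./2) -[j./2.*2]add0n jj].
  rewrite (@le_trans _ _ (H (X `&` C) + (H (XX k.*2) + (t 0%N k + t 1%N k))))//.
    rewrite leeD2l// (le_trans (le_outer_measure _ _ _ sub))//.
    rewrite (le_trans (outer_measureU2 _ _ _))// leeD2l//.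
    rewrite (le_trans (outer_measureU2 _ _ _))// leeD//;
      exact: (outer_measure_sigma_subadditive_tail _ k (fun j => r (j.*2 + _)%N)).
  rewrite addeA leeD2r// (le_trans (sep _ _ a (s k.*2) _ _ _))//.
    by move=> x [_ /= /ltW].
  by apply: le_outer_measure => x [[]|[]].
have lim : H X + (t 0%N k + t 1%N k) @[k --> \oo] --> H X.
  have t01 : t 0%N k + t 1%N k @[k --> \oo] --> 0.
    by rewrite -[X in _ --> X]adde0; apply: cvgeD.
  rewrite -[X in _ --> X]adde0.
  apply: (@cvgeD _ \oo _ _ (cst (H X)) (fun k => t 0%N k + t 1%N k) (H X) 0) => //.
    by rewrite adde_defC fin_num_adde_defr.
  exact: cvg_cst.
rewrite -[leRHS](cvg_lim (@ereal_hausdorff R) lim).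
by apply: lime_ge; [apply/cvg_ex; exists (H X)|exact: nearW].
Qed.

(** Coordinates and their opposites are 1-Lipschitz, which settles open half-spaces, then rational
    boxes, and with them all open sets. *)
Lemma caratheodory_borel n m (A : set 'rV[R]_n) : measurable A ->
  (@hausdorff_measure R n m).-caratheodory A.
Proof.
set H := @hausdorff_measure R n m.
pose T := caratheodory_type H.
have Hi i a : H.-caratheodory [set x : 'rV[R]_n | (a < x ord0 i)%R].
  rewrite (_ : [set _ | _] = ~` [set x : 'rV[R]_n | (x ord0 i <= a)%R]); last first.
    by apply/seteqP; split=> x /=; rewrite ltNge => /negP.
  apply: caratheodory_measurable_setC; apply: caratheodory_sublevel => x y.
  by rewrite (le_trans _ (coord_le_enorm _ i))// !mxE.
have Lo i a : H.-caratheodory [set x : 'rV[R]_n | (x ord0 i < a)%R].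
  rewrite (_ : [set _ | _] = ~` [set x : 'rV[R]_n | (- x ord0 i <= - a)%R]); last first.
    by apply/seteqP; split=> x /=; rewrite lerN2 ltNge => /negP.
  apply: caratheodory_measurable_setC.
  apply: (@caratheodory_sublevel _ _ (fun x => - x ord0 i)%R) => x y.
  by rewrite -opprD normrN (le_trans _ (coord_le_enorm _ i))// !mxE.
suff : <<s @open 'rV[R]_n >> `<=` (@measurable _ T) by apply.
apply: smallest_sub; first exact: sigma_algebra_measurable.
move=> U oU; rewrite (open_bigcup_rV oU).
apply: (@countable_bigcupT_measurable _ T); first exact: countableP.
move=> q; case: ifPn => _; last exact: measurable0.
rewrite (_ : [set _ | _] = \bigcap_(i in [set: 'I_n])
   ([set x : 'rV[R]_n | (ratr (q i).1 < x ord0 i)%R] `&`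
    [set x : 'rV[R]_n | (x ord0 i < ratr (q i).2)%R])); last first.
  apply/seteqP; split => x /= h i; last by have [/= h1 h2] := h i I; rewrite in_itv/= h1.
  by move=> _; have := h i; rewrite in_itv/= => /andP[].
by apply: (@fin_bigcap_measurable _ T) => // i _; apply: measurableI; [exact: Hi|exact: Lo].
Qed.

Section measure.
Variables (n m : nat).
Local Notation H := (@hausdorff_measure R n m).

Let Hadd : semi_sigma_additive (H : set 'rV[R]_n -> _).
Proof.
move=> F mF tF mUF.
apply: (@caratheodory_measure_sigma_additive R 'rV[R]_n H) => //.
- by move=> k; exact: caratheodory_borel.
- exact: caratheodory_borel.
Qed.

HB.instance Definition _ := isMeasure.Build _ 'rV[R]_n R H
  (outer_measure0 H) (outer_measure_ge0 H) Hadd.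
End measure.

(* Each set [U] of diameter [d] lies in a closed set of the same diameter:
   [{x in D | forall y in D, |x - y| <= d}] with [D] the set of points within
   [d] of all of [U]. *)
Lemma closed_diam_hull n (U : set 'rV[R]_n) :
  exists V, [/\ closed V, U `<=` V & diam V <= diam U].
Proof.
pose D (W : set 'rV[R]_n) := [set x | forall y, W y -> (enorm (x - y)%R)%:E <= diam U].
have cD W : closed (D W).
  rewrite (_ : D W = \bigcap_(y in W) [set x | (enorm (x - y)%R)%:E <= diam U]); last first.
    by apply/seteqP; split.
  apply: closed_bigI => y _.
  have ce : continuous (fun x : 'rV[R]_n => enorm (x - y)%R).
    move=> x; apply: (@continuous_comp 'rV[R]_n 'rV[R]_n R (fun x => x - y)%R (@enorm R n) x).
      apply: (@continuousB R 'rV[R]_n 'rV[R]_n id (cst y) x); first exact: cvg_id.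
      exact: cst_continuous.
    exact: continuous_enorm.
  case: (diam U) => [d| |].
  - rewrite (_ : [set _ | _] = (fun x : 'rV[R]_n => enorm (x - y)%R) @^-1` [set t | (t <= d)%R]).
      by apply: closed_comp => // x _; exact: ce.
    by apply/seteqP; split => x /=; rewrite lee_fin.
  - rewrite (_ : [set _ | _] = setT); first exact: closedT.
    by apply/seteqP; split => // x _ /=; rewrite leey.
  - rewrite (_ : [set _ | _] = set0); first exact: closed0.
    by apply/seteqP; split => // x.
exists (D U `&` D (D U)); split; first exact: closedI.
  move=> x Ux; split=> y; first by move=> Uy; exact: diam_ge.
  by move=> /(_ _ Ux); rewrite enormBC.
by apply: diam_le => x y [_ +] [+ _] => /[apply].
Qed.

Lemma measurable_closed_rV n (A : set 'rV[R]_n) : closed A -> measurable A.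
Proof.
by move=> cA; rewrite -[A]setCK; apply: measurableC; apply: measurable_open_rV;
  exact: closed_openC.
Qed.

(** Almost optimal covers at the scales [1 / (k + 1)], made closed by [closed_diam_hull] without
    enlarging diameters, are intersected. This extends estimates from Borel sets to arbitrary ones,
    such as projections of reverse spherical images. *)
Lemma hausdorff_hull n m (A : set 'rV[R]_n) : exists B, [/\ measurable B, A `<=` B &
  hausdorff_measure m B = hausdorff_measure m A].
Proof.
have [HA|HA] := eqVneq (hausdorff_measure m A) +oo.
  exists setT; split=> //; apply/eqP; rewrite HA -leye_eq -HA.
  by rewrite le_outer_measure.
pose d k : R := (k.+1%:R^-1)%R.
have d0 k : (0 < d k)%R by rewrite invr_gt0.
have /choice[V HV] k : exists V : (set 'rV[R]_n)^nat,
  [/\ forall i, closed (V i), A `<=` \bigcup_i V i, forall i, diam (V i) <= (d k)%:E &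
   \sum_(i <oo) hausdorff_gauge m (V i) <= hausdorff_measure m A + (d k)%:E].
  have fin : hausdorff_premeasure m (d k) A \is a fin_num.
    rewrite ge0_fin_numE ?outer_measure_ge0//.
    by rewrite (le_lt_trans (hausdorff_premeasure_le _ _ (d0 k)))// ltey.
  have [_ [U [AU Ud] <-] Ule] := lb_ereal_inf_adherent (d0 k) fin.
  have [V HV] := choice (fun i => closed_diam_hull (U i)).
  exists V; split.
  - by move=> i; have [] := HV i.
  - by move=> x /AU[i _ Ux]; exists i => //; have [_ + _] := HV i; exact.
  - by move=> i; have [_ _ h] := HV i; exact: le_trans h (Ud i).
  rewrite (@le_trans _ _ (hausdorff_premeasure m (d k) A + (d k)%:E))//; last first.
    by rewrite leeD2r// hausdorff_premeasure_le.
  rewrite (le_trans _ (ltW Ule))//; apply: lee_nneseries => i *.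
    exact: hausdorff_gauge_ge0.
  have [_ UV Vd] := HV i.
  have [->|V0] := eqVneq (V i) set0.
    by rewrite hausdorff_gauge0 hausdorff_gauge_ge0.
  have dV0 : 0 <= diam (V i) by apply/diam_ge0/set0P.
  (* As [diam set0] is [-oo], an empty [U i] cannot have a nonempty hull of no larger diameter. *)
  rewrite /hausdorff_gauge (negPf V0); case: ifPn => [/eqP U0|_].
    have : diam (V i) <= -oo by rewrite (le_trans Vd)// U0; apply: diam_le.
    by move=> /(le_trans dV0).
  rewrite lee_wpmul2l ?unit_ball_volume_ge0//; apply: le_expe; first exact: mule_ge0.
  by rewrite lee_wpmul2l.
exists (\bigcap_k \bigcup_i V k i); split.
- apply: bigcapT_measurable => k; apply: bigcupT_measurable => i.
  by apply: measurable_closed_rV; have [] := HV k.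
- by move=> x Ax k _; have [_ + _ _] := HV k; exact.
apply/eqP; rewrite eq_le; apply/andP; split; last first.
  by apply: le_outer_measure => x Ax k _; have [_ + _ _] := HV k; exact.
apply: hausdorff_measure_le => e e0; apply/lee_addgt0Pr => e' e'0.
have [k [ke ke']] : exists k, (d k <= e)%R /\ (d k <= e')%R.
  exists (Num.truncn (Num.min e e')^-1).
  have m0 : (0 < Num.min e e')%R by rewrite lt_min e0.
  have := truncnS_gt (Num.min e e')^-1; rewrite -ltf_pV2 ?posrE ?invr_gt0// invrK.
  by rewrite lt_min => /andP[/ltW h1 /ltW h2].
have [_ _ Vd Vs] := HV k.
rewrite (le_trans (le_hausdorff_premeasure m _ ke))//.
apply: (@le_trans _ _ (hausdorff_measure m A + (d k)%:E)); last by rewrite leeD2l// lee_fin.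
apply: le_trans Vs; apply: ereal_inf_lbound; exists (V k) => //; split => //.
by move=> x; apply.
Qed.

End hausdorff_borel.

(** * Hausdorff measure in top dimension under linear maps *)

Section hausdorff_linear.
Context (R : realType).
Local Open Scope ereal_scope.

Lemma outer_measure_fin_bigcup T (mu : {outer_measure set T -> \bar R}) (I : finType)
    (F : I -> set T) : mu (\bigcup_i F i) <= \sum_i mu (F i).
Proof.
pose G k := if insub k is Some j then F (enum_val (j : 'I_#|I|)) else set0.
have GE (j : 'I_#|I|) : G j = F (enum_val j) by rewrite /G valK.
have := outer_measure_subadditive mu G #|I|.
rewrite (_ : \sum_(i < #|I|) mu (G i) = \sum_i mu (F i)); last first.
  rewrite [RHS](reindex _ (onW_bij _ (@enum_val_bij I)))/=.
  by apply: eq_bigr => j _; rewrite GE.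
apply: le_trans; apply: le_outer_measure => x [i _ Fx].
rewrite -bigcup_mkord; exists (enum_rank i) => /=; first exact: ltn_ord.
by rewrite GE enum_rankK.
Qed.

(** The cube is covered by [N^m] cells of half side [h], each of gauge at most [(m h)^m] times the
    volume of the unit ball; as [N h = r + 1], the total bound [M] is the same at every scale. *)
Lemma hausdorff_cube_fin m (k : nat) : hausdorff_measure m (@cube R m k%:R) < +oo.
Proof.
pose r : R := k%:R.
pose M := ((fine (unit_ball_volume R m)) * ((m%:R * (r + 1)) ^+ m))%R.
apply: (@le_lt_trans _ _ M%:E); last exact: ltry.
have r0 : (0 <= r)%R by exact: ler0n.
apply: hausdorff_measure_le => d d0.
(* Chosen so that the bound [2 * (m%:R * h)] on the diameter of a cell is at most [d]. The cells
   fill the cube of half side [r + 1], which is positive even for [r = 0] and keeps the faces of the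
   given cube inside. *)
pose N := (Num.truncn (2 * (m%:R * (r + 1)) / d)%R).+1.
pose h : R := ((r + 1) / N%:R)%R.
have N0 : (0 < N%:R :> R)%R by rewrite ltr0n.
have h0 : (0 < h)%R by rewrite divr_gt0// ltr_wpDl.
have hd : (2 * (m%:R * h) <= d)%R.
  rewrite /h !mulrA ler_pdivrMr// -ler_pdivrMl// mulrC -!mulrA.
  by rewrite ltW// mulrA [X in (X < _)%R](_ : _ = 2 * (m%:R * (r + 1)) / d)%R ?truncnS_gt//; field; rewrite gt_eqF.
pose c (j : 'I_N) : R := (- (r + 1) + (2 * j%:R + 1) * h)%R.
pose cell (f : {ffun 'I_m -> 'I_N}) := [set x : 'rV[R]_m | forall i, (`|x ord0 i - c (f i)| <= h)%R].
have Nh : (N%:R * h = r + 1)%R by rewrite /h mulrC divfK// gt_eqF.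
have cover : cube r `<=` \bigcup_f cell f.
  move=> x xr.
  have /choice[f Hf] i : exists j : 'I_N, (`|x ord0 i - c j| <= h)%R.
    have := xr i; rewrite ler_norml => /andP[xl xu].
    pose t := ((x ord0 i + (r + 1)) / (2 * h))%R.
    have t0 : (0 <= t)%R by apply: divr_ge0; [lra|rewrite mulr_ge0// ltW].
    have t1 : ((Num.truncn t)%:R <= t)%R by rewrite truncn_le.
    have tN : (Num.truncn t < N)%N.
      rewrite -(ltr_nat R) (le_lt_trans t1)//.
      rewrite /t ltr_pdivrMr; last by rewrite mulr_gt0.
      rewrite mulrCA Nh; lra.
    exists (Ordinal tN); rewrite /c/=.
    have t2 := truncnS_gt t.
    have xE : (x ord0 i = t * (2 * h) - (r + 1))%R.
      by rewrite /t divfK ?addrK// mulf_neq0 ?gt_eqF.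
    rewrite xE ler_norml; move: t1 t2; rewrite -natr1.
    move: (Num.truncn t)%:R%R => u t1 t2; apply/andP; split; nra.
  by exists [ffun i => f i] => // i; rewrite ffunE.
have dcell f : diam (cell f) <= (2 * (m%:R * h))%:E.
  apply: diam_le => x y xf yf; rewrite lee_fin (le_trans (enorm_le_sum _))//.
  rewrite mulrCA mulr_natl -[X in (_ *+ X)%R]card_ord -sumr_const.
  apply: ler_sum => i _; rewrite !mxE.
  have := xf i; have := yf i; rewrite !ler_norml => /andP[a1 a2] /andP[b1 b2].
  apply/andP; split; lra.
have gcell f : hausdorff_gauge m (cell f) <= (fine (unit_ball_volume R m) * (m%:R * h) ^+ m)%:E.
  rewrite EFinM (fineK (unit_ball_volume_fin R m)) /hausdorff_gauge; case: eqP => [_|/eqP/set0P f0].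
    by rewrite mule_ge0 ?unit_ball_volume_ge0// lee_fin exprn_ge0// mulr_ge0// ltW.
  rewrite lee_wpmul2l ?unit_ball_volume_ge0// EFin_expe.
  apply: le_expe; first by rewrite mule_ge0// diam_ge0.
  rewrite (_ : (m%:R * h)%R%:E = (2^-1)%:E * (2 * (m%:R * h))%:E).
    by rewrite lee_wpmul2l.
  by rewrite -EFinM mulKf.
apply: (le_trans (le_outer_measure (hausdorff_premeasure m d) _ _ cover)).
apply: (le_trans (outer_measure_fin_bigcup _ _)).
apply: (@le_trans _ _ (\sum_(f : {ffun 'I_m -> 'I_N})
    (fine (unit_ball_volume R m) * (m%:R * h) ^+ m)%:E)).
  apply: lee_sum => f _; apply: le_trans (gcell f).
  apply: hausdorff_premeasure_le_gauge.
  by rewrite (le_trans (dcell f))// lee_fin.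
rewrite sumEFin lee_fin sumr_const card_ffun !card_ord -[leLHS]mulr_natr natrX.
rewrite -mulrA -exprMn -mulrA [(h * _)%R]mulrC Nh.
by [].
Qed.

Lemma measurable_image_unit m (M : 'M[R]_m) (B : set 'rV[R]_m) : M \in unitmx ->
  [set x *m M | x in B]%R = [set x | B (x *m invmx M)%R].
Proof.
move=> MU; apply/seteqP; split => [_ [x Bx <-]/=|x Bx]; first by rewrite mulmxK.
by exists (x *m invmx M)%R => //; rewrite mulmxKV.
Qed.

(** By translation invariance the measure is [c] times Lebesgue measure on Borel sets, and the
    unknown [c] cancels. For arbitrary [B] a Borel hull gives one inequality, and the same
    inequality for [invmx M] gives the other. *)
Lemma hausdorff_mulmx m (M : 'M[R]_m) (B : set 'rV[R]_m) : M \in unitmx ->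
  hausdorff_measure m [set x *m M | x in B]%R =
  (`|\det M|%R)%:E * hausdorff_measure m B.
Proof.
have Hshift (a : 'rV[R]_m) (A : set 'rV[R]_m) :
    hausdorff_measure m ((fun x => x + a)%R @^-1` A) = hausdorff_measure m A.
  have E : A = [set x + a | x in (fun x => x + a)%R @^-1` A]%R.
    apply/seteqP; split => [x Ax|_ [x ? <-]//].
    by exists (x - a)%R; rewrite /= subrK.
  set A' := _ @^-1` A in E *.
  apply/eqP; rewrite eq_le; apply/andP; split.
    have := @hausdorff_measure_lip R _ _ _ m id (fun x => x + a)%R A' 1%R ltr01.
    rewrite image_id expr1n mul1e -E; apply => x y _ _.
    by rewrite mul1r opprD addrACA subrr addr0.
  have := @hausdorff_measure_lip R _ _ _ m (fun x => x + a)%R id A' 1%R ltr01.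
  rewrite image_id expr1n mul1e -E; apply => x y _ _.
  by rewrite mul1r opprD addrACA subrr addr0.
have [c Hc] : exists c : R, forall A : set 'rV[R]_m, measurable A ->
    hausdorff_measure m A = c%:E * lebesgue_rV R m A.
  have := @shift_invariant_lebesgue R m (@hausdorff_measure R m m) (fun a A _ => Hshift a A)
    (hausdorff_cube_fin m).
  by exists (fine (hausdorff_measure m (@cube R m 1%R)) / 2 ^+ m)%R.
have borel (M' : 'M[R]_m) (A : set 'rV[R]_m) : M' \in unitmx -> measurable A ->
    hausdorff_measure m [set x *m M' | x in A]%R =
    (`|\det M'|%R)%:E * hausdorff_measure m A.
  move=> MU mA; rewrite measurable_image_unit// !Hc//; last first.
    exact: (measurable_preimage (measurable_mulmx (invmx M')) mA).
  rewrite lebesgue_mulmx ?unitmx_inv// muleCA det_inv.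
  by rewrite normrV ?unitfE ?invrK//; move: MU; rewrite unitmxE unitfE.
have le (M' : 'M[R]_m) (A : set 'rV[R]_m) : M' \in unitmx ->
    hausdorff_measure m [set x *m M' | x in A]%R <=
    (`|\det M'|%R)%:E * hausdorff_measure m A.
  move=> MU; have [G [mG AG <-]] := hausdorff_hull m A.
  rewrite -borel//; apply: le_outer_measure => _ [x Ax <-].
  by exists x => //; exact: AG.
move=> MU; apply/eqP; rewrite eq_le le//=.
have dM : (0 < `|\det M|)%R.
  by rewrite normr_gt0; move: MU; rewrite unitmxE unitfE.
rewrite -lee_pdivlMl//.
have {1}-> : B = [set x *m invmx M | x in [set x *m M | x in B]]%R.
  apply/seteqP; split => [x Bx|_ [_ [x Bx <-] <-]]; last by rewrite mulmxK.
  by exists (x *m M)%R; [exists x|rewrite mulmxK].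
rewrite (le_trans (le _ _ _)) ?unitmx_inv//.
by rewrite det_inv normrV ?unitfE ?invrK// -normr_gt0.
Qed.

End hausdorff_linear.

(** * Change of variables on the sphere *)
Section local_comparison.
Context (R : realType).
Local Open Scope ereal_scope.

Lemma semi_sigma_additive_sum d (T : measurableType d) (mu : set T -> \bar R)
    (F : (set T)^nat) : semi_sigma_additive mu -> (forall k, measurable (F k)) ->
  trivIset setT F -> mu (\bigcup_k F k) = \sum_(k <oo) mu (F k).
Proof.
move=> smu mF tF; apply/esym/cvg_lim => //; apply: smu => //.
exact: bigcupT_measurable.
Qed.

(* Lindelof: countably many rational boxes on which the comparison
   holds up to the factor [1 + e] cover [S]. *)
Lemma local_le_measure n (S : set 'rV[R]_n) (alpha beta : set 'rV[R]_n -> \bar R) :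
  semi_sigma_additive alpha -> semi_sigma_additive beta ->
  alpha set0 = 0 -> (forall A, 0 <= alpha A) -> (forall A, measurable A -> 0 <= beta A) ->
  (forall x (e : R), S x -> (0 < e)%R -> exists U, [/\ open U, U x &
     forall B, measurable B -> B `<=` U `&` S -> alpha B <= (1 + e)%:E * beta B]) ->
  forall A, measurable A -> A `<=` S -> alpha A <= beta A.
Proof.
move=> salpha sbeta alpha00 alpha0 beta0 loc A mA AS.
have [bA|bA] := eqVneq (beta A) +oo; first by rewrite bA leey.
have bAfin : beta A \is a fin_num by rewrite ge0_fin_numE ?ltey ?beta0.
suff le_e (e : R) : (0 < e)%R -> alpha A <= (1 + e)%:E * beta A.
  apply/lee_addgt0Pr => e e0.
  have b0 : (0 <= fine (beta A))%R by rewrite fine_ge0 ?beta0.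
  rewrite (le_trans (le_e (e / (fine (beta A) + 1))%R _))//.
    by rewrite divr_gt0// ltr_wpDl.
  rewrite -(fineK bAfin) -EFinM -EFinD lee_fin mulrDl mul1r lerD2l.
  rewrite -mulrA ler_piMr//; first exact: ltW.
  by rewrite mulrC ler_pdivrMr ?ltr_wpDl// mul1r lerDl.
move=> e0; pose Q := {ffun 'I_n -> rat * rat}.
pose box (q : Q) := [set x : 'rV[R]_n | forall i,
  x ord0 i \in `](ratr (q i).1), (ratr (q i).2)[ ]%R.
have mbox q : measurable (box q).
  rewrite (_ : box q = \bigcap_(i in [set: 'I_n])
     ((fun x : 'rV[R]_n => x ord0 i) @^-1` `](ratr (q i).1), (ratr (q i).2)[%classic)); last first.
    by apply/seteqP; split => x /= h i; [move=> _; exact: h|exact: h].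
  apply: fin_bigcap_measurable => // i _.
  exact: (measurable_preimage (measurable_coord_rV i) (measurable_itv _)).
pose good q := `[< forall B, measurable B -> B `<=` box q `&` S ->
  alpha B <= (1 + e)%:E * beta B >].
pose F k := if unpickle k is Some q then if good q then box q else set0 else set0.
have mF k : measurable (F k).
  by rewrite /F; case: unpickle => // q; case: ifP.
have cover : S `<=` \bigcup_k F k.
  move=> x Sx; have [U [oU Ux HU]] := loc x e Sx e0.
  move: Ux; rewrite {1}(open_bigcup_rV oU) => -[q _].
  case: asboolP => // qU qx; exists (pickle q) => //.
  rewrite /F pickleK ifT// /good asboolT// => B mB Bq; apply: HU => // y /Bq[/qU ? ?].
  by split.
pose D := seqDU F.
have mD k : measurable (A `&` D k) by apply: measurableI => //; exact: seqDU_measurable.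
have tD : trivIset setT (fun k => A `&` D k).
  by apply: trivIset_setIl; exact: trivIset_seqDU.
have AE : A = \bigcup_k (A `&` D k).
  rewrite -setI_bigcupr -seqDU_bigcup_eq; apply/esym/setIidPl.
  exact: subset_trans cover.
rewrite [in X in X <= _]AE [in X in _ <= X]AE.
rewrite !semi_sigma_additive_sum// -nneseriesZl; last by move=> k _; exact: beta0.
apply: lee_nneseries => // k _.
have sub : A `&` D k `<=` F k `&` S.
  by move=> x [Ax Dx]; split; [exact: subset_seqDU Dx|exact: AS].
move: sub; rewrite {1}/F; case: unpickle => [q|]; last first.
  rewrite set0I subset0 => ->.
  by rewrite alpha00 mule_ge0// ?lee_fin ?beta0// addr_ge0// ltW.
case: ifPn => [/asboolP gq|_]; last first.
  rewrite set0I subset0 => ->.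
  by rewrite alpha00 mule_ge0// ?lee_fin ?beta0// addr_ge0// ltW.
exact: gq.
Qed.

End local_comparison.

(** * Integrals against the image of a measure with a density *)

Section density.
Context d d' (X : measurableType d) (Y : measurableType d') (R : realType).
Variables (mu : {measure set X -> \bar R}) (nu : {measure set Y -> \bar R}).
Variables (phi : X -> Y) (k : X -> R).
Hypotheses (mphi : measurable_fun setT phi) (mk : measurable_fun setT k).
Hypothesis k0 : forall x, 0 <= k x.
Hypothesis nuE : forall B, measurable B ->
  nu B = (\int[mu]_(x in phi @^-1` B) (k x)%:E)%E.
Local Open Scope ereal_scope.
Import HBNNSimple.

(** Monotone convergence along simple functions approximating [g] reduces the claim to their level
    sets, where it is [nuE]. *)
Lemma ge0_integral_density (g : Y -> R) : measurable_fun setT g ->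
  (forall y, (0 <= g y)%R) ->
  \int[nu]_y (g y)%:E = \int[mu]_x (g (phi x) * k x)%:E.
Proof.
move=> mg g0.
have mEg : measurable_fun setT (EFin \o g) by exact/measurable_EFinP.
pose h := nnsfun_approx measurableT mEg.
have hcvg y : (h n y)%:E @[n --> \oo] --> (g y)%:E.
  by apply: (@cvg_nnsfun_approx _ _ _ _ measurableT _ mEg) => // *; rewrite lee_fin.
have mhphi n : measurable_fun setT (fun x => h n (phi x)).
  exact: (measurableT_comp _ mphi).
have hnd y : {homo (fun n => h n y) : a b / (a <= b)%N >-> (a <= b)%R}.
  by move=> a b ab; exact/lefP/nd_nnsfun_approx.
have -> : \int[nu]_y (g y)%:E = limn (fun n => \int[nu]_y (h n y)%:E).
  rewrite -monotone_convergence//.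
  - by apply: eq_integral => y _; apply/esym/cvg_lim.
  - by move=> n; exact/measurable_EFinP.
  - by move=> n y _; rewrite lee_fin.
  - by move=> y _ a b ab; rewrite lee_fin hnd.
have -> : \int[mu]_x (g (phi x) * k x)%:E =
    limn (fun n => \int[mu]_x (h n (phi x) * k x)%:E).
  rewrite -monotone_convergence//.
  - apply: eq_integral => x _; apply/esym/cvg_lim => //.
    rewrite EFinM; under eq_fun do rewrite EFinM.
    by apply: cvgeZr.
  - by move=> n; apply/measurable_EFinP; exact: measurable_funM.
  - by move=> n x _; rewrite lee_fin mulr_ge0.
  - by move=> x _ a b ab; rewrite lee_fin ler_wpM2r// hnd.
congr (limn _); apply/funext => n.
transitivity (\int[nu]_y
   (\sum_(r \in range (h n)) (r * \1_(h n @^-1` [set r]) y)%:E)).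
  by apply: eq_integral => t tE; rewrite /= fimfunE -fsumEFin.
rewrite ge0_integral_fsum//; last 2 first.
  - by move=> r; apply/measurable_EFinP; exact: measurable_funM.
  - by move=> m y Ey; exact: nnfun_muleindic_ge0.
transitivity (\int[mu]_x (\sum_(r \in range (h n))
    ((r * \1_(h n @^-1` [set r]) (phi x))%:E * (k x)%:E))); last first.
  apply: eq_integral => x _; rewrite -ge0_mule_fsuml => [|y]; last exact: nnfun_muleindic_ge0.
  by rewrite fsumEFin // -(fimfunE _ (phi x)) EFinM.
rewrite ge0_integral_fsum//; last 2 first.
  - move=> r; apply/measurable_EFinP; apply: measurable_funM => //.
    apply: measurable_funM => //.
    exact: (measurableT_comp _ mphi).
  - by move=> m y Ey; rewrite mule_ge0 ?lee_fin// -lee_fin nnfun_muleindic_ge0.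
apply: eq_fsbigr => r rhn.
have r0 : (0 <= r)%R by move: rhn; rewrite inE => -[t _ <-].
have mr : measurable (h n @^-1` [set r]) by exact: measurable_sfunP.
under eq_integral do rewrite EFinM.
rewrite ge0_integralZl//; last exact/measurable_EFinP.
under [RHS]eq_integral do rewrite EFinM -muleA.
have mr' : measurable_fun setT (fun x => \1_(h n @^-1` [set r]) (phi x) : R).
  exact: (measurableT_comp _ mphi).
rewrite ge0_integralZl//; last 2 first.
- by apply: emeasurable_funM; exact/measurable_EFinP.
- by move=> x _; rewrite mule_ge0// lee_fin.
congr (_ * _); rewrite integral_indic// setIT nuE// integral_mkcond.
apply: eq_integral => x _; rewrite muleC patchE indicE.
have -> : (x \in phi @^-1` (h n @^-1` [set r])) = (phi x \in h n @^-1` [set r]).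
  by apply/idP/idP => /set_mem H; apply/mem_set.
by case: ifP => _; rewrite ?mule1 ?mule0.
Qed.

End density.

(** * The spherical measure under linear maps *)

Section sphere.
Context (R : realType).

(** Turns a product of [n] relative errors [1 + d] into a single one. For [d] in [[0, 1]] the bound
    [(1 + d)^n <= 1 + 3^n d] passes through the induction because
    [d + 3^n d + 3^n d^2 <= 3 (3^n d)]. *)
Lemma pow1D_le (e : R) n : 0 < e -> exists2 d : R, 0 < d & (1 + d) ^+ n <= 1 + e.
Proof.
move=> e0.
have H (d : R) : 0 <= d <= 1 -> (1 + d) ^+ n <= 1 + 3 ^+ n * d.
  move=> /andP[d0 d1]; elim: n => [|n IH]; first by rewrite !expr0; lra.
  have h3 : 1 <= 3 ^+ n :> R by rewrite exprn_ege1// ler1n.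
  rewrite exprS; apply: (@le_trans _ _ ((1 + d) * (1 + 3 ^+ n * d))).
    by rewrite ler_pM2l//; lra.
  rewrite exprS; move: (3 ^+ n) h3 => z z1.
  have := mulr_ge0 d0 (mulr_ge0 (le_trans ler01 z1) (_ : 0 <= 1 - d)).
  by rewrite subr_ge0 => /(_ d1); nra.
have p3 : 0 < 3 ^+ n :> R by rewrite exprn_gt0.
exists (Num.min 1 (e / 3 ^+ n)); first by rewrite lt_min ltr01 divr_gt0.
rewrite (le_trans (H _ _))//.
  by rewrite ge_min lexx/= le_min ler01 divr_ge0// ltW.
rewrite lerD2l mulrC -ler_pdivlMr// ge_min lexx orbT//.
Qed.

Lemma directionZ n c (x : 'rV[R]_n) : 0 < c -> direction (c *: x) = direction x.
Proof.
move=> c0; rewrite /direction enormZ gtr0_norm// scalerA invfM mulrAC mulVf ?mul1r//.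
by rewrite gt_eqF.
Qed.

Section n.
Variable n : nat.
Implicit Types x u : 'rV[R]_n.

Lemma enorm_direction x : x != 0 -> enorm (direction x) = 1.
Proof.
move=> x0; rewrite /direction enormZ normfV (ger0_norm (enorm_ge0 _)) mulVf//.
by rewrite enorm_eq0.
Qed.

Lemma directionK x : enorm x *: direction x = x.
Proof.
have [->|x0] := eqVneq x 0; first by rewrite enorm0 scale0r.
by rewrite /direction scalerA mulfV ?scale1r// enorm_eq0.
Qed.

Lemma direction_sphere u : sphere n u -> direction u = u.
Proof. by rewrite /direction/sphere/= => ->; rewrite invr1 scale1r. Qed.

Lemma sphere_neq0 u : sphere n u -> u != 0.
Proof. by rewrite /sphere/= -enorm_gt0 => ->. Qed.

Lemma direction_mulmx p x (M : 'M[R]_(n, p)) :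
  direction (direction x *m M) = direction (x *m M).
Proof.
have [->|x0] := eqVneq x 0; first by rewrite /direction !scaler0.
by rewrite -[in RHS](directionK x) -[in RHS]scalemxAl directionZ// enorm_gt0.
Qed.

Lemma mulmx_unit_neq0 (M : 'M[R]_n) x : M \in unitmx -> x != 0 -> x *m M != 0.
Proof.
move=> MU; apply: contra_neq => xM; by rewrite -[x](mulmxK MU) xM mul0mx.
Qed.

Lemma measurable_direction_mulmx (M : 'M[R]_n) :
  measurable_fun setT (fun u => direction (u *m M)).
Proof. exact: measurableT_comp (@measurable_direction R n) (measurable_mulmx M). Qed.

Lemma measurable_enorm_mulmx (M : 'M[R]_n) :
  measurable_fun setT (fun u => enorm (u *m M)).
Proof. exact: measurableT_comp (@measurable_enorm R n) (measurable_mulmx M). Qed.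

Lemma measurable_sphere : measurable (sphere n : set 'rV[R]_n).
Proof.
rewrite (_ : sphere n = @enorm R n @^-1` [set 1]).
  exact: (measurable_preimage (@measurable_enorm R n) (measurable_set1 _)).
by apply/seteqP; split.
Qed.

Lemma spherical_measure_setI (A : set 'rV[R]_n) :
  spherical_measure n A = spherical_measure n (A `&` sphere n).
Proof.
rewrite /spherical_measure; congr (_ * lebesgue_rV R n _)%E.
apply/seteqP; split => x /= [x0 Ax]; last by split=> //; case: Ax.
split=> //; split=> //; apply: enorm_direction.
by rewrite -enorm_gt0; case/andP: x0.
Qed.

(** The cone over [A] is cut off by the ellipsoid [|x M| <= r] instead of a ball: this is what the
    round shell defining the spherical measure becomes under a linear substitution. *)
Definition cone_shell (M : 'M[R]_n) (r : R) (A : set 'rV[R]_n) :=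
  [set x | 0 < enorm (x *m M) <= r] `&` @direction R n @^-1` A.

Lemma measurable_cone_shell M r A : measurable A -> measurable (cone_shell M r A).
Proof.
move=> mA; apply: measurableI; last exact: (measurable_preimage (@measurable_direction R n) mA).
rewrite (_ : [set _ | _] = (fun x => enorm (x *m M)) @^-1` `]0, r]%classic).
  exact: (measurable_preimage (measurable_enorm_mulmx M) (measurable_itv _)).
by apply/seteqP; split=> x /=; rewrite in_itv.
Qed.

Lemma spherical_measure_shell r A : 0 < r -> measurable A ->
  (n%:R%:E * lebesgue_rV R n (cone_shell 1%:M r A) =
   (r ^+ n)%:E * spherical_measure n A)%E.
Proof.
move=> r0 mA; rewrite muleCA; congr (_ * _)%E.
have U : (r^-1%:M : 'M[R]_n) \in unitmx.
  by rewrite unitmxE det_scalar unitfE expf_neq0// invr_eq0 gt_eqF.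
have m1 := @measurable_cone_shell 1%:M 1 A mA.
have := lebesgue_mulmx U m1.
rewrite det_scalar exprVn normrV ?unitfE ?expf_neq0 ?gt_eqF// invrK.
rewrite ger0_norm ?exprn_ge0 ?(ltW r0)// => E.
transitivity (lebesgue_rV R n [set x | cone_shell 1%:M 1 A (x *m r^-1%:M)]).
  congr (lebesgue_rV R n _); apply/seteqP; split=> x; rewrite /cone_shell/= !mulmx1 mul_mx_scalar directionZ ?invr_gt0// enormZ gtr0_norm ?invr_gt0//;
  by rewrite pmulr_rgt0 ?invr_gt0// mulrC ler_pdivrMr// mul1r.
rewrite E; congr (_ * lebesgue_rV R n _)%E.
by apply/seteqP; split=> x; rewrite /cone_shell/= mulmx1.
Qed.

Lemma spherical_measure_map (M : 'M[R]_n) A : M \in unitmx -> measurable A ->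
  spherical_measure n ((fun v => direction (v *m invmx M)) @^-1` A) =
  (n%:R%:E * (`|\det M|%:E * lebesgue_rV R n (cone_shell M 1 A)))%E.
Proof.
move=> MU mA; rewrite /spherical_measure; congr (_ * _)%E.
have -> : `|\det M| = `|\det (invmx M)|^-1.
  by rewrite det_inv normrV ?invrK.
rewrite -lebesgue_mulmx ?unitmx_inv//; last exact: measurable_cone_shell.
congr (lebesgue_rV R n _); apply/seteqP; split=> x; rewrite /cone_shell/= mulmxKV//.
  by rewrite direction_mulmx.
by rewrite direction_mulmx.
Qed.

Lemma continuous_enorm_mulmx p (M : 'M[R]_(n, p)) :
  continuous (fun u => enorm (u *m M)).
Proof.
have cM j : continuous (fun u => (u *m M) ord0 j).
  rewrite (_ : (fun u => _) = (fun u => \sum_i u ord0 i * M i j)); last first.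
    by apply/funext => u; rewrite mxE.
  apply: continuous_sum_fun => i x.
  apply: (@continuousM R 'rV[R]_n (fun u => u ord0 i) (fun=> M i j) x).
    exact: coord_continuous.
  exact: cst_continuous.
move=> x; apply: (@continuous_comp _ _ _ (fun u : 'rV[R]_n => dot (u *m M) (u *m M)) Num.sqrt x);
  last exact: sqrt_continuous.
apply: continuous_sum_fun => j {}x.
by apply: (@continuousM R 'rV[R]_n (fun u => (u *m M) ord0 j) (fun u => (u *m M) ord0 j) x); exact: cM.
Qed.

Lemma open_enorm_mulmx (M : 'M[R]_n) (a b : R) :
  open [set u | a < enorm (u *m M) < b].
Proof.
rewrite (_ : [set _ | _] = (fun u => enorm (u *m M)) @^-1` `]a, b[%classic).
  apply: open_comp; last exact: interval_open.
  by move=> x _; exact: continuous_enorm_mulmx.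
by apply/seteqP; split=> x /=; rewrite in_itv.
Qed.

Local Notation w M u := (enorm (u *m M)).

Lemma measurable_inv_enorm_mulmx (M : 'M[R]_n) :
  measurable_fun setT (fun u => (w M u)^-1).
Proof.
rewrite (_ : (fun u => _) = (fun r : R => r `^ (-1)) \o (fun u => w M u)).
  exact: measurableT_comp (measurable_powR (-1)) (measurable_enorm_mulmx M).
by apply/funext => u /=; rewrite powR_inv1// enorm_ge0.
Qed.

(** On a patch where [w M] lies between [a] and [b], the set [cone_shell M 1] lies between the round
    shells of radii [b^-1] and [a^-1], so both sides lie between [lo b] and [lo a]. Patches with
    [b / a] close to 1 allow [local_le_measure] in both directions. *)
Lemma sphere_measure_linear (M : 'M[R]_n) A : M \in unitmx -> measurable A ->
  A `<=` sphere n ->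
  (\int[spherical_measure n]_(u in A) (`|\det M| * (w M u)^-1 ^+ n)%:E)%E =
  spherical_measure n ((fun v => direction (v *m invmx M)) @^-1` A).
Proof.
move=> MU mA AS; pose D := `|\det M|.
have D0 : 0 <= D by exact: normr_ge0.
pose k (u : 'rV[R]_n) := D * (w M u)^-1 ^+ n.
have k0 u : 0 <= k u by rewrite mulr_ge0// exprn_ge0// invr_ge0 enorm_ge0.
have mk : measurable_fun setT k.
  apply: measurable_funM => //; apply: measurable_funX.
  exact: measurable_inv_enorm_mulmx.
have mkE : measurable_fun setT (fun u => (k u)%:E) by exact/measurable_EFinP.
pose alpha (B : set 'rV[R]_n) := (\int[spherical_measure n]_(u in B) (k u)%:E)%E.
pose beta (B : set 'rV[R]_n) :=
  spherical_measure n ((fun v => direction (v *m invmx M)) @^-1` B).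
have alpha0 B : (0 <= alpha B)%E by apply: integral_ge0 => *; rewrite lee_fin.
have beta0 B : (0 <= beta B)%E by exact: measure_ge0.
have salpha : semi_sigma_additive alpha.
  by apply: semi_sigma_additive_nng_induced => // x; rewrite lee_fin.
have sbeta : semi_sigma_additive beta.
  have mdir := measurable_direction_mulmx (invmx M).
  by apply: (@measure_semi_sigma_additive _ _ _
    (pushforward (@spherical_measure R n) (fun v => direction (v *m invmx M)))).
pose lo a B := ((D * a^-1 ^+ n)%:E * @spherical_measure R n B)%E.
have bounds B a b : 0 < a -> 0 < b -> measurable B ->
    B `<=` [set u | a < w M u < b] `&` sphere n ->
    [/\ (lo b B <= alpha B)%E, (alpha B <= lo a B)%E, (lo b B <= beta B)%E &
      (beta B <= lo a B)%E].
  move=> a0 b0 mB Bab.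
  have loE c : lo c B = (\int[spherical_measure n]_(u in B) (D * c^-1 ^+ n)%:E)%E.
    by rewrite integral_cst.
  have mkB : measurable_fun B (fun u => (k u)%:E) by exact: measurable_funTS.
  have kb u : B u -> D * b^-1 ^+ n <= k u <= D * a^-1 ^+ n.
    move=> /Bab[/= /andP[au ub] _].
    have w0 : 0 < w M u by exact: lt_trans au.
    by rewrite !ler_wpM2l//= lerXn2r ?nnegrE ?invr_ge0 ?enorm_ge0 ?(ltW a0) ?(ltW b0)//;
      rewrite lef_pV2 ?posrE// ltW.
  have mshell r : measurable (cone_shell 1%:M r B) by exact: measurable_cone_shell.
  have loE' c : 0 < c -> lo c B = (n%:R%:E * (D%:E * lebesgue_rV R n (cone_shell 1%:M c^-1 B)))%E.
    by move=> c0; rewrite /lo [RHS]muleCA spherical_measure_shell ?invr_gt0// [RHS]muleA -EFinM.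
  have betaE := spherical_measure_map MU mB.
  have mM := measurable_cone_shell M 1 mB.
  have wE x : w M x = enorm x * w M (direction x).
    by rewrite -{1}(directionK x) -scalemxAl enormZ ger0_norm ?enorm_ge0.
  split.
  - rewrite loE; apply: ge0_le_integral => // x Bx; rewrite lee_fin.
      by rewrite mulr_ge0// exprn_ge0// invr_ge0 ltW.
    by have /andP[] := kb x Bx.
  - rewrite loE; apply: ge0_le_integral => // x Bx; rewrite lee_fin//.
    by have /andP[] := kb x Bx.
  - rewrite (loE' _ b0) /beta betaE lee_wpmul2l// lee_wpmul2l//.
    apply: (le_measure (lebesgue_rV R n)); rewrite ?inE// => x [/=].
    rewrite mulmx1 => /andP[x0 xb] Bx; split => //=.
    have [/= /andP[au ub] _] := Bab _ Bx; rewrite wE mulr_gt0 ?(lt_trans a0 au)//=.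
    rewrite (@le_trans _ _ (b^-1 * b))//; last by rewrite mulVf// gt_eqF.
    by rewrite ler_pM ?enorm_ge0// ltW.
  - rewrite (loE' _ a0) /beta betaE lee_wpmul2l// lee_wpmul2l//.
    apply: (le_measure (lebesgue_rV R n)); rewrite ?inE// => x [/=].
    move=> /andP[x0 xb] Bx; split => //=; rewrite mulmx1.
    have [/= /andP[au ub] _] := Bab _ Bx; move: x0 xb; rewrite wE.
    have w0 := lt_trans a0 au; rewrite pmulr_lgt0// => x0; rewrite x0 /= => xb.
    rewrite -[a^-1]mul1r ler_pdivlMr//; apply: le_trans xb.
    by rewrite ler_pM2l ?ltW//.
have key u0 (e : R) : sphere n u0 -> 0 < e -> exists U, [/\ open U, U u0 &
   forall B, measurable B -> B `<=` U `&` sphere n ->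
   (alpha B <= (1 + e)%:E * beta B)%E /\ (beta B <= (1 + e)%:E * alpha B)%E].
  (* The bounds [lo a] and [lo b] differ by the factor [(b / a)^n], which is [(1 + d)^(n + n)] for
     the patch chosen below. *)
  move=> Su0 e0; have [d d0 Hd] := pow1D_le (n + n) e0.
  pose w0 := w M u0.
  have w00 : 0 < w0 by rewrite enorm_gt0 mulmx_unit_neq0// sphere_neq0.
  have d1 : 1 < 1 + d by rewrite ltrDl.
  exists [set u | w0 / (1 + d) < w M u < w0 * (1 + d)]; split.
  - exact: open_enorm_mulmx.
  - by rewrite /= -/w0 ltr_pdivrMr ?ltr_pMr ?d1//; lra.
  - move=> B mB BU.
    have [] := bounds B _ _ _ _ mB BU; [by rewrite divr_gt0//; lra|by rewrite mulr_gt0//; lra|].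
    move=> b1 b2 b3 b4.
    suff lole : (lo (w0 / (1 + d))%R B <= (1 + e)%:E * lo (w0 * (1 + d))%R B)%E.
      have e1 : (0 <= (1 + e)%:E)%E by rewrite lee_fin; lra.
      split; first by rewrite (le_trans b2)// (le_trans lole)// lee_wpmul2l.
      by rewrite (le_trans b4)// (le_trans lole)// lee_wpmul2l.
    rewrite /lo [leRHS]muleA -EFinM lee_wpmul2r// lee_fin mulrCA ler_wpM2l//.
    rewrite !invfM invrK !exprMn.
    rewrite [leRHS]mulrCA ler_wpM2l ?exprn_ge0 ?invr_ge0 ?(ltW w00)//.
    have p0 : 0 < (1 + d) ^+ n by rewrite exprn_gt0//; lra.
    by rewrite exprVn ler_pdivlMr// -exprD.
suff : alpha A = beta A by [].
apply/eqP; rewrite eq_le; apply/andP; split.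
  apply: (@local_le_measure R n (sphere n) alpha beta) => //.
    exact: integral_set0.
  move=> u0 e Su0 e0; have [U [oU Uu HU]] := key u0 e Su0 e0.
  by exists U; split=> // B mB BU; have [] := HU B mB BU.
apply: (@local_le_measure R n (sphere n) beta alpha) => //.
move=> u0 e Su0 e0; have [U [oU Uu HU]] := key u0 e Su0 e0.
by exists U; split=> // B mB BU; have [] := HU B mB BU.
Qed.

(** By [sphere_measure_linear] the spherical measure is the image under [T] of the measure with
    density [k]; the extensions by zero [g1] and [k1] bring this into the form of
    [ge0_integral_density]. *)
Lemma sphere_integral_linear (M : 'M[R]_n) (g : 'rV[R]_n -> R) : M \in unitmx ->
  measurable_fun (sphere n) g -> (forall u, sphere n u -> 0 <= g u) ->
  (\int[spherical_measure n]_(v in sphere n) (g v)%:E)%E =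
  (\int[spherical_measure n]_(u in sphere n)
     (`|\det M| * (w M u)^-1 ^+ n * g (direction (u *m M)))%:E)%E.
Proof.
move=> MU mg g0; pose T u := direction (u *m M).
pose k u := `|\det M| * (w M u)^-1 ^+ n.
have k0 u : 0 <= k u by rewrite mulr_ge0// exprn_ge0// invr_ge0 enorm_ge0.
have mk : measurable_fun setT k.
  apply: measurable_funM => //; apply: measurable_funX.
  exact: measurable_inv_enorm_mulmx.
have TS u : sphere n u -> sphere n (T u).
  by move=> /sphere_neq0 u0; rewrite /sphere/= enorm_direction// mulmx_unit_neq0.
have mT : measurable_fun setT T by exact: measurable_direction_mulmx.
have mS := measurable_sphere.
rewrite integral_mkcond [RHS]integral_mkcond.
pose g1 := g \_ (sphere n).
have g1E v : g1 v = if v \in sphere n then g v else 0 by rewrite /g1 patchE.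
pose k1 u := k u * \1_(sphere n) u.
transitivity (\int[spherical_measure n]_v (g1 v)%:E)%E.
  by apply: eq_integral => v _; rewrite g1E patchE; case: ifP.
rewrite (@ge0_integral_density _ _ _ _ R (@spherical_measure R n) (@spherical_measure R n) T k1) => //.
- apply: eq_integral => u _; rewrite g1E /k1 patchE indicE.
  case: (boolP (u \in sphere n)) => [/set_mem/TS/mem_set -> /=|_].
    by rewrite mulr1 mulrC.
  by rewrite /= !mulr0.
- by apply: measurable_funM => //.
- by move=> u; rewrite /k1 mulr_ge0.
- move=> B mB.
  have mTB : measurable (T @^-1` B) by exact: measurable_preimage.
  transitivity (\int[spherical_measure n]_(u in (T @^-1` B) `&` sphere n) (k u)%:E)%E.
    rewrite sphere_measure_linear//; last exact: measurableI.
    rewrite [LHS]spherical_measure_setI [RHS]spherical_measure_setI.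
    congr (spherical_measure n _); apply/seteqP; split=> v /= [Bv Sv]; split=> //.
      split; last by rewrite /sphere/= enorm_direction// mulmx_unit_neq0 ?unitmx_inv// sphere_neq0.
      by rewrite /T direction_mulmx mulmxKV// direction_sphere.
    by move: Bv => [+ _]; rewrite /T direction_mulmx mulmxKV// direction_sphere.
  rewrite integral_mkcondr; apply: eq_integral => u _; rewrite patchE /k1 indicE.
  by case: ifP => _; rewrite ?mulr1 ?mulr0.
- apply/(measurable_restrictT _ _).1 => //.
- by move=> v; rewrite /g1 patchE; case: ifPn => // /set_mem/g0.
Qed.

End n.
End sphere.

(** * Almost flat sets *)
Section flat.
Context (R : realType) (m : nat).
Local Notation n := m.+1.

(** The reflection exchanging [v] and the first basis vector [e], in the hyperplane orthogonal to
    [v - e]; for [v = e] the identity takes its place. *)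
Lemma householder (v : 'rV[R]_n) : enorm v = 1 ->
  exists W : 'M[R]_n, [/\ W^T = W, W *m W = 1%:M & v *m W = delta_mx ord0 ord0].
Proof.
move=> v1; pose e : 'rV[R]_n := delta_mx ord0 ord0.
have ee : dot e e = 1.
  rewrite /dot (bigD1 ord0)//= big1 ?addr0; first by rewrite !mxE !eqxx mulr1.
  by move=> i i0; rewrite !mxE (negPf i0) andbF mulr0.
have vv : dot v v = 1 by rewrite -enorm_sqr v1 expr1n.
have [ve|ve] := eqVneq (v - e) 0.
  exists 1%:M; split; [exact: trmx1|exact: mulmx1|].
  by rewrite mulmx1; apply/eqP; rewrite -subr_eq0 ve.
pose w := v - e; pose q := dot w w.
have q0 : q != 0 by rewrite /q -enorm_sqr expf_neq0// enorm_eq0.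
have qE : q = 2 - 2 * dot v e.
  by rewrite /q /w !(dotBl, dotBr) (dotC e v) vv ee; ring.
have vw : dot v w = q / 2 by rewrite qE /w dotBr vv; field.
have mxw (x : 'rV[R]_n) : x *m (w^T *m w) = dot x w *: w.
  by rewrite mulmxA [x *m w^T]mx11_scalar mul_scalar_mx -dotE.
have wwww : (w^T *m w) *m (w^T *m w) = q *: (w^T *m w).
  by rewrite -mulmxA mxw -scalemxAr.
exists (1%:M - (2 / q) *: (w^T *m w)); split.
- by rewrite linearB/= linearZ/= trmx1 trmx_mul trmxK.
- set X := (2 / q) *: _.
  have XX : X *m X = X + X.
    rewrite /X -scalemxAl -scalemxAr wwww !scalerA -scalerDl; congr (_ *: _); by field.
  have XE : X *m (1%:M - X) = - X by rewrite mulmxBr mulmx1 XX opprD addrA subrr add0r.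
  by rewrite mulmxBl mul1mx XE opprK subrK.
- rewrite mulmxBr mulmx1 -scalemxAr mxw scalerA vw.
  have -> : 2 / q * (q / 2) = 1 by field.
  by rewrite scale1r /w opprB addrC subrK.
Qed.

(** The Householder matrix is orthogonal with first column [v^T]; [Q] consists of its other columns,
    so [x *m Q] lists the coordinates in R^m of the projection of [x] along [v]. *)
Lemma orthonormal_frame (v : 'rV[R]_n) : enorm v = 1 ->
  exists Q : 'M[R]_(n, m), [/\ forall x, x *m Q *m Q^T = x - dot x v *: v,
    forall x, enorm x ^+ 2 = dot x v ^+ 2 + enorm (x *m Q) ^+ 2,
    v *m Q = 0 & `|\det (row_mx v^T Q : 'M[R]_(1 + m))| = 1].
Proof.
move=> v1; have [W [WT WW vW]] := householder v1.
pose Q : 'M[R]_(n, m) := @rsubmx R n 1 m W.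
have vE : v^T = @lsubmx R n 1 m W.
  have : v = delta_mx ord0 ord0 *m W by rewrite -vW -mulmxA WW mulmx1.
  move=> ->; rewrite -rowE; apply/matrixP => i j; rewrite !mxE (ord1 j).
  by rewrite -[in LHS]WT mxE; congr (W _ _); exact/val_inj.
have WE : (W : 'M[R]_(n, 1 + m)) = row_mx v^T Q by rewrite vE /Q hsubmxK.
have WQ : row_mx v^T Q *m (row_mx v^T Q)^T = 1%:M.
  by rewrite -WE; move: WW; rewrite -{2}WT.
have key x : x *m Q *m Q^T = x - dot x v *: v.
  have : x *m (row_mx v^T Q *m (row_mx v^T Q)^T) = x by rewrite WQ mulmx1.
  rewrite tr_row_mx trmxK mul_row_col mulmxDr !mulmxA => xE.
  have e : x *m v^T *m v = dot x v *: v.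
    by rewrite [x *m v^T]mx11_scalar mul_scalar_mx -dotE.
  by apply/eqP; rewrite eq_sym subr_eq -e [X in _ == X]addrC xE.
have QE x : enorm x ^+ 2 = dot x v ^+ 2 + enorm (x *m Q) ^+ 2.
  by rewrite !enorm_sqr [in X in _ = _ + X]dot_mulmx key dotBr dotZr -expr2 addrC subrK.
exists Q; split=> //.
- apply/eqP; rewrite -enorm_eq0 -sqrf_eq0; have := QE v.
  by rewrite -[dot v v]enorm_sqr v1 !expr1n -[LHS]addr0 => /addrI <-.
- rewrite -WE; have /(congr1 determinant) := WW; rewrite det_mulmx det1 => d2.
  by apply/eqP; rewrite -(@eqrXn2 _ 2)// expr1n -normrX expr2 d2 normr1.
Qed.

(* [E] lies within slope [eta] of a hyperplane orthogonal to [v]. *)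
Definition flat (eta : R) (v : 'rV[R]_n) (E : set 'rV[R]_n) :=
  forall x y, E x -> E y -> `|dot (x - y) v| <= eta * enorm (x - y).

(** Pythagoras gives [|d| <= |<d, v>| + |d Q|], and flatness absorbs the first summand. *)
Lemma flat_proj (eta : R) v (Q : 'M[R]_(n, m)) (d : 'rV[R]_n) : enorm v = 1 ->
  enorm d ^+ 2 = dot d v ^+ 2 + enorm (d *m Q) ^+ 2 ->
  `|dot d v| <= eta * enorm d ->
  enorm (d *m Q) <= enorm d /\ (1 - eta) * enorm d <= enorm (d *m Q).
Proof.
move=> v1 E F.
have d0 := enorm_ge0 d; have q0 := enorm_ge0 (d *m Q).
split.
  rewrite -(@ler_pXn2r _ 2)// ?nnegrE// E lerDr sqr_ge0//.
suff : enorm d <= `|dot d v| + enorm (d *m Q) by lra.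
rewrite -(@ler_pXn2r _ 2)// ?nnegrE ?addr_ge0// E sqrrD.
rewrite real_normK ?num_real//.
have : 0 <= `|dot d v| * enorm (d *m Q) by rewrite mulr_ge0.
by lra.
Qed.

Lemma image_mulmxA p q (E : set 'rV[R]_n) (A : 'M[R]_(n, p)) (B : 'M[R]_(p, q)) :
  [set x *m B | x in [set x *m A | x in E]] = [set x *m A *m B | x in E].
Proof. by rewrite image_comp. Qed.

(** In orthonormal coordinates of the hyperplane orthogonal to [v] and of its image, [phi] becomes
    the square matrix [M], to which [hausdorff_mulmx] applies. Passing from [E] to its projection,
    and from the image of [E] under [phi] to that of the projection under [M], distorts distances by
    factors close to 1. *)
Lemma flat_hausdorff (phi : 'M[R]_n) (v : 'rV[R]_n) (e : R) :
  phi \in unitmx -> enorm v = 1 -> 0 < e ->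
  exists2 eta, 0 < eta & forall E, flat eta v E ->
   (hausdorff_measure m [set x *m phi | x in E] <=
      ((1 + e) * (`|\det phi| * enorm (v *m invmx phi^T)))%:E * hausdorff_measure m E)%E /\
   ((`|\det phi| * enorm (v *m invmx phi^T))%:E * hausdorff_measure m E <=
     (1 + e)%:E * hausdorff_measure m [set x *m phi | x in E])%E.
Proof.
move=> phiU v1 e0.
have phiTU : phi^T \in unitmx by rewrite unitmx_tr.
pose z := v *m invmx phi^T; set J := _ * enorm z.
have v0 : v != 0 by rewrite -enorm_gt0 v1.
have z0 : 0 < enorm z by rewrite enorm_gt0 mulmx_unit_neq0// unitmx_inv.
pose w := direction z.
have w1 : enorm w = 1 by rewrite enorm_direction// -enorm_gt0.
(* Hence [phi] maps the hyperplane orthogonal to [v] to the one orthogonal to [w]. *)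
have wE : phi *m w^T = (enorm z)^-1 *: v^T.
  rewrite /w /direction linearZ/= -scalemxAr /z trmx_mul trmx_inv trmxK mulmxA mulmxV//.
  by rewrite mul1mx.
have [Q [QQ QE vQ detQ]] := orthonormal_frame v1.
have [Q' [QQ' QE' wQ' detQ']] := orthonormal_frame w1.
pose M := Q^T *m phi *m Q'.
have detM : `|\det M| = J.
  (* In the two frames [phi] is block triangular: [Q^T phi w^T] is a multiple of the transpose of
     [v Q = 0], and the corner entry is [1 / |z|]. *)
  have : \det ((row_mx v^T Q : 'M[R]_(1 + m))^T *m phi *m (row_mx w^T Q' : 'M[R]_(1 + m))) =
      (enorm z)^-1 * \det M.
    rewrite tr_row_mx trmxK mul_col_mx mul_col_row -/M.
    rewrite -[v *m phi *m w^T]mulmxA wE -[Q^T *m phi *m w^T]mulmxA wE -!scalemxAr.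
    rewrite -trmx_mul vQ trmx0 scaler0 det_ublock; congr (_ * _).
    rewrite det_mx11 mxE (_ : _ ord0 ord0 = 1) ?mulr1//.
    by have := enorm_sqr v; rewrite v1 expr1n dotE => <-.
  rewrite !det_mulmx det_tr => /(congr1 (fun x : R => `|x|)).
  rewrite !normrM detQ detQ' mul1r mulr1 normfV (ger0_norm (enorm_ge0 z)) => H.
  by rewrite /J H mulrAC mulVf ?mul1r// gt_eqF.
have MU : M \in unitmx.
  rewrite unitmxE unitfE -normr_gt0 detM mulr_gt0// normr_gt0.
  by move: phiU; rewrite unitmxE unitfE.
have J0 : 0 <= J by rewrite -detM.
have [C1 C10 HC1] := enorm_mulmx phi.
have [C2 C20 HC2] := enorm_mulmx (invmx phi).
(* The product [C1 * C2] bounds [|a| |v phi|] by a multiple of [|a phi|]; the summand 1 lets the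
   same slope serve for the projection by [Q]. *)
pose C := 1 + C1 * C2.
have C0 : 1 <= C by rewrite lerDl mulr_ge0// ltW.
(* The lower estimate passes through two comparisons, each costing [(1 + d) ^+ m]. *)
have [d d0 Hd] := pow1D_le (m + m) e0.
have d1 : 0 < 1 + d by lra.
(* With this choice [1 - eta * C] is the inverse of [1 + d]. *)
pose eta := d / (1 + d) / C.
have C00 : 0 < C by lra.
have eta0 : 0 < eta by rewrite !divr_gt0.
have etaC : eta * C = d / (1 + d) by rewrite /eta divfK// gt_eqF.
have dd : d / (1 + d) <= d by rewrite ler_pdivrMr//; nra.
have ddV : (1 - d / (1 + d)) * (1 + d) = 1 by field; rewrite gt_eqF.
have eta_le : eta <= d / (1 + d) by rewrite -etaC ler_peMr// ltW.
exists eta => // E fE.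
have est x y : E x -> E y ->
  [/\ enorm (x *m Q - y *m Q) <= enorm (x - y),
      enorm (x - y) <= (1 + d) * enorm (x *m Q - y *m Q),
      enorm (x *m Q *m M - y *m Q *m M) <= (1 + d) * enorm (x *m phi - y *m phi) &
      enorm (x *m phi - y *m phi) <= (1 + d) * enorm (x *m Q *m M - y *m Q *m M)].
  move=> Ex Ey; have Fxy := fE x y Ex Ey.
  rewrite -!mulmxBl; move: (x - y) Fxy => a Fa.
  have [q1 q2] := flat_proj v1 (QE a) Fa.
  have a0 := enorm_ge0 a.
  pose p := a - dot a v *: v.
  have pE : a *m Q *m M = p *m phi *m Q' by rewrite /M !mulmxA QQ.
  have pw : dot (p *m phi) w = 0.
    rewrite dotE -mulmxA wE -scalemxAr mxE -dotE /p dotBl dotZl -[dot v v]enorm_sqr.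
    by rewrite v1 expr1n mulr1 subrr mulr0.
  (* As [p *m phi] has no component along [w], the projection by [Q'] preserves its norm. *)
  have pn : enorm (a *m Q *m M) = enorm (p *m phi).
    by apply/eqP; rewrite -(@eqrXn2 _ 2) ?enorm_ge0// [X in _ == X]QE' pw expr0n/= add0r pE.
  have ap : enorm (dot a v *: v *m phi) <= d / (1 + d) * enorm (a *m phi).
    rewrite -scalemxAl enormZ -etaC -mulrA; apply: (@le_trans _ _ (eta * enorm a * C1)).
      by apply: ler_pM; rewrite ?enorm_ge0//; rewrite (le_trans (HC1 _))// v1 mulr1.
    rewrite -mulrA ler_wpM2l ?(ltW eta0)//.
    have := HC2 (a *m phi); rewrite mulmxK// => h.
    apply: (@le_trans _ _ (C2 * enorm (a *m phi) * C1)); first by rewrite ler_wpM2r// ltW.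
    by rewrite mulrAC ler_wpM2r ?enorm_ge0// /C mulrC lerDr.
  have aE : a *m phi = p *m phi + dot a v *: v *m phi by rewrite -mulmxDl subrK.
  split=> //.
  - have : (1 - d / (1 + d)) * enorm a <= enorm (a *m Q).
      by rewrite (le_trans _ q2)// ler_wpM2r//; lra.
    rewrite -(ler_pM2l d1) => h; apply: le_trans h.
    by rewrite mulrA [_ * (1 - _)]mulrC ddV mul1r.
  - have : enorm (p *m phi) <= enorm (a *m phi) + enorm (dot a v *: v *m phi).
      rewrite (_ : p *m phi = a *m phi - dot a v *: v *m phi); first exact: enormB.
      by rewrite aE addrK.
    rewrite pn => h; rewrite (le_trans h)// mulrDl mul1r lerD2l (le_trans ap)//.
    by rewrite ler_wpM2r// enorm_ge0.
  - have h := enormD (p *m phi) (dot a v *: v *m phi); rewrite -aE in h.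
    have {}h : (1 - d / (1 + d)) * enorm (a *m phi) <= enorm (p *m phi) by lra.
    move: h; rewrite pn -(ler_pM2l d1) => h; apply: le_trans h.
    by rewrite mulrA [_ * (1 - _)]mulrC ddV mul1r.
have HEQ : (hausdorff_measure m [set x *m Q | x in E] <= hausdorff_measure m E)%E.
  have := @hausdorff_measure_lip R _ _ _ m (mulmxr Q) id E 1 ltr01.
  rewrite image_id expr1n mul1e; apply => x y Ex Ey.
  by rewrite mul1r; have [] := est x y Ex Ey.
have HE : (hausdorff_measure m E <= ((1 + d) ^+ m)%:E * hausdorff_measure m [set x *m Q | x in E])%E.
  have := @hausdorff_measure_lip R _ _ _ m id (mulmxr Q) E _ d1.
  rewrite image_id; apply => x y Ex Ey.
  by have [] := est x y Ex Ey.
have HM : (hausdorff_measure m [set x *m Q *m M | x in E] =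
    J%:E * hausdorff_measure m [set x *m Q | x in E])%E.
  by rewrite -detM -hausdorff_mulmx// image_mulmxA.
have HMphi : (hausdorff_measure m [set x *m Q *m M | x in E] <=
    ((1 + d) ^+ m)%:E * hausdorff_measure m [set x *m phi | x in E])%E.
  apply: (@hausdorff_measure_lip R _ _ _ m (fun x => x *m Q *m M) (mulmxr phi) E _ d1).
  by move=> x y Ex Ey; have [] := est x y Ex Ey.
have HphiM : (hausdorff_measure m [set x *m phi | x in E] <=
    ((1 + d) ^+ m)%:E * hausdorff_measure m [set x *m Q *m M | x in E])%E.
  apply: (@hausdorff_measure_lip R _ _ _ m (mulmxr phi) (fun x => x *m Q *m M) E _ d1).
  by move=> x y Ex Ey; have [] := est x y Ex Ey.
have dm0 : 0 <= (1 + d) ^+ m by rewrite exprn_ge0// ltW.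
have dmm : (1 + d) ^+ m <= 1 + e.
  rewrite (le_trans _ Hd)// exprD ler_peMr// exprn_ege1//; lra.
split.
  rewrite (le_trans HphiM)// HM muleA -EFinM.
  have c0 : (0 <= ((1 + d) ^+ m * J)%:E)%E by rewrite lee_fin mulr_ge0.
  apply: le_trans (lee_wpmul2l c0 HEQ) _.
  by rewrite lee_wpmul2r ?outer_measure_ge0// lee_fin ler_wpM2r.
have J0' : (0 <= J%:E)%E by rewrite lee_fin.
have dm0' : (0 <= ((1 + d) ^+ m)%:E)%E by rewrite lee_fin.
apply: le_trans (lee_wpmul2l J0' HE) _; rewrite muleCA -HM.
apply: le_trans (lee_wpmul2l dm0' HMphi) _; rewrite muleA -EFinM -exprD.
by rewrite lee_wpmul2r ?outer_measure_ge0// lee_fin.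
Qed.

(** With slope 1/2 the projection along [v] at most halves distances, and the projected set lies in
    a cube of R^m. *)
Lemma flat_hausdorff_fin (v : 'rV[R]_n) (E : set 'rV[R]_n) (k : nat) : enorm v = 1 ->
  flat 2^-1 v E -> E `<=` cube k%:R -> (hausdorff_measure m E < +oo)%E.
Proof.
move=> v1 fE Ek; have [Q [_ QE _ _]] := orthonormal_frame v1.
have HE : (hausdorff_measure m E <= (2 ^+ m)%:E * hausdorff_measure m [set x *m Q | x in E])%E.
  have := @hausdorff_measure_lip R _ _ _ m id (mulmxr Q) E 2 (ltr0n _ _).
  rewrite image_id; apply => x y Ex Ey.
  have [_] := flat_proj v1 (QE (x - y)) (fE x y Ex Ey).
  by rewrite /= -mulmxBl; lra.
rewrite (le_lt_trans HE)// lte_mul_pinfty//.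
have [s Hs] := cube_mulmx Q k%:R.
apply: le_lt_trans (hausdorff_cube_fin R m s); apply: le_outer_measure => _ [x Ex <-].
by apply: Hs; exact: Ek.
Qed.

End flat.

(** * Convex bodies and their curvature functions *)
Section convex_bodies.
Context (R : realType) (n : nat).
Implicit Types (K L : set 'rV[R]_n) (x y u v : 'rV[R]_n).

Lemma compact_enorm_le K : compact K -> exists M, forall x, K x -> enorm x <= M.
Proof.
move=> /compact_bounded[M [_ HM]]; exists (n%:R * (M + 1)) => x Kx.
rewrite (le_trans (enorm_le_norm _))// ler_wpM2l//.
by apply: HM => //; rewrite ltrDl.
Qed.

Lemma closed_dot_le u (c : R) : closed [set x | dot x u <= c].
Proof.
rewrite (_ : [set x | _] = dot u @^-1` [set t | t <= c]); last first.
  by apply/seteqP; split=> x /=; rewrite dotC.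
by apply: closed_comp => // x _; exact: continuous_dotr.
Qed.

Lemma open_dot_gt u (c : R) : open [set x | c < dot x u].
Proof.
rewrite (_ : [set x | _] = ~` [set x | dot x u <= c]).
  by apply: closed_openC; exact: closed_dot_le.
by apply/seteqP; split => x /=; rewrite ltNge => /negP.
Qed.

Lemma interior0P K : interior K 0 <-> exists2 r, 0 < r & forall x, enorm x < r -> K x.
Proof.
split=> [/nbhs_ballP[r /= r0 rK]|[r r0 rK]].
  exists r => // x xr; apply: rK; rewrite -ball_normE/= sub0r normrN.
  exact: le_lt_trans (norm_le_enorm _) xr.
apply/nbhs_ballP; exists (r / (n%:R + 1)) => /=; first by rewrite divr_gt0// ltr_wpDl.
move=> x; rewrite -ball_normE/= sub0r normrN ltr_pdivlMr ?ltr_wpDl// => h.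
apply: rK; apply: le_lt_trans h; rewrite (le_trans (enorm_le_norm _))//.
by rewrite mulrC ler_wpM2l// lerDl.
Qed.

Lemma K0_0 K : K0 n K -> K 0.
Proof. by move=> [_ _]; exact: interior_subset. Qed.

Lemma has_sup_dot K u : K0 n K -> has_sup [set dot x u | x in K].
Proof.
move=> K0K; have [cK _ _] := K0K; have [M HM] := compact_enorm_le cK.
split; first by exists (dot 0 u), 0 => //; exact: K0_0.
exists (M * enorm u) => _ [x Kx <-].
rewrite (le_trans (ler_norm _))// (le_trans (dot_le_enorm _ _))//.
by rewrite ler_wpM2r ?enorm_ge0// HM.
Qed.

Lemma dot_le_support K x u : K0 n K -> K x -> dot x u <= support_fun K u.
Proof.
by move=> K0K Kx; apply: ub_le_sup; [exact: (has_sup_dot u K0K).2|exists x].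
Qed.

Lemma support_le K u (c : R) : K0 n K -> (forall x, K x -> dot x u <= c) ->
  support_fun K u <= c.
Proof.
move=> K0K Kc; apply: ge_sup; first exact: (has_sup_dot u K0K).1.
by move=> _ [x Kx <-]; exact: Kc.
Qed.

Lemma support_funZ K (c : R) u : K0 n K -> 0 < c ->
  support_fun K (c *: u) = c * support_fun K u.
Proof.
move=> K0K c0; apply/eqP; rewrite eq_le; apply/andP; split.
  apply: support_le => // x Kx; rewrite dotZr ler_pM2l//.
  exact: dot_le_support.
rewrite -ler_pdivlMl//; apply: support_le => // x Kx.
by rewrite ler_pdivlMl// -dotZr; exact: dot_le_support.
Qed.

Lemma support_gt0 K u : K0 n K -> u != 0 -> 0 < support_fun K u.
Proof.
move=> K0K u0; have [_ _ /interior0P[r r0 rK]] := K0K.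
have eu : 0 < enorm u by rewrite enorm_gt0.
pose t := r / 2 / enorm u.
have t0 : 0 < t by rewrite !divr_gt0.
have /(dot_le_support u K0K) : K (t *: u).
  by apply: rK; rewrite enormZ gtr0_norm// /t divfK ?gt_eqF//; lra.
by apply: lt_le_trans; rewrite dotZl mulr_gt0// -enorm_sqr exprn_gt0.
Qed.

(** Superlevel sets of a supremum of linear functions are unions of open half-spaces. *)
Lemma measurable_support K : K0 n K -> measurable_fun setT (support_fun K).
Proof.
move=> K0K; apply: (measurability _ (RGenOInfty.measurableE R)) => //.
move=> /= _ [_ [c ->] <-]; rewrite setTI; apply: measurable_open_rV.
rewrite (_ : _ @^-1` _ = \bigcup_(x in K) [set u | c < dot x u]).
  apply: bigcup_open => x _; rewrite (_ : [set u | _] = [set u | c < dot u x]).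
    exact: open_dot_gt.
  by apply/seteqP; split=> u /=; rewrite dotC.
apply/seteqP; split=> [u|u [x Kx /= cx]]; rewrite /= in_itv/= andbT.
  move=> cu; have [_ [x Kx <-] cx] := sup_gt (has_sup_dot u K0K).1 cu.
  by exists x.
exact: lt_le_trans cx (dot_le_support _ K0K Kx).
Qed.

Lemma continuous_mulmx (M : 'M[R]_n) : continuous (fun x : 'rV[R]_n => x *m M).
Proof.
move=> x B /nbhs_ballP[e /= e0 eB]; have [C C0 HC] := enorm_mulmx M.
apply/nbhs_ballP; exists (e / (C * (n%:R + 1))) => /=.
  by rewrite divr_gt0// mulr_gt0// ltr_wpDl.
move=> y xy; apply: eB; move: xy; rewrite -!ball_normE/= -mulmxBl => h.
rewrite (le_lt_trans (norm_le_enorm _))// (le_lt_trans (HC _))//.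
move: h; rewrite ltr_pdivlMr; last by rewrite mulr_gt0// ltr_wpDl.
apply: le_lt_trans; rewrite mulrCA ler_pM2l// (le_trans (enorm_le_norm _))//.
by rewrite mulrC ler_wpM2l// lerDl.
Qed.

Lemma K0_linear_image (phi : 'M[R]_n) K : phi \in unitmx -> K0 n K ->
  K0 n (linear_image phi K).
Proof.
move=> phiU [cK vK /interior0P[r r0 rK]]; split.
- apply: continuous_compact => //; apply: continuous_subspaceT => x.
  exact: continuous_mulmx.
- move=> x y l /set_mem[x' Kx' <-] /set_mem[y' Ky' <-]; apply/mem_set.
  have /set_mem H := vK x' y' l (mem_set Kx') (mem_set Ky').
  eexists; first exact: H.
  by rewrite [LHS]mulmxDl -!scalemxAl.
- apply/interior0P; have [C C0 HC] := enorm_mulmx (invmx phi).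
  exists (r / C) => [|x]; first exact: divr_gt0.
  rewrite ltr_pdivlMr// mulrC => xr; exists (x *m invmx phi); last by rewrite mulmxKV.
  by apply: rK; exact: le_lt_trans (HC _) xr.
Qed.

Lemma support_linear_image (phi : 'M[R]_n) K u :
  support_fun (linear_image phi K) u = support_fun K (u *m phi^T).
Proof.
congr sup; apply/seteqP; split => [_ [_ [x Kx <-] <-]|_ [x Kx <-]].
  by exists x => //; rewrite dot_mulmx.
by exists (x *m phi); [exists x|rewrite dot_mulmx].
Qed.

Lemma polar_linear_image (phi : 'M[R]_n) K :
  polar (linear_image phi K) = [set x | polar K (x *m phi^T)].
Proof.
apply/seteqP; split=> x H y => [Ky|[z Kz <-]].
  by rewrite dotC -dot_mulmx dotC; apply: H; exists y.
by rewrite dotC dot_mulmx dotC; exact: H.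
Qed.

Lemma measurable_polar K : measurable (polar K).
Proof.
apply: measurable_closed_rV.
rewrite (_ : polar K = \bigcap_(y in K) [set x | dot x y <= 1]).
  by apply: closed_bigI => y _; exact: closed_dot_le.
by apply/seteqP; split.
Qed.

Lemma radial_fun_polar K u : K0 n K -> u != 0 ->
  radial_fun (polar K) u = (support_fun K u)^-1.
Proof.
move=> K0K u0; have h0 := support_gt0 K0K u0.
have E t : 0 <= t -> polar K (t *: u) <-> t <= (support_fun K u)^-1.
  move=> t0; rewrite -[_^-1]mul1r ler_pdivlMr//; split=> [H|H y Ky].
    have [->|tn0] := eqVneq t 0; first by rewrite mul0r.
    have {tn0}t0' : 0 < t by rewrite lt0r tn0.
    rewrite -ler_pdivlMl// mulr1; apply: support_le => // x Kx.
    by rewrite -[t^-1]mulr1 ler_pdivlMl// dotC -dotZl; exact: H.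
  rewrite dotZl (le_trans _ H)// ler_wpM2l// dotC; exact: dot_le_support.
apply/eqP; rewrite eq_le; apply/andP; split.
  apply: ge_sup; last by move=> t [t0 /E]; exact.
  by exists 0; split=> //; apply/E => //; rewrite invr_ge0 ltW.
apply: ub_le_sup; last by split; [rewrite invr_ge0 ltW|apply/E => //; rewrite invr_ge0 ltW].
by exists (support_fun K u)^-1 => t [t0 /E]; exact.
Qed.

Local Notation tau := reverse_spherical_image.

Lemma reverse_spherical_imageP K A x : K0 n K ->
  tau K A x <-> K x /\ exists u, [/\ sphere n u, A u & forall y, K y -> dot y u <= dot x u].
Proof.
move=> K0K; split=> -[Kx [u [Su Au H]]]; split=> //; exists u; split=> //.
  by move=> y Ky; rewrite H; exact: dot_le_support.
by apply/eqP; rewrite eq_le dot_le_support//= support_le.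
Qed.

Lemma le_reverse_spherical_image K A B : A `<=` B -> tau K A `<=` tau K B.
Proof. by move=> AB x [Kx [u [Su Au H]]]; split=> //; exists u; split=> //; exact: AB. Qed.

Lemma reverse_spherical_image_setI K A : tau K A = tau K (A `&` sphere n).
Proof.
by apply/seteqP; split=> x [Kx [u [Su Au H]]]; split=> //; exists u; split=> //; case: Au.
Qed.

Lemma reverse_spherical_image_bigcup K (F : (set 'rV[R]_n)^nat) :
  tau K (\bigcup_k F k) = \bigcup_k tau K (F k).
Proof.
apply/seteqP; split=> x.
  by move=> [Kx [u [Su [k _ Fu] H]]]; exists k => //; split=> //; exists u.
by move=> [k _ [Kx [u [Su Fu H]]]]; split=> //; exists u; split=> //; exists k.
Qed.

Lemma reverse_spherical_image0 K : tau K set0 = set0.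
Proof. by apply/seteqP; split=> // x [_ [u []]]. Qed.

Lemma closed_sphere : closed (sphere n : set 'rV[R]_n).
Proof.
rewrite (_ : sphere n = @enorm R n @^-1` [set 1]); last by apply/seteqP; split.
apply: closed_comp; first by move=> x _; exact: continuous_enorm.
exact: closed_eq.
Qed.

Lemma compact_sphere : compact (sphere n : set 'rV[R]_n).
Proof.
apply: bounded_closed_compact; last exact: closed_sphere.
exists 1; split; first exact: num_real.
move=> M M1 x; rewrite /sphere/= => x1; rewrite (le_trans (norm_le_enorm _))// x1.
exact: ltW.
Qed.

(** The pairs of a point and an outer unit normal in [A] form a compact set, of which [tau K A] is a
    projection. For closed [A] this gives measurability, from which the general Borel case is
    built. *)
Lemma compact_reverse_spherical_image K A : K0 n K -> closed A -> compact (tau K A).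
Proof.
move=> K0K cA; have [cK _ _] := K0K.
pose S := (K `*` (sphere n `&` A)) `&`
  \bigcap_(y in K) [set xu : 'rV[R]_n * 'rV[R]_n | dot y xu.2 <= dot xu.1 xu.2].
have -> : tau K A = fst @` S.
  apply/seteqP; split=> x.
    move=> /(reverse_spherical_imageP _ _ K0K)[Kx [u [Su Au H]]].
    by exists (x, u) => //; split.
  move=> [[x' u] [[/= Kx [Su Au]] H] <-]; apply/(reverse_spherical_imageP _ _ K0K).
  by split=> //; exists u; split.
apply: continuous_compact.
  by apply: continuous_subspaceT => xu; exact: cvg_fst.
apply: compact_closedI.
  by apply: compact_setX => //; apply: compact_closedI => //; exact: compact_sphere.
apply: closed_bigI => y _.
have cdot (f g : 'rV[R]_n * 'rV[R]_n -> 'rV[R]_n) : continuous f -> continuous g ->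
    continuous (fun xu => dot (f xu) (g xu)).
  move=> cf cg; apply: continuous_sum_fun => i xu.
  apply: (@continuousM R _ (fun xu => f xu ord0 i) (fun xu => g xu ord0 i) xu).
    by apply: (@continuous_comp _ _ _ f (fun z : 'rV[R]_n => z ord0 i) xu (cf xu)); exact: coord_continuous.
  by apply: (@continuous_comp _ _ _ g (fun z : 'rV[R]_n => z ord0 i) xu (cg xu)); exact: coord_continuous.
pose h (xu : 'rV[R]_n * 'rV[R]_n) := dot xu.1 xu.2 - dot y xu.2.
rewrite (_ : [set _ | _] = h @^-1` [set t | 0 <= t]).
  apply: closed_comp; last exact: closed_ge.
  move=> xu _; apply: (@continuousB R R _ (fun xu => dot xu.1 xu.2) (fun xu => dot y xu.2) xu).
    by apply: cdot => {}xu; [exact: cvg_fst|exact: cvg_snd].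
  by apply: (cdot (fun=> y)) => {}xu; [exact: cst_continuous|exact: cvg_snd].
by apply/seteqP; split=> xu; rewrite /h/= subr_ge0.
Qed.

Lemma measurable_reverse_spherical_image_closed K A : K0 n K -> closed A ->
  measurable (tau K A).
Proof.
move=> K0K cA; apply: measurable_closed_rV; apply: compact_closed.
  exact: norm_hausdorff.
exact: compact_reverse_spherical_image.
Qed.

(** A normal [u] of the image at [x *m phi] corresponds to the normal [u *m phi^T] of [K] at [x], by
    the adjunction [dot_mulmx]; normalizing it gives the direction. *)
Lemma reverse_spherical_image_linear (phi : 'M[R]_n) K A : phi \in unitmx -> K0 n K ->
  tau (linear_image phi K) A =
  linear_image phi (tau K ((fun v => direction (v *m invmx phi^T)) @^-1` A)).
Proof.
move=> phiU K0K; have phiTU : phi^T \in unitmx by rewrite unitmx_tr.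
have K0phi := K0_linear_image phiU K0K.
apply/seteqP; split=> x.
  move=> /(reverse_spherical_imageP _ _ K0phi)[[x' Kx' <-] [u [Su Au H]]].
  have u0 := sphere_neq0 Su; have v0 := mulmx_unit_neq0 phiTU u0.
  exists x' => //; apply/(reverse_spherical_imageP _ _ K0K); split=> //.
  exists (direction (u *m phi^T)); split.
  - exact: enorm_direction.
  - by rewrite /= direction_mulmx mulmxK// direction_sphere.
  - move=> y Ky; rewrite /direction !dotZr ler_pM2l ?invr_gt0 ?enorm_gt0//.
    by rewrite -!dot_mulmx; apply: H; exists y.
move=> [x' /(reverse_spherical_imageP _ _ K0K)[Kx' [v [Sv /= Av H]]] <-].
have v0 := sphere_neq0 Sv.
have vU : v *m invmx phi^T != 0 by rewrite mulmx_unit_neq0 ?unitmx_inv.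
apply/(reverse_spherical_imageP _ _ K0phi); split; first by exists x'.
exists (direction (v *m invmx phi^T)); split=> //; first exact: enorm_direction.
move=> _ [y Ky <-]; rewrite /direction !dotZr ler_pM2l ?invr_gt0 ?enorm_gt0//.
by rewrite !dot_mulmx mulmxKV//; exact: H.
Qed.

End convex_bodies.

(** If [x] has a normal [u] close to [v], then [<x - y, u> >= 0], so [<x - y, v>] is at least
    [- |u - v| |x - y|]; exchanging [x] and [y] bounds it from above. *)
Lemma reverse_spherical_image_flat (R : realType) m (K : set 'rV[R]_m.+1) (v : 'rV[R]_m.+1)
    (eta : R) A : K0 m.+1 K -> A `<=` [set u | enorm (u - v) <= eta] ->
  flat eta v (reverse_spherical_image K A).
Proof.
move=> K0K Av.
have H x y : reverse_spherical_image K A x -> reverse_spherical_image K A y ->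
    - (eta * enorm (x - y)) <= dot (x - y) v.
  move=> /(reverse_spherical_imageP _ _ K0K)[Kx [u [Su Au Hx]]].
  move=> /(reverse_spherical_imageP _ _ K0K)[Ky _].
  have := Hx y Ky; rewrite -subr_ge0 -dotBl => h.
  have := dot_le_enorm (x - y) (v - u); rewrite dotBr ler_norml => /andP[+ _].
  have := Av _ Au; rewrite /= (enormBC u v) => vu.
  have := ler_wpM2l (enorm_ge0 (x - y)) vu.
  lra.
move=> x y Ex Ey; rewrite ler_norml H//=.
have := H y x Ey Ex; rewrite (enormBC y x) -(opprB x y) dotNl; lra.
Qed.

(** * Outer measures and sets with null overlaps *)

Section caratheodory_null.
Context (R : realType) (T : pointedType) (mu : {outer_measure set T -> \bar R}).
Local Open Scope ereal_scope.

Lemma caratheodory_null (N : set T) : mu N = 0 -> mu.-caratheodory N.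
Proof.
move=> N0; apply: le_caratheodory_measurable => X.
rewrite (_ : mu (X `&` N) = 0).
  by rewrite add0e le_outer_measure//; exact: subIsetl.
apply/eqP; rewrite eq_le outer_measure_ge0 andbT -N0.
by apply: le_outer_measure; exact: subIsetr.
Qed.

Lemma outer_measure0_sub (A N : set T) : A `<=` N -> mu N = 0 -> mu A = 0.
Proof.
move=> AN N0; apply/eqP; rewrite eq_le outer_measure_ge0 andbT -N0.
exact: le_outer_measure.
Qed.

(** Making the sets disjoint by [seqDU] removes only null overlaps. Reverse spherical images of
    disjoint sets are of this kind. *)
Lemma caratheodory_almost_disjoint_sum (E : (set T)^nat) :
  (forall k, mu.-caratheodory (E k)) ->
  (forall i j, i <> j -> mu (E i `&` E j) = 0) ->
  mu (\bigcup_k E k) = \sum_(k <oo) mu (E k).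
Proof.
move=> cE nE.
have cD k : mu.-caratheodory (seqDU E k).
  by apply: caratheodory_measurable_setD => //; exact: caratheodory_measurable_bigsetU.
have DE k : mu (seqDU E k) = mu (E k).
  apply/eqP; rewrite eq_le le_outer_measure/=; last exact: subset_seqDU.
  rewrite (le_trans (le_outer_measureIC mu (seqDU E k) (E k)))//.
  rewrite [X in _ + X](_ : _ = 0) ?adde0.
    by apply: le_outer_measure; exact: subIsetr.
  apply: (@outer_measure0_sub _ (\bigcup_(i in `I_k) (E k `&` E i))).
    move=> x [Ex /not_andP[//|/contrapT]]; rewrite -bigcup_mkord => -[i ik Ei].
    by exists i.
  rewrite bigcup_mkord; apply/eqP; rewrite eq_le outer_measure_ge0 andbT.
  rewrite (le_trans (outer_measure_subadditive mu (fun i => E k `&` E i) k))//.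
  rewrite big1// => i _; apply: nE => ki.
  by have := ltn_ord i; rewrite -ki ltnn.
rewrite seqDU_bigcup_eq.
under [RHS]eq_eseriesr do rewrite -DE.
apply/esym/cvg_lim => //.
apply: (@caratheodory_measure_sigma_additive R T mu) => //.
exact: caratheodory_measurable_bigcup.
Qed.

End caratheodory_null.

(** * The surface area of linear images *)

Section surface_area.
Context (R : realType) (m : nat).
Local Notation n := m.+1.
Variables (K : set 'rV[R]_n).
Hypothesis K0K : K0 n K.
Local Notation tau := (reverse_spherical_image K).
Local Notation H := (@hausdorff_measure R n m).
Local Notation sigma := (@spherical_measure R n).
Local Open Scope ereal_scope.

(** The sphere is covered by finitely many balls of radius 1/2, and the boundary points with normals
    in one of them form a bounded flat set of slope 1/2. *)
Lemma surface_area_fin : H (tau setT) < +oo.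
Proof.
have [cK _ _] := K0K; have [M HM] := compact_enorm_le cK.
pose k := (Num.truncn M).+1.
have Kk : K `<=` cube k%:R.
  move=> x Kx i; rewrite (le_trans (coord_le_enorm _ _))// (le_trans (HM _ Kx))//.
  by rewrite ltW// truncnS_gt.
pose U (v : 'rV[R]_n) := [set u : 'rV[R]_n | (enorm (u - v) < 2^-1)%R].
have oU v : open (U v).
  rewrite (_ : U v = (fun u => enorm (u - v)%R) @^-1` [set t | (t < 2^-1)%R]); last by [].
  apply: open_comp; last exact: open_lt.
  move=> x _; apply: (@continuous_comp 'rV[R]_n 'rV[R]_n R (fun x => x - v)%R (@enorm R n) x).
    apply: (@continuousB R 'rV[R]_n 'rV[R]_n id (cst v) x); first exact: cvg_id.
    exact: cst_continuous.
  exact: continuous_enorm.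
have Ufin v : sphere n v -> H (tau (U v)) < +oo.
  move=> Sv; apply: (@flat_hausdorff_fin R m v _ k) => //.
    by apply: reverse_spherical_image_flat => // u /ltW.
  by move=> x [Kx _]; exact: Kk.
have := compact_sphere (R := R) (n := n); rewrite compact_cover.
move=> /(_ _ (sphere n) U (fun v _ => oU v))[].
  by move=> u Su; exists u => //; rewrite /U/= subrr enorm0 invr_gt0.
move=> D DS Scov.
pose G (s : seq 'rV[R]_n) := \bigcup_(v in [set v | v \in s]) tau (U v).
have sub : tau setT `<=` G (finmap.enum_fset D).
  move=> x [Kx [u [Su _ Hu]]].
  by have [v Dv Uv] := Scov _ Su; exists v => //; split=> //; exists u.
apply: (le_lt_trans (le_outer_measure H _ _ sub)).
have {Scov sub} : forall v, v \in (finmap.enum_fset D) -> sphere n v by move=> v /DS/set_mem.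
elim: (finmap.enum_fset D) => [|v s IH] Ds.
  by rewrite /G bigcup0// outer_measure0 ltry.
have sub : G (v :: s) `<=` tau (U v) `|` G s.
  move=> x [w /=]; rewrite in_cons => /orP[/eqP ->|ws]; first by left.
  by right; exists w.
apply: (le_lt_trans (le_outer_measure H _ _ sub)).
rewrite (le_lt_trans (outer_measureU2 _ _ _))// lte_add_pinfty//.
  by apply: Ufin; apply: Ds; rewrite mem_head.
by apply: IH => w ws; apply: Ds; rewrite in_cons ws orbT.
Qed.

Variable f : 'rV[R]_n -> R.
Hypothesis Kf : is_curvature_function K f.

(** A curvature function is constrained only on the sphere; the extension by zero is measurable and
    nonnegative on the whole space. *)
Definition sphere_ext (u : 'rV[R]_n) : R := f u * \1_(sphere n) u.

Lemma measurable_sphere_ext : measurable_fun setT sphere_ext.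
Proof.
have [mf _ _] := Kf.
rewrite (_ : sphere_ext = f \_ (sphere n)).
  apply/(measurable_restrictT _ _).1 => //; exact: measurable_sphere.
apply/funext => u; rewrite /sphere_ext patchE indicE.
by case: ifP => _; rewrite ?mulr1 ?mulr0.
Qed.

Lemma sphere_ext_ge0 u : (0 <= sphere_ext u)%R.
Proof.
have [_ f0 _] := Kf; rewrite /sphere_ext indicE.
by case: (boolP (u \in sphere n)) => [/set_mem/f0|_]; rewrite ?mulr1 ?mulr0.
Qed.

Lemma sphere_extE u : sphere n u -> sphere_ext u = f u.
Proof. by move=> Su; rewrite /sphere_ext indicE mem_set// mulr1. Qed.

Lemma surface_area_integral A : measurable A ->
  H (tau A) = \int[sigma]_(u in A) (sphere_ext u)%:E.
Proof.
move=> mA; have [_ _ HK] := Kf.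
rewrite reverse_spherical_image_setI.
have mAS : measurable (A `&` sphere n) by apply: measurableI => //; exact: measurable_sphere.
have := HK _ mAS (@subIsetr _ _ _); rewrite /surface_area_measure/= => ->.
rewrite integral_mkcondr; apply: eq_integral => u _.
rewrite patchE /sphere_ext indicE.
by case: ifP => _; rewrite ?mulr1 ?mulr0.
Qed.

Lemma tau_fin A : H (tau A) \is a fin_num.
Proof.
rewrite ge0_fin_numE ?outer_measure_ge0//; apply: le_lt_trans surface_area_fin.
by apply: le_outer_measure; exact: le_reverse_spherical_image.
Qed.

(* The additivity of [S(K, .)], built into the existence of a density, forces the
   set of boundary points with normals in both [A] and its complement to be null. *)
Lemma tau_overlap A : measurable A -> H.-caratheodory (tau A) ->
  H (tau A `&` tau (~` A)) = 0.
Proof.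
move=> mA cA.
have TE : tau setT = tau A `|` tau (~` A).
  apply/seteqP; split=> x.
    move=> [Kx [u [Su _ Hu]]]; have [Au|nAu] := pselect (A u).
      by left; split=> //; exists u.
    by right; split=> //; exists u.
  by move=> [|]; exact: le_reverse_spherical_image.
have HT : H (tau setT) = H (tau A) + H (tau (~` A)).
  have mC : measurable (~` A) by exact: measurableC.
  rewrite !surface_area_integral// -(setUv A) ge0_integral_setU//.
  - apply/measurable_EFinP; apply: measurable_funTS; exact: measurable_sphere_ext.
  - by move=> u _; rewrite lee_fin sphere_ext_ge0.
  - by apply/disj_setPS => x [].
have := cA (tau setT).
rewrite (_ : tau setT `&` tau A = tau A); last first.
  by apply/setIidPr; exact: le_reverse_spherical_image.
rewrite (_ : tau setT `&` ~` tau A = tau (~` A) `&` ~` tau A); last first.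
  rewrite TE setIUl setICr set0U//.
rewrite HT => /(congr1 (fun x => x - H (tau A))).
rewrite ![H (tau A) + _]addeC !addeK ?tau_fin// [in LHS](cA (tau (~` A))).
have fin X : X `<=` tau setT -> H X \is a fin_num.
  move=> XT; rewrite ge0_fin_numE ?outer_measure_ge0//.
  by apply: le_lt_trans surface_area_fin; exact: le_outer_measure.
move=> /(congr1 (fun x => x - H (tau (~` A) `&` ~` tau A))).
rewrite addeK ?subee ?fin//; try by move=> x [+ _]; exact: le_reverse_spherical_image.
by rewrite setIC.
Qed.

Lemma hausdorff_linear_image_null (M : 'M[R]_n) N : H N = 0 -> H (linear_image M N) = 0.
Proof.
move=> N0; have [C C0 HC] := enorm_mulmx M.
apply/eqP; rewrite eq_le outer_measure_ge0 andbT.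
have := @hausdorff_measure_lip R _ _ _ m (mulmxr M) id N C C0.
rewrite image_id N0 mule0; apply => x y _ _.
by rewrite /= -mulmxBl.
Qed.

Lemma linear_imageI (M : 'M[R]_n) A B : M \in unitmx ->
  linear_image M (A `&` B) = linear_image M A `&` linear_image M B.
Proof.
move=> MU; apply/seteqP; split=> x.
  by move=> [y [Ay By] <-]; split; exists y.
move=> [[y Ay yx] [z Bz zx]]; exists y => //; split=> //.
by rewrite -(mulmxK MU y) yx -zx mulmxK.
Qed.

Lemma linear_imageU (M : 'M[R]_n) A B :
  linear_image M (A `|` B) = linear_image M A `|` linear_image M B.
Proof. exact: image_setU. Qed.

Lemma linear_imageD (M : 'M[R]_n) A B : M \in unitmx ->
  linear_image M (A `\` B) = linear_image M A `\` linear_image M B.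
Proof.
move=> MU; apply/seteqP; split=> x.
  move=> [y [Ay nBy] <-]; split; first by exists y.
  by move=> [z Bz zx]; apply: nBy; rewrite -(mulmxK MU y) -zx mulmxK.
move=> [[y Ay <-] nB]; exists y => //; split=> // By; apply: nB; by exists y.
Qed.

Lemma tau_caratheodory A : measurable A ->
  forall M, M \in unitmx -> H.-caratheodory (linear_image M (tau A)).
Proof.
pose C (A : set 'rV[R]_n) := measurable A /\
  forall M, M \in unitmx -> H.-caratheodory (linear_image M (tau A)).
have im1 E : linear_image 1%:M E = E.
  apply/seteqP; split=> [_ [x Ex <-]|x Ex]; rewrite ?mulmx1//.
  by exists x => //; rewrite mulmx1.
have Cclosed B : closed B -> C B.
  move=> cB; split; first exact: measurable_closed_rV.
  move=> M MU; apply: caratheodory_borel; rewrite /linear_image measurable_image_unit//.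
  apply: (measurable_preimage (measurable_mulmx (invmx M))).
  exact: measurable_reverse_spherical_image_closed.
have CC B : C B -> C (~` B).
  move=> [mB cB]; split; first exact: measurableC.
  have cB1 : H.-caratheodory (tau B) by rewrite -[tau B]im1; apply: cB; exact: unitmx1.
  have N0 := tau_overlap mB cB1.
  move=> M MU.
  rewrite (_ : tau (~` B) = (tau setT `\` tau B) `|` (tau B `&` tau (~` B))).
    rewrite linear_imageU linear_imageD//; apply: caratheodory_measurable_setU.
      apply: caratheodory_measurable_setD; last exact: cB.
      by have [_] := Cclosed _ (@closedT _); exact.
    by apply: caratheodory_null; exact: hausdorff_linear_image_null.
  apply/seteqP; split=> x.
    move=> tx; have [ax|nax] := pselect (tau B x); first by right.
    by left; split=> //; exact: le_reverse_spherical_image tx.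
  move=> [[[Kx [u [Su _ Hu]]] ntA]|[]//]; split=> //; exists u; split=> // Au.
  by apply: ntA; split=> //; exists u.
move=> mA; suff : C A by case.
suff : <<s @open 'rV[R]_n >> `<=` C by apply.
apply: smallest_sub.
  split.
  - by apply: Cclosed; exact: closed0.
  - by move=> B /CC; rewrite setTD.
  - move=> F CF; split; first by apply: bigcupT_measurable => k; have [] := CF k.
    move=> M MU; rewrite reverse_spherical_image_bigcup /linear_image image_bigcup.
    by apply: caratheodory_measurable_bigcup => k; have [_] := CF k; exact.
move=> U oU; rewrite -[U]setCK; apply: CC; apply: Cclosed; exact: open_closedC.
Qed.

(** For disjoint sets the images overlap only in images of points with a normal in each of them.
    These are null by [tau_overlap], since linear maps are Lipschitz. *)
Lemma tau_image_additive (M : 'M[R]_n) : M \in unitmx ->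
  semi_sigma_additive (fun A => H (linear_image M (tau A))).
Proof.
move=> MU F mF tF mUF.
have -> : H (linear_image M (tau (\bigcup_k F k))) =
    \sum_(k <oo) H (linear_image M (tau (F k))).
  rewrite reverse_spherical_image_bigcup /linear_image image_bigcup.
  apply: (caratheodory_almost_disjoint_sum (mu := H)).
    by move=> k; exact: tau_caratheodory.
  move=> i j ij; rewrite -linear_imageI//; apply: hausdorff_linear_image_null.
  have ci : H.-caratheodory (tau (F i)).
    rewrite (_ : tau (F i) = linear_image 1%:M (tau (F i))).
      by apply: tau_caratheodory => //; exact: unitmx1.
    apply/seteqP; split=> [x Ex|_ [x Ex <-]]; last by rewrite mulmx1.
    by exists x => //; rewrite mulmx1.
  apply: outer_measure0_sub (tau_overlap (mF i) ci).
  move=> x [ti tj]; split=> //; apply: le_reverse_spherical_image tj => u Fju Fiu.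
  by apply: ij; apply: (tF i j I I); exists u.
by apply: is_cvg_nneseries => *; exact: outer_measure_ge0.
Qed.

(** On a small patch around [v] both sides are close to [J v] times [H (tau B)]: the left by
    flatness, the right by the continuity of [J]. The comparison [local_le_measure] needs the
    additivity from [tau_image_additive]. *)
Lemma tau_image_density (phi : 'M[R]_n) A : phi \in unitmx -> measurable A ->
  A `<=` sphere n ->
  H (linear_image phi (tau A)) =
  \int[sigma]_(u in A)
    (`|\det phi| * enorm (u *m invmx phi^T) * sphere_ext u)%:E.
Proof.
move=> phiU mA AS.
have phiTU : phi^T \in unitmx by rewrite unitmx_tr.
pose W := invmx phi^T.
have WU : W \in unitmx by rewrite unitmx_inv.
pose J (u : 'rV[R]_n) := (`|\det phi| * enorm (u *m W))%R.
have detphi : (0 < `|\det phi|)%R.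
  by rewrite normr_gt0; move: phiU; rewrite unitmxE unitfE.
have J0 u : (0 <= J u)%R by rewrite mulr_ge0 ?enorm_ge0.
have mJ : measurable_fun setT J.
  by apply: measurable_funM => //; exact: measurable_enorm_mulmx.
have mext := measurable_sphere_ext; have ext0 := sphere_ext_ge0.
pose k u := (J u * sphere_ext u)%R.
have k0 u : (0 <= k u)%R by rewrite mulr_ge0.
have mk : measurable_fun setT (fun u => (k u)%:E).
  by apply/measurable_EFinP; exact: measurable_funM.
pose alpha (B : set 'rV[R]_n) := H (linear_image phi (tau B)).
pose beta (B : set 'rV[R]_n) := \int[sigma]_(u in B) (k u)%:E.
have salpha : semi_sigma_additive alpha by exact: tau_image_additive.
have sbeta : semi_sigma_additive beta.
  by apply: semi_sigma_additive_nng_induced => // u; rewrite lee_fin.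
have beta_ge0 B : 0 <= beta B by apply: integral_ge0 => *; rewrite lee_fin.
have key v (e : R) : sphere n v -> (0 < e)%R -> exists U, [/\ open U, U v &
   forall B, measurable B -> B `<=` U `&` sphere n ->
   alpha B <= (1 + e)%:E * beta B /\ beta B <= (1 + e)%:E * alpha B].
  (* One factor [1 + d] pays for flatness, the other for the variation of [J] on the patch. *)
  move=> Sv e0; have [d d0 Hd] := pow1D_le 2 e0.
  have d1 : (1 < 1 + d)%R by rewrite ltrDl.
  have [eta eta0 Heta] := flat_hausdorff phiU Sv d0.
  pose w0 := enorm (v *m W).
  have w00 : (0 < w0)%R by rewrite enorm_gt0 mulmx_unit_neq0// sphere_neq0.
  exists ([set u | (w0 / (1 + d) < enorm (u *m W) < w0 * (1 + d))%R] `&`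
          [set u | (enorm (u - v) < eta)%R]); split.
  - apply: openI; first exact: open_enorm_mulmx.
    rewrite (_ : [set _ | _] = (fun u : 'rV[R]_n => enorm (u - v)%R) @^-1` [set t | (t < eta)%R]); last by [].
    apply: open_comp; last exact: open_lt.
    move=> x _; apply: (@continuous_comp 'rV[R]_n 'rV[R]_n R (fun x => x - v)%R (@enorm R n) x).
      apply: (@continuousB R 'rV[R]_n 'rV[R]_n id (cst v) x); first exact: cvg_id.
      exact: cst_continuous.
    exact: continuous_enorm.
  - split; last by rewrite /= subrr enorm0.
    by rewrite /= -/w0 ltr_pdivrMr ?ltr_pMr ?d1//; lra.
  - move=> B mB BU.
    have [h1 h2] : alpha B <= ((1 + d) * J v)%:E * H (tau B) /\
        (J v)%:E * H (tau B) <= (1 + d)%:E * alpha B.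
      apply: Heta; apply: reverse_spherical_image_flat => // u /BU[[_ /= /ltW]] //.
    have Hext : H (tau B) = \int[sigma]_(u in B) (sphere_ext u)%:E.
      exact: surface_area_integral.
    have mextB : measurable_fun B (fun u => (sphere_ext u)%:E).
      by apply/measurable_EFinP; exact: measurable_funTS.
    have mkB : measurable_fun B (fun u => (k u)%:E) by exact: measurable_funTS.
    have bnd u : B u -> (J v <= (1 + d) * J u)%R /\ (J u <= (1 + d) * J v)%R.
      move=> /BU[[/= /andP[a b] _] _]; rewrite /J ![((1 + d) * (_ * _))%R]mulrCA.
      rewrite !ler_pM2l//; split; last by rewrite mulrC ltW.
      by rewrite mulrC -ler_pdivrMr ?(ltW a)//; lra.
    have b1 : (J v)%:E * H (tau B) <= (1 + d)%:E * beta B.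
      rewrite Hext -!ge0_integralZl//; try by move=> *; rewrite lee_fin//; lra.
      apply: ge0_le_integral => //.
      + by move=> u _; rewrite -EFinM lee_fin mulr_ge0.
      + exact: measurable_funeM.
      + exact: measurable_funeM.
      + move=> u /bnd[h _]; rewrite -!EFinM lee_fin /k [leRHS]mulrA.
        by rewrite ler_wpM2r.
      by rewrite lee_fin.
    have b2 : beta B <= ((1 + d) * J v)%:E * H (tau B).
      rewrite Hext -!ge0_integralZl//; try by move=> *; rewrite lee_fin// mulr_ge0//; lra.
      apply: ge0_le_integral => //.
      + by move=> u _; rewrite lee_fin.
      + exact: measurable_funeM.
      + move=> u /bnd[_ h]; rewrite -!EFinM lee_fin /k.
        by rewrite ler_wpM2r.
    have dd0 : 0 <= (1 + d)%:E by rewrite lee_fin; lra.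
    have Hd' : (1 + d)%:E * (1 + d)%:E <= (1 + e)%:E by rewrite -EFinM lee_fin -expr2.
    have fact x y z : 0 <= z -> x <= (1 + d)%:E * y -> y <= (1 + d)%:E * z -> x <= (1 + e)%:E * z.
      move=> z0 xy yz; apply: le_trans xy _; apply: le_trans (lee_wpmul2l dd0 yz) _.
      by rewrite muleA lee_wpmul2r.
    split.
      apply: fact b1 => //; by rewrite muleA -EFinM.
    apply: fact h2; first exact: outer_measure_ge0.
    by rewrite muleA -EFinM.
suff : alpha A = beta A by [].
apply/eqP; rewrite eq_le; apply/andP; split.
  apply: (@local_le_measure R n (sphere n) alpha beta) => //.
    by rewrite /alpha reverse_spherical_image0 /linear_image image_set0 outer_measure0.
  move=> u0 e Su0 e0; have [U [oU Uu HU]] := key u0 e Su0 e0.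
  by exists U; split=> // B mB BU; have [] := HU B mB BU.
apply: (@local_le_measure R n (sphere n) beta alpha) => //.
  exact: integral_set0.
move=> u0 e Su0 e0; have [U [oU Uu HU]] := key u0 e Su0 e0.
by exists U; split=> // B mB BU; have [] := HU B mB BU.
Qed.

End surface_area.

(** * The curvature function of a linear image *)

Section curvature.
Context (R : realType) (m : nat).
Local Notation n := m.+1.
Local Notation sigma := (@spherical_measure R n).

(** Both are densities of the same measure, which is finite by [surface_area_fin]. *)
Lemma curvature_function_unique (K : set 'rV[R]_n) (f g : 'rV[R]_n -> R) :
  K0 n K -> is_curvature_function K f -> is_curvature_function K g ->
  ae_eq sigma (sphere n) (EFin \o f) (EFin \o g).
Proof.
move=> K0K Kf Kg; have [mf f0 Hf] := Kf; have [mg g0 Hg] := Kg.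
have mS := @measurable_sphere R n.
apply: integral_ae_eq => //.
- apply/integrableP; split; first exact/measurable_EFinP.
  under eq_integral => u /set_mem Su do rewrite /= ger0_norm ?f0//.
  rewrite -Hf//; apply: le_lt_trans (surface_area_fin K0K).
  by apply: le_outer_measure; exact: le_reverse_spherical_image.
- exact/measurable_EFinP.
- by move=> E ES mE; rewrite -[LHS]Hf// -[RHS]Hg.
Qed.

(** One determinant and [w^-1] come from the Jacobian on the boundary, the other determinant and
    [w^-n] from the substitution on the sphere. *)
Definition linear_curvature (phi : 'M[R]_n) (f : 'rV[R]_n -> R) (u : 'rV[R]_n) : R :=
  `|\det phi| ^+ 2 * (enorm (u *m phi^T))^-1 ^+ n.+1 * f (direction (u *m phi^T)).

Lemma curvature_linear_image (phi : 'M[R]_n) (K : set 'rV[R]_n) (f : 'rV[R]_n -> R) :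
  phi \in unitmx -> K0 n K -> is_curvature_function K f ->
  is_curvature_function (linear_image phi K) (linear_curvature phi f).
Proof.
move=> phiU K0K Kf; have [mf f0 Hf] := Kf.
have phiTU : phi^T \in unitmx by rewrite unitmx_tr.
have mS := @measurable_sphere R n.
pose T (u : 'rV[R]_n) := direction (u *m phi^T).
have TS u : sphere n u -> sphere n (T u).
  by move=> /sphere_neq0 u0; rewrite /sphere/= enorm_direction// mulmx_unit_neq0.
have mT : measurable_fun setT T by exact: measurable_direction_mulmx.
have mfe := measurable_sphere_ext Kf; have fe0 := sphere_ext_ge0 Kf.
have minv := measurable_inv_enorm_mulmx phi^T.
split.
- have : measurable_fun (sphere n) (fun u => `|\det phi| ^+ 2 *
     (enorm (u *m phi^T))^-1 ^+ n.+1 * sphere_ext f (T u)).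
    apply: measurable_funTS; apply: measurable_funM.
      by apply: measurable_funM => //; exact: measurable_funX.
    exact: measurableT_comp mfe mT.
  apply: eq_measurable_fun => u /set_mem Su.
  by rewrite /linear_curvature sphere_extE//; exact: TS.
- move=> u Su; apply: mulr_ge0; last exact/f0/TS.
  by rewrite mulr_ge0// exprn_ge0// invr_ge0 enorm_ge0.
move=> A mA AS; rewrite /surface_area_measure/=.
rewrite reverse_spherical_image_linear// reverse_spherical_image_setI.
pose V (v : 'rV[R]_n) := direction (v *m invmx phi^T).
have mV : measurable_fun setT V by exact: measurable_direction_mulmx.
have mVA : measurable (V @^-1` A) by exact: measurable_preimage.
rewrite (tau_image_density K0K Kf) //; last first.
  by apply: measurableI.
pose J (u : 'rV[R]_n) := `|\det phi| * enorm (u *m invmx phi^T).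
(* The indicator of [A] is moved into the integrand, since the change of variables is stated over
   the whole sphere. *)
pose g v := J v * sphere_ext f v * \1_A (V v).
have mg : measurable_fun setT g.
  apply: measurable_funM.
    by apply: measurable_funM => //; apply: measurable_funM => //;
      exact: measurable_enorm_mulmx.
  exact: measurableT_comp (measurable_indic _) mV.
have g0 v : 0 <= g v.
  by rewrite mulr_ge0 ?indicE ?ler0n// mulr_ge0// mulr_ge0// enorm_ge0.
transitivity (\int[sigma]_(v in sphere n) (g v)%:E)%E.
  rewrite setIC integral_mkcondr; apply: eq_integral => v _; rewrite patchE /g indicE.
  have -> : (v \in V @^-1` A) = (V v \in A) by apply/idP/idP => /set_mem H; apply/mem_set.
  by case: ifP => _; rewrite ?mulr1 ?mulr0.
rewrite (sphere_integral_linear phiTU)//; last exact: measurable_funTS.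
rewrite -[in RHS](setIidr AS) [RHS]integral_mkcondr.
apply: eq_integral => u /set_mem Su; rewrite patchE.
have u0 := sphere_neq0 Su.
have w0 : enorm (u *m phi^T) != 0 by rewrite enorm_eq0 mulmx_unit_neq0.
have VT : V (T u) = u by rewrite /V /T direction_mulmx mulmxK// direction_sphere.
rewrite -/(T u) /g VT indicE.
case: ifP => _; last by rewrite !mulr0.
rewrite mulr1 sphere_extE; last exact: TS.
congr EFin; rewrite det_tr /linear_curvature -/(T u) /J.
have -> : enorm (T u *m invmx phi^T) = (enorm (u *m phi^T))^-1.
  rewrite /T /direction -scalemxAl mulmxK// enormZ normfV (ger0_norm (enorm_ge0 _)).
  by move: Su; rewrite /sphere/= => ->; rewrite mulr1.
rewrite [in RHS](exprS _ n) expr2; ring.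
Qed.

Lemma curvature_functionP (K : set 'rV[R]_n) : F0 n K ->
  is_curvature_function K (curvature_function K).
Proof. by move=> [_ _ [f Kf]]; apply: xgetPex; exists f. Qed.

(** [curvature_function] is a chosen density, so it agrees with the explicit one only almost
    everywhere. *)
Lemma curvature_function_linear_image (phi : 'M[R]_n) (K : set 'rV[R]_n) :
  phi \in unitmx -> F0 n K ->
  is_curvature_function (linear_image phi K) (curvature_function (linear_image phi K)) /\
  ae_eq sigma (sphere n) (EFin \o curvature_function (linear_image phi K))
    (EFin \o linear_curvature phi (curvature_function K)).
Proof.
move=> phiU FK; have [K0K _ _] := FK; have Kf := curvature_functionP FK.
have lin := curvature_linear_image phiU K0K Kf.
have Kphi : is_curvature_function (linear_image phi K) (curvature_function (linear_image phi K)).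
  by apply: xgetPex; eexists; exact: lin.
by split=> //; apply: curvature_function_unique lin => //; exact: K0_linear_image.
Qed.

End curvature.

(** * Mixed geominimal surface areas *)
Section geominimal_linear.
Context (R : realType).

Lemma epowerZ (c a : R) (x : \bar R) : 0 < c -> (0 <= x)%E ->
  epower (c%:E * x) a = ((c `^ a)%:E * epower x a)%E.
Proof.
move=> c0 x0; rewrite /epower; case: ifPn => a0; last first.
  by rewrite poweRM ?poweR_EFin// lee_fin ltW.
rewrite poweRM ?poweR_EFin ?lee_fin ?(ltW c0)//.
have y0 : (0 <= x `^ (- a))%E by exact: poweR_ge0.
have cE : c `^ a = (c `^ (- a))^-1 by rewrite -powRN opprK.
rewrite cE; have : 0 < c `^ (- a) by exact: powR_gt0.
(* The inverse sends 0 to [+oo] and [+oo] to 0; multiplication by a positive number preserves both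
   values, so they are separated from the other ones. *)
move: (c `^ (- a)) (x `^ (- a))%E y0 => d [y| |] // y0 d0.
  rewrite -EFinM !inver mulf_eq0 gt_eqF//=.
  by case: eqP => _; rewrite ?gt0_muley ?lte_fin ?invr_gt0// -EFinM invfM.
by rewrite gt0_muley ?lte_fin// invey mule0.
Qed.

Lemma prode_constZ (I : finType) (c : R) (f : I -> \bar R) :
  (\prod_i (c%:E * f i) = (c ^+ #|I|)%:E * \prod_i f i)%E.
Proof.
rewrite big_split/=; congr (_ * _)%E.
by rewrite big_const; elim: #|I| => [|k IH] //=; rewrite IH -EFinM exprS.
Qed.

Lemma linear_imageK n (M : 'M[R]_n) (L : set 'rV[R]_n) : M \in unitmx ->
  linear_image M (linear_image (invmx M) L) = L.
Proof.
move=> MU; apply/seteqP; split=> [_ [_ [x Lx <-] <-]|x Lx]; first by rewrite mulmxKV.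
by exists (x *m invmx M); [exists x|rewrite mulmxKV].
Qed.

Variable m : nat.
Local Notation n := m.+1.
Local Notation sigma := (@spherical_measure R n).
Variable phi : 'M[R]_n.
Hypothesis phiU : phi \in unitmx.
Local Notation D := `|\det phi|.
Local Notation w u := (enorm (u *m phi^T)).
Local Notation T u := (direction (u *m phi^T)).
Local Notation phiL := (linear_image phi).

Let phiTU : phi^T \in unitmx. Proof. by rewrite unitmx_tr. Qed.

Let D_gt0 : 0 < D.
Proof. by rewrite normr_gt0 -unitfE -unitmxE. Qed.

Let w_gt0 u : sphere n u -> 0 < w u.
Proof. by move=> Su; rewrite enorm_gt0 mulmx_unit_neq0// sphere_neq0. Qed.

Let T_sphere u : sphere n u -> sphere n (T u).
Proof.
by move=> Su; rewrite /sphere/= enorm_direction// mulmx_unit_neq0// sphere_neq0.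
Qed.

Let mS := @measurable_sphere R n.

Lemma support_linear_imageE (L : set 'rV[R]_n) u : K0 n L -> sphere n u ->
  support_fun (phiL L) u = w u * support_fun L (T u).
Proof.
move=> K0L Su; rewrite support_linear_image -[in LHS](directionK (u *m phi^T)).
by rewrite support_funZ// w_gt0.
Qed.

Lemma measurable_comp_T (g : 'rV[R]_n -> R) : measurable_fun (sphere n) g ->
  measurable_fun (sphere n) (fun u => g (T u)).
Proof.
move=> mg; apply: (measurable_comp mS _ mg).
  by move=> _ [u Su <-]; exact: T_sphere.
by apply: measurable_funTS; exact: measurable_direction_mulmx.
Qed.

(** Common core of the case [p = 0] and of the mixed volume. The geometric mean of [n] functions
    that all acquire the factor [D^2 w^-n] acquires the same factor; the change of variables on the
    sphere absorbs [D w^-n] of it, and [D] remains. *)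
Lemma geometric_mean_integral (a b : 'I_n -> 'rV[R]_n -> R) :
  (forall i, measurable_fun (sphere n) (a i)) ->
  (forall i, measurable_fun (sphere n) (b i)) ->
  (forall i u, sphere n u -> 0 <= a i u) ->
  (forall i, ae_eq sigma (sphere n) (EFin \o b i)
     (fun u => (D ^+ 2 * (w u)^-1 ^+ n * a i (T u))%:E)) ->
  (\int[sigma]_(u in sphere n) (\prod_(i < n) (b i u) `^ n%:R^-1)%:E =
   D%:E * \int[sigma]_(u in sphere n) (\prod_(i < n) (a i u) `^ n%:R^-1)%:E)%E.
Proof.
move=> ma mb a0 ab.
pose G u := \prod_(i < n) (a i u) `^ n%:R^-1.
have mroot (f : 'I_n -> 'rV[R]_n -> R) : (forall i, measurable_fun (sphere n) (f i)) ->
    measurable_fun (sphere n) (fun u => \prod_(i < n) (f i u) `^ n%:R^-1).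
  move=> mf; apply: measurable_prod => i _.
  exact: (measurableT_comp (measurable_powR _) (mf i)).
have mG : measurable_fun (sphere n) G by exact: mroot.
have G0 u : 0 <= G u by apply: prodr_ge0 => i _; exact: powR_ge0.
have minv := measurable_inv_enorm_mulmx phi^T.
pose k u := D * (w u)^-1 ^+ n * G (T u).
have k0 u : 0 <= k u by rewrite mulr_ge0// mulr_ge0// exprn_ge0// invr_ge0 enorm_ge0.
have mk : measurable_fun (sphere n) k.
  apply: measurable_funM; last exact: measurable_comp_T.
  by apply: measurable_funTS; apply: measurable_funM => //; exact: measurable_funX.
have mkE : measurable_fun (sphere n) (fun u => (k u)%:E) by exact/measurable_EFinP.
transitivity (\int[sigma]_(u in sphere n) (D%:E * (k u)%:E))%E; last first.
  rewrite ge0_integralZl//; last by move=> u _; rewrite lee_fin.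
  by rewrite [in RHS](sphere_integral_linear phiTU mG)// det_tr.
apply: (@ge0_ae_eq_integral _ _ _ sigma (sphere n)
  (fun u => (\prod_(i < n) (b i u) `^ n%:R^-1)%:E) (fun u => (D%:E * (k u)%:E)%E)) => //.
- by apply/measurable_EFinP; exact: (mroot b mb).
- exact: measurable_funeM.
- by move=> u _; rewrite lee_fin; apply: prodr_ge0 => i _; exact: powR_ge0.
- by move=> u _; rewrite -EFinM lee_fin mulr_ge0.
have : {ae sigma, forall u, forall i, sphere n u ->
    (b i u)%:E = (D ^+ 2 * (w u)^-1 ^+ n * a i (T u))%:E}.
  by apply: filter_forall => i; exact: ab.
apply: filterS => u abu Su.
have c0 : 0 <= D ^+ 2 * (w u)^-1 ^+ n.
  by rewrite mulr_ge0 ?exprn_ge0// invr_ge0 enorm_ge0.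
rewrite -EFinM; congr EFin.
under eq_bigr => i _.
  have -> : b i u = D ^+ 2 * (w u)^-1 ^+ n * a i (T u) by apply: EFin_inj; exact: abu.
  rewrite powRM//; last exact/a0/T_sphere.
  over.
rewrite big_split/= -/(G (T u)) prodr_const card_ord /k -powR_mulrn ?powR_ge0//.
by rewrite -powRrM mulVf ?pnatr_eq0// powRr1// expr2; ring.
Qed.

Lemma curvature_measurable (K : set 'rV[R]_n) : F0 n K ->
  measurable_fun (sphere n) (curvature_function K) /\
  forall u, sphere n u -> 0 <= curvature_function K u.
Proof. by move=> /curvature_functionP[]. Qed.

Lemma ae_curvature (K : set 'rV[R]_n) : F0 n K ->
  ae_eq sigma (sphere n) (EFin \o curvature_function (phiL K))
    (EFin \o linear_curvature phi (curvature_function K)).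
Proof. by move=> FK; have [] := curvature_function_linear_image phiU FK. Qed.

Lemma curvature_phi_measurable (K : set 'rV[R]_n) : F0 n K ->
  measurable_fun (sphere n) (curvature_function (phiL K)).
Proof. by move=> FK; have [[]] := curvature_function_linear_image phiU FK. Qed.

Lemma measurable_support_sphere (L : set 'rV[R]_n) : K0 n L ->
  measurable_fun (sphere n) (support_fun L).
Proof. by move=> K0L; apply: measurable_funTS; exact: measurable_support. Qed.

Lemma mixed_Lp_volume_linear p (K L : 'I_n -> set 'rV[R]_n) :
  (forall i, F0 n (K i)) -> (forall i, K0 n (L i)) ->
  mixed_Lp_volume p (fun i => phiL (K i)) (fun i => phiL (L i)) =
  (D%:E * mixed_Lp_volume p K L)%E.
Proof.
move=> KF LK; rewrite /mixed_Lp_volume muleCA; congr (_ * _)%E.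
have KK i : K0 n (K i) by have [] := KF i.
have KphiK i : K0 n (phiL (K i)) by exact: K0_linear_image.
have LphiK i : K0 n (phiL (L i)) by exact: K0_linear_image.
have mLp (A B : set 'rV[R]_n) : K0 n A -> K0 n B ->
   measurable_fun (sphere n) (curvature_function B) ->
   measurable_fun (sphere n) (fun u => support_fun A u `^ p * Lp_curvature_function p B u).
  move=> KA KB mB; apply: measurable_funM.
    exact: (measurableT_comp (measurable_powR _) (measurable_support_sphere KA)).
  apply: measurable_funM => //.
  exact: (measurableT_comp (measurable_powR _) (measurable_support_sphere KB)).
apply: (geometric_mean_integral
   (a := fun i u => support_fun (L i) u `^ p * Lp_curvature_function p (K i) u)
   (b := fun i u => support_fun (phiL (L i)) u `^ p * Lp_curvature_function p (phiL (K i)) u)).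
- by move=> i; apply: mLp => //; have [] := curvature_measurable (KF i).
- by move=> i; apply: mLp => //; exact: curvature_phi_measurable.
- move=> i u Su; rewrite mulr_ge0 ?powR_ge0// mulr_ge0 ?powR_ge0//.
  by have [_] := curvature_measurable (KF i); exact.
move=> i; have := ae_curvature (KF i); apply: filterS => u h Su.
have fE : curvature_function (phiL (K i)) u = linear_curvature phi (curvature_function (K i)) u.
  by apply: EFin_inj; exact: h.
congr EFin; rewrite /= /Lp_curvature_function fE !support_linear_imageE//.
have w0 := w_gt0 Su.
have hL := support_gt0 (LK i) (sphere_neq0 (T_sphere Su)).
have hK := support_gt0 (KK i) (sphere_neq0 (T_sphere Su)).
rewrite !powRM ?(ltW w0) ?(ltW hL) ?(ltW hK)// /linear_curvature.
(* The powers of [w] from the two support functions always combine to [w], which reduces [w^-(n+1)]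
   to [w^-n]; so the factor does not depend on [p]. *)
have ww : w u `^ p * w u `^ (1 - p) = w u.
  by rewrite -powRD ?subrKC ?powRr1 ?(ltW w0)// gt_eqF// implybT.
have wn : w u * (w u)^-1 ^+ n.+1 = (w u)^-1 ^+ n.
  by rewrite exprS mulrA mulfV ?mul1r// gt_eqF.
rewrite -[in RHS]wn -[X in _ = _ * (X * _) * _]ww; ring.
Qed.

Lemma geominimal0_linear (K : 'I_n -> set 'rV[R]_n) : (forall i, F0 n (K i)) ->
  (\int[sigma]_(u in sphere n) (\prod_(i < n) (curvature_function (phiL (K i)) u *
      support_fun (phiL (K i)) u) `^ n%:R^-1)%:E =
   D%:E * \int[sigma]_(u in sphere n) (\prod_(i < n) (curvature_function (K i) u *
      support_fun (K i) u) `^ n%:R^-1)%:E)%E.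
Proof.
move=> KF.
have KK i : K0 n (K i) by have [] := KF i.
have KphiK i : K0 n (phiL (K i)) by exact: K0_linear_image.
apply: (geometric_mean_integral
   (a := fun i u => curvature_function (K i) u * support_fun (K i) u)
   (b := fun i u => curvature_function (phiL (K i)) u * support_fun (phiL (K i)) u)).
- move=> i; apply: measurable_funM; last exact: measurable_support_sphere.
  by have [] := curvature_measurable (KF i).
- move=> i; apply: measurable_funM; last exact: measurable_support_sphere.
  exact: curvature_phi_measurable.
- move=> i u Su; rewrite mulr_ge0//; last exact/ltW/support_gt0/sphere_neq0.
  by have [_] := curvature_measurable (KF i); exact.
move=> i; have := ae_curvature (KF i); apply: filterS => u h Su.
have fE : curvature_function (phiL (K i)) u = linear_curvature phi (curvature_function (K i)) u.
  by apply: EFin_inj; exact: h.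
congr EFin; rewrite /= fE support_linear_imageE// /linear_curvature.
have w0 := w_gt0 Su.
have wn : w u * (w u)^-1 ^+ n.+1 = (w u)^-1 ^+ n.
  by rewrite exprS mulrA mulfV ?mul1r// gt_eqF.
rewrite -[in RHS]wn; ring.
Qed.

Lemma lebesgue_polar_linear (L : set 'rV[R]_n) :
  lebesgue_rV R n (polar (phiL L)) = (D^-1%:E * lebesgue_rV R n (polar L))%E.
Proof.
by rewrite polar_linear_image lebesgue_mulmx ?det_tr//; exact: measurable_polar.
Qed.

(** The [n] radial functions contribute [w^-n], which is the density of the change of variables
    without its factor [D]; hence [D^-1]. *)
Lemma dual_mixed_volume_linear (L : 'I_n -> set 'rV[R]_n) : (forall i, K0 n (L i)) ->
  dual_mixed_volume (fun i => polar (phiL (L i))) =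
  (D^-1%:E * dual_mixed_volume (fun i => polar (L i)))%E.
Proof.
move=> LK; rewrite /dual_mixed_volume muleCA; congr (_ * _)%E.
have LphiK i : K0 n (phiL (L i)) by exact: K0_linear_image.
(* As powers with exponent [-1], the reciprocals are visibly measurable and multiplicative. *)
have radE (A : 'I_n -> set 'rV[R]_n) u : (forall i, K0 n (A i)) -> sphere n u ->
    \prod_(i < n) radial_fun (polar (A i)) u = \prod_(i < n) (support_fun (A i) u) `^ (-1).
  move=> KA Su; apply: eq_bigr => i _; have u0 := sphere_neq0 Su.
  by rewrite radial_fun_polar// powR_inv1// ltW// support_gt0.
pose g u := \prod_(i < n) (support_fun (L i) u) `^ (-1).
have mg : measurable_fun (sphere n) g.
  apply: measurable_prod => i _.
  exact: (measurableT_comp (measurable_powR _) (measurable_support_sphere (LK i))).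
have g0 u : 0 <= g u by apply: prodr_ge0 => i _; exact: powR_ge0.
have minv := measurable_inv_enorm_mulmx phi^T.
have mk : measurable_fun (sphere n) (fun u => (w u)^-1 ^+ n * g (T u)).
  apply: measurable_funM; last exact: measurable_comp_T.
  by apply: measurable_funTS; exact: measurable_funX.
have mkE : measurable_fun (sphere n) (fun u => ((w u)^-1 ^+ n * g (T u))%:E).
  exact/measurable_EFinP.
transitivity (\int[sigma]_(u in sphere n) ((w u)^-1 ^+ n * g (T u))%:E)%E.
  apply: eq_integral => u /set_mem Su; rewrite radE//; congr EFin.
  under eq_bigr => i _ do rewrite support_linear_imageE// powRM ?(ltW (w_gt0 Su)) ?ltW ?support_gt0 ?(sphere_neq0 (T_sphere Su))//.
  by rewrite big_split/= prodr_const card_ord powR_inv1 ?enorm_ge0.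
transitivity (D^-1%:E * \int[sigma]_(u in sphere n) (g u)%:E)%E; last first.
  by congr (_ * _)%E; apply: eq_integral => u /set_mem Su; rewrite radE.
rewrite (sphere_integral_linear phiTU mg)// det_tr.
under [in RHS]eq_integral do rewrite -mulrA EFinM.
rewrite ge0_integralZl//; last first.
  by move=> u _; rewrite lee_fin mulr_ge0// exprn_ge0// invr_ge0 enorm_ge0.
by rewrite muleA -EFinM mulVf ?mul1e// gt_eqF.
Qed.

Lemma mixed_Lp_volume_ge0 p (K L : 'I_n -> set 'rV[R]_n) :
  (0 <= mixed_Lp_volume p K L)%E.
Proof.
apply: mule_ge0 => //; apply: integral_ge0 => u _.
by rewrite lee_fin; apply: prodr_ge0 => i _; exact: powR_ge0.
Qed.

Lemma dual_mixed_volume_ge0 (L : 'I_n -> set 'rV[R]_n) : (forall i, K0 n (L i)) ->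
  (0 <= dual_mixed_volume (fun i => polar (L i)))%E.
Proof.
move=> LK; apply: mule_ge0 => //; apply: integral_ge0 => u Su.
rewrite lee_fin; apply: prodr_ge0 => i _; have u0 := sphere_neq0 Su.
by rewrite radial_fun_polar// invr_ge0 ltW// support_gt0.
Qed.

Lemma geominimal_values_linear alpha p (K : 'I_n -> set 'rV[R]_n) :
  p != - n%:R -> (forall i, F0 n (K i)) ->
  geominimal_values alpha p (fun i => phiL (K i)) =
  [set (D `^ ((n%:R - p) / (n%:R + p)))%:E * x | x in geominimal_values alpha p K]%E.
Proof.
move=> pn KF; set c := D `^ _.
have np : n%:R + p != 0 by rewrite addrC addr_eq0.
have D0 := ltW D_gt0.
have Dn0 : D != 0 by rewrite gt_eqF.
have DV0 : 0 < D^-1 by rewrite invr_gt0.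
(* The first factor comes from the mixed volume, which scales by [D], the second from the polar
   term, which scales by [D^-1]. *)
have cE : c = D `^ (n%:R / (n%:R + p)) * D^-1 `^ (p / (n%:R + p)).
  rewrite -[D^-1]powR_inv1// -powRrM -powRD; last by rewrite Dn0 implybT.
  by congr (_ `^ _); rewrite mulN1r -mulNr -mulrDl.
have KL (L : set 'rV[R]_n) : K0 n L -> K0 n (phiL L) /\ K0 n (linear_image (invmx phi) L).
  by move=> LK; split; apply: K0_linear_image; rewrite ?unitmx_inv.
have scale1 L P : (forall i, K0 n (L i)) -> (0 <= P)%E ->
   (n%:R%:E * epower (mixed_Lp_volume p (fun i => phiL (K i)) (fun i => phiL (L i)))
       (n%:R / (n%:R + p)) * epower (D^-1%:E * P) (p / (n%:R + p)) =
    c%:E * (n%:R%:E * epower (mixed_Lp_volume p K L) (n%:R / (n%:R + p)) *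
       epower P (p / (n%:R + p))))%E.
  move=> LK P0; rewrite mixed_Lp_volume_linear// epowerZ ?D_gt0 ?mixed_Lp_volume_ge0//.
  by rewrite (epowerZ _ DV0 P0) cE EFinM [(n%:R%:E * (_ * _))%E]muleCA muleACA.
have scale2 L (P : 'I_n -> \bar R) : (forall i, K0 n (L i)) -> (forall i, (0 <= P i)%E) ->
   (n%:R%:E * epower (mixed_Lp_volume p (fun i => phiL (K i)) (fun i => phiL (L i)))
       (n%:R / (n%:R + p)) *
     \prod_(i < n) epower (D^-1%:E * P i) (p / ((n%:R + p) * n%:R)) =
    c%:E * (n%:R%:E * epower (mixed_Lp_volume p K L) (n%:R / (n%:R + p)) *
     \prod_(i < n) epower (P i) (p / ((n%:R + p) * n%:R))))%E.
  move=> LK P0; rewrite mixed_Lp_volume_linear// epowerZ ?D_gt0 ?mixed_Lp_volume_ge0//.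
  under eq_bigr => i _ do rewrite (epowerZ _ DV0 (P0 i)).
  rewrite prode_constZ card_ord -powR_mulrn ?powR_ge0// -powRrM.
  (* The [n] polar volumes with exponent [p / ((n + p) n)] together scale like a single one with
     exponent [p / (n + p)]. *)
  rewrite (_ : p / ((n%:R + p) * n%:R) * n%:R = p / (n%:R + p)); last first.
    by rewrite invfM !mulrA divfK// pnatr_eq0.
  by rewrite cE EFinM [(n%:R%:E * (_ * _))%E]muleCA muleACA.
have LE (L : 'I_n -> set 'rV[R]_n) : (fun i => phiL (linear_image (invmx phi) (L i))) = L.
  by apply/funext => i; rewrite linear_imageK.
case: alpha; rewrite /geominimal_values.
- apply/seteqP; split=> [_ [L LK <-]|_ [_ [L LK <-] <-]].
    have [_ LK'] := KL L LK.
    eexists; first by exists (linear_image (invmx phi) L); [exact: LK'|reflexivity].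
    by rewrite -scale1// -lebesgue_polar_linear linear_imageK.
  have [LK' _] := KL L LK; exists (phiL L) => //.
  rewrite lebesgue_polar_linear.
  exact: (scale1 (fun=> L) _ (fun=> LK) (measure_ge0 _ _)).
- apply/seteqP; split=> [_ [L LK <-]|_ [_ [L LK <-] <-]].
    eexists; first by exists (fun i => linear_image (invmx phi) (L i));
      [move=> i; exact: (KL _ (LK i)).2|reflexivity].
    rewrite -scale2//; last by move=> i; exact: (KL _ (LK i)).2.
    rewrite LE; congr (_ * _)%E; apply: eq_bigr => i _.
    by rewrite -lebesgue_polar_linear linear_imageK.
  exists (fun i => phiL (L i)); first by move=> i; exact: (KL _ (LK i)).1.
  etransitivity; last first.
    exact: (scale2 L (fun i => lebesgue_rV R n (polar (L i))) LK (fun i => measure_ge0 _ _)).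
  by congr (_ * _)%E; apply: eq_bigr => i _; rewrite lebesgue_polar_linear.
- apply/seteqP; split=> [_ [L LK <-]|_ [_ [L LK <-] <-]].
    have LK' i := (KL _ (LK i)).2.
    eexists; first by exists (fun i => linear_image (invmx phi) (L i));
      [exact: LK'|reflexivity].
    rewrite -scale1 ?dual_mixed_volume_ge0// -dual_mixed_volume_linear// LE.
    by congr (_ * epower (dual_mixed_volume _) _)%E; apply/funext => i; rewrite linear_imageK.
  exists (fun i => phiL (L i)); first by move=> i; exact: (KL _ (LK i)).1.
  rewrite dual_mixed_volume_linear//.
  exact: (scale1 L _ LK (dual_mixed_volume_ge0 LK)).
Qed.

Lemma geominimal_linear alpha p (K : 'I_n -> set 'rV[R]_n) :
  p != - n%:R -> (forall i, F0 n (K i)) ->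
  geominimal alpha p (fun i => phiL (K i)) =
  ((D `^ ((n%:R - p) / (n%:R + p)))%:E * geominimal alpha p K)%E.
Proof.
move=> pn KF; rewrite /geominimal.
have [->|p0] := eqVneq p 0.
  (* For [p = 0] the exponent is 1, in agreement with the factor [D] of the integral. *)
  rewrite subr0 addr0 divff ?pnatr_eq0// powRr1 ?(ltW D_gt0)//.
  exact: geominimal0_linear.
rewrite geominimal_values_linear//.
(* A positive finite factor commutes with infimum and supremum in the extended reals, infinite
   values included. *)
have c0 : 0 < D `^ ((n%:R - p) / (n%:R + p)) by rewrite powR_gt0.
by case: ifP => _; [rewrite ereal_inf_pZl|rewrite ereal_sup_pZl].
Qed.

End geominimal_linear.

Theorem proposition4p1 (R : realType) (n : nat) (n_gt0 : (0 < n)%N)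
    (K : 'I_n -> set 'rV[R]_n) (KF0 : forall i, F0 n (K i))
    (phi : 'M[R]_n) (phiGL : phi \in unitmx) :
  (forall (alpha : geominimal_index) (p : R), p != - n%:R ->
     geominimal alpha p (fun i => linear_image phi (K i)) =
     ((`|\det phi| `^ ((n%:R - p) / (n%:R + p)))%:E * geominimal alpha p K)%E)
  /\
  (\det phi = 1 ->
   forall (alpha : geominimal_index) (p : R), p != - n%:R ->
     geominimal alpha p (fun i => linear_image phi (K i)) =
     geominimal alpha p K).
Proof.
case: n n_gt0 K KF0 phi phiGL => [|m] n_gt0 K KF0 phi phiGL.
  by exfalso; rewrite ltnn in n_gt0.
have lin := fun alpha p pn => @geominimal_linear R m phi phiGL alpha p K pn KF0.
split=> [|det1 alpha p pn]; first exact: lin.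
by rewrite lin// det1 normr1 powR1 mul1e.
Qed.
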